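(* Let $p\ge2$, $R=k[x_1,\dots,x_p]$, and let $M$ be a (nonzero) level artinian $R$-module (of codimension $p$), generated in degree zero, with the weak Lefschetz property, whose $h$-vector is the degree $c$ polynomial $h(t)=\sum_{i\in\mathbb{Z}}h_it^i$. Let $\ell$ be a Lefschetz element on $M$, $S=R/(\ell)$ with graded maximal ideal $\mathfrak{m}_S$, $s_i=\binom{p-2+i}{p-2}$, and let $u$ be the smallest non-negative integer such that $h_u\ge h_{u+1}$. Put $$F=\sum_{i=0}^{u}f_i\,\beta^S(S/\mathfrak{m}_S^{i+1}),\quad f_i=\frac{h_i-h_{i-1}}{s_i}-\frac{h_{i+1}-h_i}{s_{i+1}}\ (0\le i\le u-1),\quad f_u=\frac{h_u-h_{u-1}}{s_u},$$ $$G=\sum_{i=0}^{c-u}g_i\,\beta^S(S/\mathfrak{m}_S^{i+1}),\quad g_i=\frac{h_{c-i}-h_{c-i+1}}{s_i}-\frac{h_{c-i-1}-h_{c-i}}{s_{i+1}}\ (0\le i\le c-u-1),\quad g_{c-u}=\frac{h_u-h_{u+1}}{s_{c-u}}.$$ Then $f_i\ge0$ for $i=0,1,\dots,u$ and $g_i\ge0$ for $i=0,1,\dots,c-u$. Moreover, $\beta(M)$ is obtained by a sequence of consecutive cancellations from the diagram $E$ defined by $E_{i,j}=F_{i,j}+G_{p-i,p+c-j}$ for all integers $i,j$, and $E$ is a non-negative linear combination of pure diagrams of codimension $p$.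
   Context: $k$ is a field, rings are standard graded, all modules are finitely generated and graded. $\beta^A_{i,j}(M)=\dim_k\operatorname{Tor}^A_i(M,k)_j$, and $\beta^A(M)$ is the matrix (Betti diagram) of these numbers; for $A=R$ the superscript is omitted. The $h$-vector of an artinian $R$-module $M$ is $\sum_i(\dim_kM_i)t^i$. An artinian $R$-module is level if its minimal generators are concentrated in a single degree and its socle is concentrated in a single degree. It has the weak Lefschetz property if there is a (nonzero) linear form $\ell\in R$, called a Lefschetz element, such that for each $i$ the map $M_{i-1}\xrightarrow{\times\ell}M_i$ is injective or surjective. A diagram of codimension $p$ is a matrix $D=(D_{i,j})_{i,j\in\mathbb{Z}}$ of rational numbers with finitely many nonzero entries, with $D_{i,j}=0$ unless $0\le i\le p$, such that $\sum_{i,j}(-1)^iD_{i,j}t^j$ is divisible by $(1-t)^p$ in $\mathbb{Q}[t,t^{-1}]$. For a strictly increasing integer sequence $d=(d_0,\dots,d_p)$, $\pi(d)$ is the unique diagram of codimension $p$ with $\pi(d)_{i,j}=0$ whenever $j\ne d_i$ and $\pi(d)_{0,d_0}=1$ (pure diagram of type $d$). A non-negative linear combination of pure diagrams is a finite sum $\sum_da_d\pi(d)$ with $a_d\in\mathbb{Q}_{\ge0}$. $C^{k,l}$ ($0\le k\le p-1$) is the matrix with entry $1$ in positions $(k,l)$ and $(k+1,l)$ and $0$ elsewhere; $D'$ is obtained from $D$ by a sequence of consecutive cancellations if $D'=D-\sum_{i,j}b_{i,j}C^{i,j}$ with non-negative rational $b_{i,j}$ (finitely many nonzero) and $D'$ has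 non-negative entries. *)

(* Defs.v *)
From HB Require Import structures.
From Stdlib Require Import ClassicalEpsilon.
From mathcomp Require Import all_boot all_order all_algebra mpoly.

Set Implicit Arguments.
Unset Strict Implicit.
Unset Printing Implicit Defensive.

Import Order.TTheory GRing.Theory Num.Theory.
Local Open Scope ring_scope.
Local Open Scope quotient_scope.

Definition lspan (A : pzRingType) (V : lmodType A) (X : V -> Prop) (v : V) :
    Prop :=
  exists n (a : 'I_n -> A) (x : 'I_n -> V),
    (forall i, X (x i)) /\ v = \sum_(i < n) a i *: x i.

(* The ideal generated by X, with membership made boolean by excluded middle
   because generic_quotient needs a decidable equivalence. *)
Definition ideal (A : comPzRingType) (X : A -> Prop) : A -> bool :=
  fun a => if excluded_middle_informative (@lspan A A^o X a) then true
           else false.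

Lemma idealP (A : comPzRingType) (X : A -> Prop) (a : A) :
  reflect (@lspan A A^o X a) (ideal X a).
Proof.
by rewrite /ideal; case: excluded_middle_informative => h; constructor.
Qed.

Lemma lspanD (A : pzRingType) (V : lmodType A) (X : V -> Prop) (u v : V) :
  lspan X u -> lspan X v -> lspan X (u + v).
Proof.
move=> [m [a [x [Xx ->]]]] [n [b [y [Xy ->]]]].
exists (m + n)%N,
  (fun i => match split i with inl j => a j | inr j => b j end),
  (fun i => match split i with inl j => x j | inr j => y j end).
split=> [i|]; first by case: (split i).
rewrite big_split_ord /=; congr (_ + _); apply: eq_bigr => i _.
  by rewrite (unsplitK (inl i)).
by rewrite (unsplitK (inr i)).
Qed.

Lemma lspanZ (A : pzRingType) (V : lmodType A) (X : V -> Prop) (c : A)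
  (v : V) : lspan X v -> lspan X (c *: v).
Proof.
move=> [m [a [x [Xx ->]]]]; exists m, (fun i => c * a i), x; split=> //.
by rewrite scaler_sumr; apply: eq_bigr => i _; rewrite scalerA.
Qed.

Lemma ideal_zmod_closed (A : comPzRingType) (X : A -> Prop) :
  zmod_closed (ideal X).
Proof.
split=> [|a b /idealP Xa /idealP Xb]; apply/idealP.
  exists 0%N, (fun=> 0), (fun=> 0); split; first by case.
  by rewrite big_ord0.
by apply: lspanD => //; rewrite -mulN1r; apply: (@lspanZ A A^o).
Qed.

Definition ideal_zmodClosed (A : comPzRingType) (X : A -> Prop) :
    zmodClosed A :=
  HB.pack (ideal X)
    (GRing.isZmodClosed.Build A (ideal X) (ideal_zmod_closed X)).

Lemma idealM (A : comPzRingType) (X : A -> Prop) (a b : A) :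
  b \in ideal X -> a * b \in ideal X.
Proof. by move=> /idealP Xb; apply/idealP; apply: (@lspanZ A A^o). Qed.

(* The quotient of A by the ideal generated by X, as a ring and as an
   A-module.  The {ideal_quot _} of MathComp is not used because it requires a
   proof that the ideal is proper. *)
Section Quotient.
Variables (A : comPzRingType) (X : A -> Prop).

Definition quo : Type := {ideal_quot ideal_zmodClosed X}.

HB.instance Definition _ := Choice.on quo.
HB.instance Definition _ := GRing.Zmodule.on quo.

Definition proj (a : A) : quo := \pi_({ideal_quot ideal_zmodClosed X}) a.

Lemma proj_eq (a b : A) : (proj a = proj b) <-> (a - b \in ideal X).
Proof.
by rewrite (Quotient.idealrBE (ideal_zmodClosed X)); split=> [/eqP|/eqP].
Qed.

Lemma proj_surj (q : quo) : exists a, q = proj a.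
Proof. by exists (repr q); rewrite /proj reprK. Qed.

Lemma proj_zmod_morphism : zmod_morphism proj.
Proof. exact: pi_is_zmod_morphism. Qed.

Definition quo_one : quo := proj 1.
Definition quo_mul (q r : quo) : quo := proj (repr q * repr r).

Lemma quo_mulE (a b : A) : quo_mul (proj a) (proj b) = proj (a * b).
Proof.
rewrite /quo_mul; set a' := repr (proj a); set b' := repr (proj b).
have Ha : a' - a \in ideal X by apply/proj_eq; rewrite /proj reprK.
have Hb : b' - b \in ideal X by apply/proj_eq; rewrite /proj reprK.
apply/proj_eq.
have -> : a' * b' - a * b = b' * (a' - a) + a * (b' - b).
  by rewrite !mulrBr (mulrC b' a') (mulrC b' a) addrA subrK.
by apply: (rpredD (S := ideal_zmodClosed X)); apply: idealM.
Qed.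

Fact quo_mulA : associative quo_mul.
Proof.
move=> x y z; case: (proj_surj x) (proj_surj y) (proj_surj z).
by move=> a -> [b ->] [c ->]; rewrite !quo_mulE mulrA.
Qed.

Fact quo_mulC : commutative quo_mul.
Proof.
move=> x y; case: (proj_surj x) (proj_surj y) => a -> [b ->].
by rewrite !quo_mulE mulrC.
Qed.

Fact quo_mul1 : left_id quo_one quo_mul.
Proof. by move=> x; case: (proj_surj x) => a ->; rewrite quo_mulE mul1r. Qed.

Lemma projD (a b : A) : proj (a + b) = proj a + proj b.
Proof.
have projN c : proj (- c) = - proj c.
  have := proj_zmod_morphism 0 c; rewrite sub0r => ->.
  have := proj_zmod_morphism 0 0; rewrite subrr => ->.
  by rewrite subrr sub0r.
by have := proj_zmod_morphism a (- b); rewrite opprK projN opprK.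
Qed.

Fact quo_mulDl : left_distributive quo_mul +%R.
Proof.
move=> x y z; case: (proj_surj x) (proj_surj y) (proj_surj z).
by move=> a -> [b ->] [c ->]; rewrite -projD !quo_mulE -projD mulrDl.
Qed.

HB.instance Definition _ := GRing.Zmodule_isComPzRing.Build quo
  quo_mulA quo_mulC quo_mul1 quo_mulDl.

Lemma proj_monoid_morphism : monoid_morphism proj.
Proof. by split=> // a b; rewrite -quo_mulE. Qed.

HB.instance Definition _ := GRing.isZmodMorphism.Build A quo proj
  proj_zmod_morphism.
HB.instance Definition _ := GRing.isMonoidMorphism.Build A quo proj
  proj_monoid_morphism.

Definition quo_scale (a : A) (q : quo) : quo := proj a * q.

Fact quo_scaleA a b q : quo_scale a (quo_scale b q) = quo_scale (a * b) q.
Proof. by rewrite /quo_scale mulrA rmorphM. Qed.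
Fact quo_scale1 : left_id 1 quo_scale.
Proof. by move=> q; rewrite /quo_scale rmorph1 mul1r. Qed.
Fact quo_scaleDr : right_distributive quo_scale +%R.
Proof. by move=> a q r; rewrite /quo_scale mulrDr. Qed.
Fact quo_scaleDl q : {morph quo_scale^~ q : a b / a + b}.
Proof. by move=> a b; rewrite /quo_scale rmorphD mulrDl. Qed.

HB.instance Definition _ := GRing.Zmodule_isLmodule.Build A quo
  quo_scaleA quo_scale1 quo_scaleDr quo_scaleDl.

End Quotient.

(* Raw data of a graded k-algebra: ghom j is the set of homogeneous elements
   of degree j (0 included).  The axioms of a grading are not part of the
   record; only polynomial_ring and quotients of it by a linear form occur. *)
Record gring (k : fieldType) := MkGring {
  gring_sort :> comPzRingType;
  gunit : {rmorphism k -> gring_sort};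
  ghom : int -> gring_sort -> Prop
}.

Definition polynomial_ring (k : fieldType) (p : nat) : gring k :=
  @MkGring k {mpoly k[p]} (@mpolyC p k)
    (fun j f => match j with Posz d => f \is d.-homog | Negz _ => f = 0 end).

Definition quotient_ring (k : fieldType) (A : gring k) (X : A -> Prop) :
    gring k :=
  @MkGring k (quo X) (@proj A X \o gunit A : {rmorphism k -> quo X})
    (fun j q => exists2 a, ghom j a & q = proj X a).

Definition irrelevant (k : fieldType) (A : gring k) (a : A) : Prop :=
  @lspan A A^o (fun b => exists2 j : int, 0 < j & ghom j b) a.

Fixpoint ideal_pow (A : comPzRingType) (I : A -> Prop) (n : nat) (a : A) :
    Prop :=
  if n is m.+1 then
    @lspan A A^o (fun b => exists x y, [/\ I x, ideal_pow I m y & b = x * y]) a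
  else True.

(* Raw data of a graded module; the axioms are in is_graded. *)
Record gmod (k : fieldType) (A : gring k) := MkGmod {
  gmod_sort :> lmodType A;
  mhom : int -> gmod_sort -> Prop
}.

Definition quotient_module (k : fieldType) (A : gring k) (X : A -> Prop) :
    gmod A :=
  @MkGmod k A (quo X) (fun j q => exists2 a, ghom j a & q = proj X a).

Definition residue_field (k : fieldType) (A : gring k) : gmod A :=
  quotient_module (@irrelevant k A).

Section Modules.
Variables (k : fieldType) (A : gring k).
Implicit Types M N : gmod A.

Definition is_graded M : Prop :=
  [/\ forall j : int, mhom j (0 : M)
        /\ (forall x y : M, mhom j x -> mhom j y -> mhom j (x - y)),
      forall (i j : int) (a : A) (x : M),
        ghom i a -> mhom j x -> mhom (i + j) (a *: x),
      forall x : M, exists (s : seq int) (f : int -> M),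
        (forall j, mhom j (f j)) /\ x = \sum_(j <- s) f j
    & forall (s : seq int) (f : int -> M), uniq s ->
        (forall j, mhom j (f j)) -> \sum_(j <- s) f j = 0 ->
        forall j, j \in s -> f j = 0].

Definition generates M (X : M -> Prop) : Prop := forall x : M, lspan X x.

Definition finitely_generated M : Prop :=
  exists n (g : 'I_n -> M), generates (fun x => exists i, x = g i).

Definition minimal_generators M n (g : 'I_n -> M) : Prop :=
  generates (fun x => exists i, x = g i)
  /\ forall i, ~ generates (fun x => exists2 j, j != i & x = g j).

Definition is_submodule M (N : M -> Prop) : Prop :=
  N 0 /\ forall (a : A) (x y : M), N x -> N y -> N (a *: x + y).

Definition artinian M : Prop :=
  forall N : nat -> M -> Prop, (forall n, is_submodule (N n)) ->
    (forall n x, N n.+1 x -> N n x) ->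
    exists n0, forall n, (n0 <= n)%N -> forall x, N n0 x -> N n x.

Definition socle M (x : M) : Prop :=
  forall a : A, irrelevant a -> a *: x = 0.

Definition level M : Prop :=
  (exists d : int, forall n (g : 'I_n -> M), minimal_generators g ->
     (forall i, exists j, mhom j (g i)) -> forall i, mhom d (g i))
  /\ (exists s : int, forall x : M, socle x -> mhom s x).

Definition lefschetz_element M (l : A) : Prop :=
  [/\ l != 0, ghom 1 l
    & forall i : int,
        (forall x y : M, mhom (i - 1) x -> mhom (i - 1) y ->
           l *: x = l *: y -> x = y)
        \/ (forall y : M, mhom i y -> exists2 x, mhom (i - 1) x & y = l *: x)].

Definition weak_lefschetz M : Prop := exists l, lefschetz_element M l.

(* dim_k (Z / B) = n for k-subspaces B of Z of an A-module. *)
Definition has_dim (V : lmodType A) (Z B : V -> Prop) (n : nat) : Prop :=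
  exists b : 'I_n -> V, (forall i, Z (b i)) /\
    forall z, Z z ->
      exists! c : 'rV[k]_n, B (z - \sum_(i < n) gunit A (c 0 i) *: b i).

(* A complex of graded free modules F_i = \bigoplus_b A(- fdeg b), with b in
   'I_(rk i); elements of F_i are row vectors, and fdiff i is the matrix of
   F_{i+1} -> F_i acting on the right. *)
Record free_complex := FreeComplex {
  rk : nat -> nat;
  fdeg : forall i, 'I_(rk i) -> int;
  fdiff : forall i, 'M[A]_(rk i.+1, rk i)
}.

Definition augment N (F : free_complex) (e : 'I_(rk F 0) -> N)
    (v : 'rV[A]_(rk F 0)) : N := \sum_b v 0 b *: e b.

Definition free_resolution N (F : free_complex) (e : 'I_(rk F 0) -> N) :
    Prop :=
  [/\ (forall i a b, ghom (fdeg a - fdeg b) (fdiff F i a b))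
        /\ (forall b, mhom (fdeg b) (e b)),
      forall x : N, exists v, x = augment e v,
      forall v, augment e v = 0 <-> exists w, v = w *m fdiff F 0
    & forall i (v : 'rV[A]_(rk F i.+1)),
        v *m fdiff F i = 0 <-> exists w, v = w *m fdiff F i.+1].

(* M (x) F_i is identified with M ^ (rk i). *)
Definition tensor_diff M (F : free_complex) i
    (m : {ffun 'I_(rk F i.+1) -> M}) : {ffun 'I_(rk F i) -> M} :=
  [ffun b => \sum_a fdiff F i a b *: m a].

Definition tensor_hom M (F : free_complex) i (j : int)
    (m : {ffun 'I_(rk F i) -> M}) : Prop :=
  forall b, mhom (j - fdeg b) (m b).

Definition cycles M (F : free_complex) i (j : int) :
    {ffun 'I_(rk F i) -> M} -> Prop :=
  match i with
  | 0 => fun m => tensor_hom j m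
  | _.+1 => fun m => tensor_hom j m /\ tensor_diff m = 0
  end.

Definition boundaries M (F : free_complex) i (j : int)
    (m : {ffun 'I_(rk F i) -> M}) : Prop :=
  exists2 w : {ffun 'I_(rk F i.+1) -> M}, tensor_hom j w & m = tensor_diff w.

(* dim_k Tor_i(M, N)_j, with Tor_i(M, -) the left derived functor of
   M (x) -; independent of the resolution of N. *)
Definition tor_dim M N (i : nat) (j : int) : nat :=
  epsilon (inhabits 0%N) (fun n =>
    exists (F : free_complex) (e : 'I_(rk F 0) -> N),
      free_resolution e /\ has_dim (@cycles M F i j) (@boundaries M F i j) n).

Definition betti M (i j : int) : rat :=
  match i with
  | Posz n => (tor_dim M (residue_field A) n j)%:R
  | Negz _ => 0
  end.

End Modules.

Definition hcoef (h : {poly nat}) (i : int) : nat :=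
  match i with Posz n => (h`_n)%R | Negz _ => 0%N end.

Definition has_hvector (k : fieldType) (A : gring k) (M : gmod A)
    (h : {poly nat}) : Prop :=
  forall i : int, has_dim (@mhom k A M i) (fun x => x = 0) (hcoef h i).

Definition diagram : Type := int -> int -> rat.

(* The divisibility condition is stated after multiplying the Laurent
   polynomial by the unit t ^ N of Q[t, 1/t], for N large. *)
Definition is_diagram (p : nat) (D : diagram) : Prop :=
  (forall i j : int, ~~ (0 <= i <= p%:Z) -> D i j = 0)
  /\ exists N : nat,
       (forall i j : int, N%:Z < `|j| -> D i j = 0)
       /\ (1 - 'X) ^+ p %|
            \poly_(n < N.*2.+1)
              (\sum_(i < p.+1) (-1) ^+ i * D i%:Z (n%:Z - N%:Z)).

Definition strictly_increasing (p : nat) (d : 'I_p.+1 -> int) : Prop :=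
  forall i i' : 'I_p.+1, (i < i')%N -> d i < d i'.

Definition is_pure_diagram (p : nat) (d : 'I_p.+1 -> int) (D : diagram) :
    Prop :=
  [/\ is_diagram p D,
      forall (i : 'I_p.+1) (j : int), j <> d i -> D (i : nat)%:Z j = 0
    & D 0 (d ord0) = 1].

Definition nonneg_pure_combination (p : nat) (E : diagram) : Prop :=
  exists (n : nat) (d : 'I_n -> 'I_p.+1 -> int) (P : 'I_n -> diagram)
         (a : 'I_n -> rat),
    (forall m, [/\ strictly_increasing (d m), is_pure_diagram (d m) (P m)
                 & 0 <= a m])
    /\ forall i j, E i j = \sum_(m < n) a m * P m i j.

Definition cancellation_matrix (q l : int) : diagram :=
  fun i j => (((i == q) || (i == q + 1)) && (j == l))%:R.

Definition consecutive_cancellations (p : nat) (D D' : diagram) : Prop :=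
  exists (s : seq ('I_p * int)) (b : 'I_p -> int -> rat),
    [/\ uniq s, forall q l, 0 <= b q l,
        forall i j, D' i j = D i j
          - \sum_(x <- s) b x.1 x.2 * cancellation_matrix x.1%:Z x.2 i j
      & forall i j, 0 <= D' i j].

Section Coefficients.
Variables (p : nat) (h : {poly nat}) (c u : nat).
Let H (i : int) : rat := (hcoef h i)%:R.
Let s (i : nat) : rat := ('C(p - 2 + i, p - 2))%:R.

Definition fcoef (i : nat) : rat :=
  if (i < u)%N then
    (H i%:Z - H (i%:Z - 1)) / s i - (H (i%:Z + 1) - H i%:Z) / s i.+1
  else (H u%:Z - H (u%:Z - 1)) / s u.

Definition gcoef (i : nat) : rat :=
  if (i < c - u)%N then
    (H (c%:Z - i%:Z) - H (c%:Z - i%:Z + 1)) / s i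
    - (H (c%:Z - i%:Z - 1) - H (c%:Z - i%:Z)) / s i.+1
  else (H u%:Z - H (u%:Z + 1)) / s (c - u)%N.

Variables (k : fieldType) (S : gring k).
Let B (i : nat) : diagram :=
  betti (quotient_module (ideal_pow (@irrelevant k S) i.+1)).

Definition Fdiag : diagram := fun i j => \sum_(m < u.+1) fcoef m * B m i j.
Definition Gdiag : diagram :=
  fun i j => \sum_(m < (c - u).+1) gcoef m * B m i j.
Definition Ediag : diagram :=
  fun i j => Fdiag i j + Gdiag (p%:Z - i) ((p + c)%:Z - j).

End Coefficients.

(* Main.v *)
(* The Betti numbers of a graded module M over k[x_0..x_(n+1)] with Hilbert
   function h are 'C(n+2, q) h_d minus the ranks of the two Koszul differentials
   that enter and leave the strand d = j - q.  After a change of coordinates l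
   is a variable, and splitting it off makes the Koszul differential block
   triangular: its rank is at least 'C(n+1, q) rank (l : M_(d-1) -> M_d) plus
   the ranks of the Koszul differentials of coker l and of ker l over
   S = R / (l).  M is generated in degree 0, so coker l is generated in degree 0
   and a basis of standard monomials bounds the rank from below by its value
   for a direct sum of truncations S / m^(i+1); since the socle of M is
   concentrated in degree c, the dual of ker l is treated in the same way.  In
   exterior degree n + 1 the same bound says f_i >= 0 and g_i >= 0.  The
   differences between the actual and the least ranks are the coefficients of
   the consecutive cancellations.

   For pure diagrams, write the entries of S / m^(i+1) as products of
   differences of degrees.  The sum of the diagram of one truncation and the
   dual of another, both divided by the length, is a telescoping sum of pure
   diagrams whose degree sequences switch from the degrees of the first to
   those of the second; the total lengths in F and in G are both h_u. *)

Require Import Defs.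
From Stdlib Require Import ClassicalEpsilon.
From mathcomp Require Import all_boot all_order all_algebra mpoly.
From mathcomp Require Import ring lra zify.

Set Implicit Arguments.
Unset Strict Implicit.
Unset Printing Implicit Defensive.

Import Order.TTheory GRing.Theory Num.Theory.
Local Open Scope ring_scope.

(** * Ranks of Koszul differentials *)

(** [tor_dim] is a value produced by some free resolution of the residue field, so independence of
    the resolution has to be proved before the Koszul complex may be used. That complex is shown to
    be exact without the Euler homotopy, whose division by degrees fails in positive characteristic:
    the rank bound [koszul_rank_ge], applied to the polynomial ring itself, already makes two
    consecutive ranks fill the dimension between them. The bound is therefore sharp for the
    polynomial ring and for its truncations, and this is why the truncations S / m^(i+1) are the
    extremal modules.

    The bound comes from double counting over standard monomials; its factor (m+1) / (m+1+q)
    compares the degree of the monomial with the total degree that includes the exterior part.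

    E is the Betti diagram that would result if all Koszul ranks were least. One Koszul rank is
    subtracted in two adjacent columns and in the same internal degree j, so each excess over the
    least rank is exactly one consecutive cancellation. *)

Section FiniteIndexMatrices.
Variable k : fieldType.
Implicit Types I J K P : finType.

Definition fmx I J (F : I -> J -> k) : 'M[k]_(#|I|, #|J|) :=
  \matrix_(i, j) F (enum_val i) (enum_val j).

Definition frank I J (F : I -> J -> k) : nat := \rank (fmx F).

Lemma sum_enum_val I (V : nmodType) (f : I -> V) :
  \sum_i f i = \sum_(i < #|I|) f (enum_val i).
Proof. by rewrite (reindex _ (onW_bij _ (@enum_val_bij I))). Qed.

Lemma fmx_mul I J K (F : I -> J -> k) (G : J -> K -> k) :
  fmx F *m fmx G = fmx (fun i l => \sum_j F i j * G j l).
Proof.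
apply/matrixP=> i l; rewrite !mxE [RHS]sum_enum_val.
by apply: eq_bigr => j _; rewrite !mxE.
Qed.

Lemma eq_fmx I J (F G : I -> J -> k) : F =2 G -> fmx F = fmx G.
Proof. by move=> FG; apply/matrixP=> i j; rewrite !mxE FG. Qed.

Lemma eq_frank I J (F G : I -> J -> k) : F =2 G -> frank F = frank G.
Proof. by move=> FG; rewrite /frank (eq_fmx FG). Qed.

(** [G] factors through [F]. Lower bounds on ranks are obtained by exhibiting a [G] of known rank
    that consists of values of [F] on test rows and test columns. *)
Lemma frank_le I J I' J' (F : I -> J -> k) (G : I' -> J' -> k)
    (L : I' -> I -> k) (R : J -> J' -> k) :
  (forall i' j', G i' j' = \sum_i \sum_j L i' i * F i j * R j j') ->
  (frank G <= frank F)%N.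
Proof.
move=> GE; have -> : frank G = \rank (fmx L *m (fmx F *m fmx R)).
  rewrite !fmx_mul; apply: eq_frank => i' j'; rewrite GE.
  by apply: eq_bigr => i _; rewrite mulr_sumr; apply: eq_bigr => j _; rewrite mulrA.
by rewrite mulmxA (leq_trans (mxrankM_maxl _ _)) // mxrankM_maxr.
Qed.

Lemma frank_sub I J I' J' (F : I -> J -> k) (f : I' -> I) (g : J' -> J) :
  (frank (fun i j => F (f i) (g j)) <= frank F)%N.
Proof.
apply: (@frank_le _ _ _ _ _ _ (fun i' i => (i == f i')%:R)
  (fun j j' => (j == g j')%:R)) => i' j'.
rewrite (bigD1 (f i')) //= (bigD1 (g j')) //= !eqxx mul1r mulr1 !big1 ?addr0 //.
- by move=> i /negPf ne; rewrite big1 // => j _; rewrite ne !mul0r.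
- by move=> j /negPf ne; rewrite ne mulr0.
Qed.

Lemma frank_tr I J (F : I -> J -> k) : frank (fun j i => F i j) = frank F.
Proof.
by rewrite /frank -mxrank_tr; congr (\rank _); apply/matrixP=> i j; rewrite !mxE.
Qed.

(* Q is triangular with non-zero diagonal for the preorder pulled back from T,
   so the vector of coefficients of a relation vanishes, starting from the
   largest key. *)
Lemma frank_triangular d (T : orderType d) P (key : P -> T)
    (Q : P -> P -> k) :
  (forall x, Q x x != 0) ->
  (forall x y, x != y -> Q x y != 0 -> (key y < key x)%O) -> frank Q = #|P|.
Proof.
move=> Q1 Qlt; apply/eqP/inj_row_free => v vQ; apply/rowP => i0.
rewrite mxE; apply/eqP/negPn/negP => vi0.
pose a (x : P) := v 0 (enum_rank x).
have aQ y : \sum_x a x * Q x y = 0.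
  have := congr1 (fun w : 'rV_#|P| => w 0 (enum_rank y)) vQ; rewrite [RHS]mxE => EQ.
  rewrite -[RHS]EQ mxE sum_enum_val; apply: eq_bigr => i _.
  by rewrite /a !mxE enum_valK enum_rankK.
have ai0 : a (enum_val i0) != 0 by rewrite /a enum_valK.
case: (@Order.TotalTheory.arg_maxP _ _ _ _ (fun x => a x != 0) key ai0) => x ax xmax.
have := aQ x; rewrite (bigD1 x) //= big1 ?addr0.
  by move/eqP; rewrite mulf_eq0 (negPf ax) (negPf (Q1 x)).
move=> y yx; apply/eqP/negPn/negP.
rewrite mulf_eq0 negb_or => /andP[ay Qyx].
by have := Qlt _ _ yx Qyx; rewrite ltNge; have /= -> := xmax y ay.
Qed.

End FiniteIndexMatrices.

Section Koszul.
Variables (k : fieldType) (n : nat) (s : 'I_n -> {set 'I_n} -> k).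

(* The part of the Koszul differential that starts in exterior degree r, for
   the multiplication maps Y v; no compatibility of the signs s is required. *)
Definition kmx r c' c (Y : 'I_n -> 'M[k]_(c', c))
    (i : {set 'I_n} * 'I_c') (j : {set 'I_n} * 'I_c) : k :=
  if #|i.1| == r then
    \sum_(v in i.1) (j.1 == i.1 :\ v)%:R * (s v i.1 * Y v i.2 j.2)
  else 0.

(** The test row [x] is placed at the set T' and the test column [z] at T; only the elements whose
    removal turns T' into T contribute. *)
Lemma kmx_bilinear r c' c (Y : 'I_n -> 'M[k]_(c', c)) T' T
    (x : 'rV_c') (z : 'cV_c) :
  \sum_i \sum_j ((i.1 == T')%:R * x 0 i.2) * kmx r Y i j
     * ((j.1 == T)%:R * z j.2 0) =
  if #|T'| == r then
    \sum_(v in T') (T == T' :\ v)%:R * (s v T' * (x *m Y v *m z) 0 0)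
  else 0.
Proof.
transitivity (\sum_a \sum_b x 0 a * kmx r Y (T', a) (T, b) * z b 0).
  have pairE (A B : finType) (f : A * B -> k) : \sum_i f i = \sum_a \sum_b f (a, b).
    by rewrite pair_bigA /=; apply: eq_bigr => -[].
  rewrite pairE (bigD1 T') //= [X in _ + X]big1 ?addr0.
    apply: eq_bigr => a _; rewrite pairE (bigD1 T) //= [X in _ + X]big1 ?addr0.
      by apply: eq_bigr => b _; rewrite !eqxx !mul1r.
    by move=> U /negPf ne; rewrite big1 // => b _; rewrite ne !mul0r mulr0.
  move=> U /negPf ne; rewrite big1 // => a _; rewrite big1 // => j _.
  by rewrite ne !mul0r.
rewrite /kmx /=; case: ifP => _; last first.
  by rewrite big1 // => a _; rewrite big1 // => b _; rewrite mulr0 mul0r.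
under eq_bigr => a _ do under eq_bigr => b _ do rewrite mulr_sumr mulr_suml.
under eq_bigr => a _ do rewrite exchange_big /=.
rewrite exchange_big /=; apply: eq_bigr => v _.
rewrite exchange_big /= !mxE !mulr_sumr; apply: eq_bigr => b _.
rewrite !mxE mulr_suml !mulr_sumr; apply: eq_bigr => a _.
by ring.
Qed.

End Koszul.

(** * Standard monomials and the rank lower bound *)

Definition monomial n m := {b : 'X_{1..n < m.+1} | mdeg b == m}.

Definition mnm_of n m (b : monomial n m) : 'X_{1..n} := bmnm (val b).

Lemma mnm_of_inj n m : injective (@mnm_of n m).
Proof. by move=> x y exy; apply/val_inj/val_inj. Qed.

Lemma mdeg_mnm_of n m (b : monomial n m) : mdeg (mnm_of b) = m.
Proof. by apply/eqP; exact: (valP b). Qed.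

Lemma monomial_exists n m (a : 'X_{1..n}) :
  mdeg a = m -> exists b : monomial n m, mnm_of b = a.
Proof.
move=> da; have lt : (mdeg a < m.+1)%N by rewrite da.
have P : mdeg (BMultinom lt) == m by rewrite /= da.
by exists (exist _ (BMultinom lt) P).
Qed.

Definition mset n (T : {set 'I_n}) : 'X_{1..n} := [multinom (i \in T : nat) | i < n].

Lemma mdeg_mset n (T : {set 'I_n}) : mdeg (mset T) = #|T|.
Proof.
rewrite mdegE -sum1_card [RHS]big_mkcond /=; apply: eq_bigr => i _.
by rewrite mnmE; case: (i \in T).
Qed.

Section StandardMonomials.
Variables (k : fieldType) (n m r c : nat) (w : 'X_{1..n} -> 'I_r -> 'rV[k]_c).
Hypothesis w_separates : forall z : 'cV[k]_c,
  (forall b rho, mdeg b = m -> w b rho *m z = 0) -> z = 0.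

Definition mindex := (monomial n m * 'I_r)%type.

Definition mkey (x : mindex) : ('X_{1..n} *l 'I_r)%type := (mnm_of x.1, x.2).

Let W (x : mindex) := w (mnm_of x.1) x.2.

Definition mprefix (x : mindex) := (\sum_(y | (mkey y < mkey x)%O) <<W y>>)%MS.

(** Standard in the sense of Groebner bases: the image of the monomial is no combination of the
    images of smaller ones, in an order that compares monomials before generators. *)
Definition standard (x : mindex) := ~~ (W x <= mprefix x)%MS.

(** A functional that kills the images of all smaller monomials and does not kill the image of a
    standard one: a column of the cokernel matrix of their span. The default 0 is reached only for
    non-standard [x]. *)
Definition leading (x : mindex) : 'cV[k]_c :=
  if [pick j | (W x *m cokermx (mprefix x)) 0 j != 0] is Some j
  then col j (cokermx (mprefix x)) else 0.

Lemma leading_neq0 x : standard x -> (W x *m leading x) 0 0 != 0.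
Proof.
rewrite /standard /leading submxE => ne; case: pickP => [j|all0].
  by rewrite colE mulmxA -colE [X in _ -> X != 0]mxE.
case/negP: ne; apply/eqP/rowP => j; rewrite [RHS]mxE.
by have /negPn/eqP := negbT (all0 j).
Qed.

Lemma leading_eq0 x y : (mkey y < mkey x)%O -> (W y *m leading x) 0 0 = 0.
Proof.
move=> yx; have : (W y <= mprefix x)%MS.
  by rewrite -genmxE /mprefix (sumsmx_sup y).
rewrite submxE /leading => /eqP W0; case: pickP => [j _|_].
  by rewrite colE mulmxA W0 mul0mx mxE.
by rewrite mulmx0 mxE.
Qed.

(** A smallest monomial outside the span would not be standard, hence would be a combination of
    smaller ones, which all lie inside. *)
Lemma standard_spans x : (W x <= \sum_(y | standard y) <<W y>>)%MS.
Proof.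
apply/negPn/negP => nx.
case: (@Order.TotalTheory.arg_minP _ _ _ _
  (fun x => ~~ (W x <= \sum_(y | standard y) <<W y>>)%MS) mkey nx) => y /negP ny miny.
case: (boolP (standard y)) => [sy|].
  by apply: ny; rewrite -genmxE (sumsmx_sup y).
rewrite negbK => sub; apply: ny; apply: submx_trans sub _.
apply/sumsmx_subP => z zy; rewrite genmxE; apply/negPn/negP => nz.
by move: (miny z nz) => /=; rewrite leNgt zy.
Qed.

Lemma card_standard : (c <= #|[pred x | standard x]|)%N.
Proof.
have full : row_full (\sum_(y | standard y) <<W y>>)%MS.
  rewrite -cokermx_eq0; apply/eqP/matrixP => i j; rewrite [RHS]mxE.
  set S := (\sum_(y | _) _)%MS.
  have : col j (cokermx S) = 0.
    apply: w_separates => b rho /monomial_exists[x xb].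
    have := standard_spans (x, rho); rewrite submxE /W /= xb => /eqP W0.
    by rewrite colE mulmxA W0 mul0mx.
  by move/colP/(_ i); rewrite !mxE.
rewrite -(eqP full) -sum1_card.
apply: (@big_ind2 _ _ (fun (A : 'M_c) d => (\rank A <= d)%N)).
- by rewrite mxrank0.
- move=> A d B e dA eB.
  by apply: leq_trans (leq_add dA eB); have [] := mxrank_adds_leqif A B.
- by move=> x _; rewrite genmxE rank_leq_row.
Qed.

End StandardMonomials.

Lemma card_sets_avoiding n q (v : 'I_n.+1) :
  #|[set T : {set 'I_n.+1} | (#|T| == q) && (v \notin T)]| = 'C(n, q).
Proof.
have -> : 'C(n, q) = 'C(#|[set~ v]|, q) by rewrite cardsC1 card_ord.
rewrite -cards_draws; apply: eq_card => T; rewrite !inE andbC; congr (_ && _).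
by rewrite subsetC sub1set inE.
Qed.

Section KoszulRankLowerBound.
Variables (k : fieldType) (n r c' c m q : nat).
Variable s : 'I_n.+1 -> {set 'I_n.+1} -> k.
Variable Y : 'I_n.+1 -> 'M[k]_(c', c).
Variable w' : 'X_{1..n.+1} -> 'I_r -> 'rV[k]_c'.
Variable w : 'X_{1..n.+1} -> 'I_r -> 'rV[k]_c.
Hypothesis s_neq0 : forall v (T : {set 'I_n.+1}), v \in T -> s v T != 0.
Hypothesis wY : forall b rho v, mdeg b = m -> w' b rho *m Y v = w (b + U_(v))%MM rho.
Hypothesis w_separates : forall z : 'cV[k]_c,
  (forall b rho, mdeg b = m.+1 -> w b rho *m z = 0) -> z = 0.

Local Notation X := ({set 'I_n.+1} * (monomial n.+1 m.+1 * 'I_r))%type.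

Let basis (x : X) := (#|x.1| == q) && standard w x.2.

Fact total_degree_bound (x : X) :
  (mdeg (mnm_of x.2.1 + mset x.1)%MM < (m.+1 + n.+1).+1)%N.
Proof.
rewrite ltnS mdegD mdeg_mnm_of leq_add2l mdeg_mset.
by rewrite (leq_trans (max_card _)) ?card_ord.
Qed.

(* The multidegree, together with the index of the generator. *)
Let deg (x : X) : 'X_{1..n.+1 < (m.+1 + n.+1).+1} * 'I_r :=
  (BMultinom (total_degree_bound x), x.2.2).

Let avoiding y v := #|[pred x | [&& basis x, deg x == y & v \notin x.1]]|.

(** A variable of the multidegree that is avoided at least as often as the average, where each
    variable is weighted by its exponent. A maximiser of [avoiding] among the variables that occur
    has this property, so every multidegree of positive degree has a pivot. *)
Let good (y : 'X_{1..n.+1 < (m.+1 + n.+1).+1} * 'I_r) v :=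
  (0 < bmnm y.1 v)%N &&
  (\sum_u bmnm y.1 u * avoiding y u <= mdeg (bmnm y.1) * avoiding y v)%N.

Let pivot y := odflt ord0 [pick v | good y v].

Let pivotP y : (0 < mdeg (bmnm y.1))%N -> good y (pivot y).
Proof.
move=> dy; rewrite /pivot; case: pickP => //= none.
have [v0 v0P] : exists v, (0 < bmnm y.1 v)%N.
  apply/existsP; apply: contraTT dy; rewrite negb_exists => /forallP y0.
  by rewrite -leqNgt leqn0 mdegE big1 // => v _; apply/eqP; rewrite -leqn0 leqNgt.
case: (@arg_maxnP _ v0 (fun v => 0 < bmnm y.1 v)%N (avoiding y) v0P) => v vP vmax.
have := none v; rewrite /good vP /= => /negP[].
rewrite mdegE big_distrl /=; apply: leq_sum => u _.
case: (posnP (bmnm y.1 u)) => [->//|u0].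
by rewrite leq_mul2l; apply/orP; right; exact: vmax.
Qed.

Let deg_mdeg x : basis x -> mdeg (bmnm (deg x).1) = (m.+1 + q)%N.
Proof. by case/andP=> /eqP xq _; rewrite /= mdegD mdeg_mnm_of mdeg_mset xq. Qed.

Let selected (x : X) := basis x && (pivot (deg x) \notin x.1).

(** Double counting of pairs of a basis vector (T, monomial) and a variable v outside T, weighted by
    the exponent of v. Each v is avoided by ['C(n, q)] sets T and the exponents of a monomial add up
    to m+1, which bounds the sum from below. Within one multidegree, whose total degree is m+1+q,
    the sum is at most m+1+q times the number of vectors whose set avoids the pivot. *)
Let card_selected :
  (m.+1 * 'C(n, q) * c <= (m.+1 + q) * #|[pred x | selected x]|)%N.
Proof.
have lb : (m.+1 * 'C(n, q) * c <=
    \sum_(x | basis x) \sum_v (v \notin x.1) * bmnm (deg x).1 v)%N.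
  have -> : (\sum_(x | basis x) \sum_v (v \notin x.1) * bmnm (deg x).1 v =
      \sum_(i : monomial n.+1 m.+1 * 'I_r | standard w i) \sum_v mnm_of i.1 v * 'C(n, q))%N.
    transitivity (\sum_(T : {set 'I_n.+1} | #|T| == q) \sum_(i : monomial n.+1 m.+1 * 'I_r | standard w i)
        \sum_v mnm_of i.1 v * (v \notin T))%N.
      rewrite [RHS]pair_big. apply: eq_bigr => -[T i] _ /=; apply: eq_bigr => v _.
      (* Outside T the exponent of v in the multidegree is its exponent in the monomial. *)
      rewrite mnmDE mnmE; case: (v \in T); rewrite ?muln0 ?mul0n //=.
      by rewrite mul1n muln1 addn0.
    rewrite exchange_big /=; apply: eq_bigr => i _; rewrite exchange_big /=.
    apply: eq_bigr => v _; rewrite -big_distrr /=; congr (_ * _)%N.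
    rewrite -(card_sets_avoiding q v) -sum1_card [RHS]big_mkcond.
    rewrite [LHS]big_mkcond; apply: eq_bigr => T _; rewrite inE.
    by case: eqP => //=; case: (v \in T).
  under eq_bigr => i _ do rewrite -big_distrl /= -mdegE mdeg_mnm_of.
  rewrite sum_nat_const mulnC leq_mul2r.
  by rewrite (card_standard w_separates) orbT.
apply: leq_trans lb _.
rewrite (partition_big deg predT) //=.
apply: (@leq_trans (\sum_y \sum_(x | basis x && (deg x == y))
    (m.+1 + q) * (pivot (deg x) \notin x.1))); last first.
  rewrite -(partition_big deg predT) //= -big_distrr /= leq_mul2l.
  rewrite -sum1_card big_mkcond /= [X in (_ <= X)%N]big_mkcond /=.
  apply: leq_sum => x _; rewrite inE /selected /=.
  by case: (basis x) => //=; case: (_ \in _).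
apply: leq_sum => y _.
case: (pickP [pred x | basis x && (deg x == y)]) => [x0 /andP[bx0 /eqP dx0]|none]; last first.
  by rewrite !big_pred0.
have dy : mdeg (bmnm y.1) = (m.+1 + q)%N by rewrite -dx0 deg_mdeg.
have [|_] := andP (@pivotP y _); first by rewrite dy.
rewrite dy => ge.
apply: (@leq_trans (\sum_u bmnm y.1 u * avoiding y u)).
  rewrite exchange_big /=; apply: leq_sum => v _.
  rewrite /avoiding -sum1_card big_distrr /= [X in (_ <= X)%N]big_mkcond /=.
  rewrite [X in (X <= _)%N]big_mkcond /=.
  apply: leq_sum => x _; rewrite !inE; case: ifP => [/andP[bx /eqP dx]|//].
  rewrite bx dx eqxx /=; case: (v \in x.1); rewrite ?mul0n //.
  by rewrite mul1n muln1 -dx.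
apply: leq_trans ge _.
rewrite -big_distrr /= leq_mul2l /= /avoiding -sum1_card big_mkcond /=.
rewrite [X in (_ <= X)%N]big_mkcond /=.
apply: leq_sum => x _; rewrite !inE.
case: (boolP (basis x)) => //= bx; case: eqP => //= ->.
by case: (_ \in _).
Qed.

Let sel_index := {x : X | selected x}.

Let kkey (x : sel_index) : ('X_{1..n.+1} *l 'I_r)%type :=
  (bmnm (deg (val x)).1, (val x).2.2).

Let piv (x : sel_index) := pivot (deg (val x)).

Let piv_notin x : piv x \notin (val x).1.
Proof. by case/andP: (valP x). Qed.

Let piv_card x : #|piv x |: (val x).1| == q.+1.
Proof. by rewrite cardsU1 piv_notin; case/andP: (valP x) => /andP[/eqP-> _]. Qed.

Let piv_le x : (U_(piv x) <= mnm_of (val x).2.1)%MM.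
Proof.
have b : basis (val x) by case/andP: (valP x).
have [|gt0 _] := andP (@pivotP (deg (val x)) _); first by rewrite deg_mdeg.
apply/mnm_lepP => u; rewrite mnm1E; case: eqP => // <-.
by move: gt0; rewrite mnmDE mnmE (negPf (piv_notin x)) addn0.
Qed.

(** The pivot is moved from the monomial to the exterior part; the term of the differential that
    removes it again leads back to [x]. *)
Let source (x : sel_index) := w' (mnm_of (val x).2.1 - U_(piv x))%MM (val x).2.2.

Let sourceY x u : source x *m Y u =
  w (mnm_of (val x).2.1 - U_(piv x) + U_(u))%MM (val x).2.2.
Proof.
apply: wY; have := congr1 mdeg (submK (piv_le x)).
by rewrite mdegD mdeg1 addn1 mdeg_mnm_of => -[].
Qed.

Let Q (x y : sel_index) : k :=
  \sum_i \sum_j ((i.1 == piv x |: (val x).1)%:R * source x 0 i.2)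
    * kmx s q.+1 Y i j * ((j.1 == (val y).1)%:R * leading w (val y).2 j.2 0).

Let QE x y : Q x y = \sum_(u in piv x |: (val x).1)
  ((val y).1 == (piv x |: (val x).1) :\ u)%:R * (s u (piv x |: (val x).1)
     * (w (mnm_of (val x).2.1 - U_(piv x) + U_(u))%MM (val x).2.2
        *m leading w (val y).2) 0 0).
Proof.
rewrite /Q (kmx_bilinear s q.+1 Y _ _ (source x) (leading w (val y).2)).
by rewrite piv_card; apply: eq_bigr => u _; rewrite sourceY.
Qed.

Let Qxx x : Q x x != 0.
Proof.
rewrite QE (bigD1 (piv x)) ?setU11 //= big1 ?addr0.
  rewrite setU1K ?piv_notin // eqxx mul1r submK ?piv_le //.
  rewrite mulf_neq0 ?s_neq0 ?setU11 ?leading_neq0 //.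
  by case/andP: (valP x) => /andP[].
move=> u /andP[uT un]; case: ((val x).1 =P _) => [E|_]; last by rewrite mul0r.
by have := piv_notin x; rewrite E !inE eqxx eq_sym un.
Qed.

(** The differential preserves the multidegree, and the functional [leading] of y vanishes on
    monomials below that of y, so the key of y is at most the key of x. If the keys agree, so do the
    pivots; the pivot lies outside the set of y, hence it is the element that was removed, and y is
    x. *)
Let Qtri x y : x != y -> Q x y != 0 -> (kkey y < kkey x)%O.
Proof.
move=> xy; rewrite QE => Qn.
have [u uT] : exists u, (u \in piv x |: (val x).1) &&
   (((val y).1 == (piv x |: (val x).1) :\ u)%:R * (s u (piv x |: (val x).1)
     * (w (mnm_of (val x).2.1 - U_(piv x) + U_(u))%MM (val x).2.2
        *m leading w (val y).2) 0 0) != 0).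
  apply/existsP; apply: contraTT Qn; rewrite negb_exists => /forallP Q0.
  rewrite negbK big1 // => u uT; apply/eqP.
  by have := Q0 u; rewrite uT negbK.
case/andP: uT => uT; case: ((val y).1 =P _) => [Ty|_]; last by rewrite mul0r eqxx.
rewrite mul1r mulf_eq0 negb_or => /andP[_ wn].
set a := (mnm_of (val x).2.1 - U_(piv x) + U_(u))%MM in wn.
have da : mdeg a = m.+1.
  have := congr1 mdeg (submK (piv_le x)).
  by rewrite /a !mdegD !mdeg1 mdeg_mnm_of.
have [a' a'E] := monomial_exists da.
have le : (mkey (val y).2 <= mkey (a', (val x).2.2))%O.
  rewrite leNgt; apply/negP => lt; case/negP: wn; apply/eqP.
  by rewrite -a'E (leading_eq0 w lt).
have kx : bmnm (deg (val x)).1 = (a + mset (val y).1)%MM.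
  rewrite /= /a -[in LHS](submK (piv_le x)) -!addmA; congr (_ + _)%MM.
  apply/mnmP => i; rewrite !mnmDE !mnm1E !mnmE Ty !inE.
  have /negPf pT := piv_notin x; have [<-|ui] := eqVneq u i.
    move: uT; rewrite !inE => /predU1P[->|uT].
      by rewrite eqxx pT.
    by rewrite uT; case: eqP => // E; move: uT; rewrite -E pT.
  by have [<-|pi] := eqVneq (piv x) i; rewrite ?pT.
rewrite lt_neqAle; apply/andP; split; last first.
  move: le; rewrite /mkey /kkey a'E kx !leEprodlexi /=.
  by rewrite !lemc_add2l.
apply: contra xy => /eqP kk.
have e1 : (mnm_of (val y).2.1 + mset (val y).1 = mnm_of (val x).2.1 + mset (val x).1)%MM.
  by have := congr1 fst kk.
have e2 : (val y).2.2 = (val x).2.2 by have := congr1 snd kk.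
have dd : deg (val y) = deg (val x) by rewrite /deg e2; congr (_, _); apply: val_inj.
have pp : piv y = piv x by rewrite /piv dd.
have up : u = piv x.
  apply/eqP; apply: contraTT (piv_notin y) => un.
  by rewrite negbK pp Ty !inE eqxx eq_sym un.
have TT : (val y).1 = (val x).1 by rewrite Ty up setU1K ?piv_notin.
apply/eqP/val_inj; rewrite TT in e1.
case: (val x) (val y) TT e1 e2 => [T [b i]] [T' [b' i']] /= -> e1 ->.
congr (_, (_, _)); apply: mnm_of_inj.
by apply/mnmP => j; have := congr1 (fun a : 'X_{1..n.+1} => a j) e1; rewrite !mnmDE => /addIn.
Qed.

(* The vectors (T, standard monomial) whose pivot is outside T; since pivots
   maximise the number of such T in each multidegree, their number is at least
   the average of the number of T avoiding v, where v has weight equal to its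
   exponent. *)
Theorem koszul_rank_ge :
  (m.+1 * 'C(n, q) * c <= (m.+1 + q) * frank (kmx s q.+1 Y))%N.
Proof.
apply: leq_trans card_selected _; rewrite leq_mul2l /=.
rewrite -(card_sig selected) -(frank_triangular Qxx Qtri).
exact: frank_le.
Qed.

End KoszulRankLowerBound.

(** * Tor and graded free resolutions *)
Section Dimension.
Variables (k : fieldType) (A : gring k).

Definition ksubspace (V : lmodType A) (Z : V -> Prop) :=
  Z 0 /\ forall c x y, Z x -> Z y -> Z (gunit A c *: x + y).

(** The scalar multiplications are parameters because coordinate vectors carry an action of k,
    whereas modules over [A] carry it only through [gunit]. *)
Definition klinear (V W : zmodType) (sV : k -> V -> V) (sW : k -> W -> W)
  (f : V -> W) := forall c x y, f (sV c x + y) = sW c (f x) + f y.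

Definition kscale (V : lmodType A) (c : k) (x : V) : V := gunit A c *: x.

Definition lin (V : lmodType A) n (b : 'I_n -> V) (v : 'rV[k]_n) : V :=
  \sum_(i < n) gunit A (v 0 i) *: b i.

Lemma lin_is_klinear (V : lmodType A) n (b : 'I_n -> V) :
  klinear *:%R (@kscale V) (lin b).
Proof.
move=> c x y; rewrite /lin /kscale scaler_sumr -big_split; apply: eq_bigr => i _.
by rewrite /= !mxE rmorphD rmorphM scalerDl scalerA.
Qed.

Section KLinear.
Variables (V W : zmodType) (sV : k -> V -> V) (sW : k -> W -> W) (f : V -> W).
Hypotheses (fL : klinear sV sW f) (sV1 : left_id 1 sV) (sW1 : left_id 1 sW).

Lemma klinearD x y : f (x + y) = f x + f y.
Proof. by have := fL 1 x y; rewrite sV1 sW1. Qed.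

Lemma klinear0 : f 0 = 0.
Proof. by apply: (@addrI _ (f 0)); rewrite -klinearD !addr0. Qed.

Lemma klinearB x y : f (x - y) = f x - f y.
Proof. by apply: (@addIr _ (f y)); rewrite -klinearD !subrK. Qed.

Lemma klinear_sum I (r : seq I) (P : pred I) (F : I -> V) :
  f (\sum_(i <- r | P i) F i) = \sum_(i <- r | P i) f (F i).
Proof. exact: (big_morph f klinearD klinear0). Qed.

Lemma klinearZ c x : f (sV c x) = sW c (f x).
Proof. by have := fL c x 0; rewrite klinear0 !addr0. Qed.

End KLinear.

Lemma kscale1 (V : lmodType A) : left_id 1 (@kscale V).
Proof. by move=> x; rewrite /kscale rmorph1 scale1r. Qed.

Lemma lin0 (V : lmodType A) n (b : 'I_n -> V) : lin b 0 = 0.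
Proof. exact: klinear0 (lin_is_klinear b) (@scale1r _ _) (@kscale1 V). Qed.

Lemma ksubspaceD (V : lmodType A) (Z : V -> Prop) x y :
  ksubspace Z -> Z x -> Z y -> Z (x + y).
Proof. by move=> [_ ZL] Zx Zy; have := ZL 1 x y Zx Zy; rewrite rmorph1 scale1r. Qed.

Lemma ksubspace_sum (V : lmodType A) (Z : V -> Prop) I (r : seq I) (P : pred I)
    (c : I -> k) (x : I -> V) :
  ksubspace Z -> (forall i, P i -> Z (x i)) ->
  Z (\sum_(i <- r | P i) gunit A (c i) *: x i).
Proof.
move=> ZZ Zx; apply: (big_ind Z) => [|u v Zu Zv|i Pi].
- by case: ZZ.
- exact: ksubspaceD.
by have := ZZ.2 (c i) (x i) 0 (Zx i Pi) ZZ.1; rewrite addr0.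
Qed.

(** If n exceeded n', the coordinates of the images of the basis of Z / B would satisfy a
    non-trivial relation. The corresponding combination of basis elements is sent into B', hence
    lies in B, against the uniqueness of coordinates modulo B. *)
Lemma has_dim_le (V V' : lmodType A) (Z B : V -> Prop) (Z' B' : V' -> Prop)
    (f : V -> V') n n' :
  ksubspace Z -> ksubspace B -> ksubspace B' ->
  klinear (@kscale V) (@kscale V') f ->
  (forall x, Z x -> Z' (f x)) -> (forall x, Z x -> B' (f x) -> B x) ->
  has_dim Z B n -> has_dim Z' B' n' -> (n <= n')%N.
Proof.
move=> ZZ BB BB' fL fZ fB [b [Zb bB]] [b' [Zb' bB']].
have [C CP] : exists C : 'I_n -> 'rV[k]_n', forall i, B' (f (b i) - lin b' (C i)).
  apply: (@fin_all_exists _ (fun=> 'rV[k]_n') (fun i c => B' (f (b i) - lin b' c))) => i.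
  by have [c [Bc _]] := bB' _ (fZ _ (Zb i)); exists c.
pose M := \matrix_i C i; rewrite leqNgt; apply/negP => lt.
have : kermx M != 0.
  rewrite -mxrank_eq0 mxrank_ker subn_eq0 -ltnNge.
  exact: leq_ltn_trans (rank_leq_col _) lt.
case/rowV0Pn => v /sub_kermxP vM /eqP[]; pose z := lin b v.
have Zz : Z z by apply: ksubspace_sum.
have Bz : B z.
  apply: fB => //.
  have -> : f z = \sum_i gunit A (v 0 i) *: (f (b i) - lin b' (C i)).
    under eq_bigr => i _ do rewrite scalerBr.
    rewrite sumrB.
    have -> : \sum_i gunit A (v 0 i) *: lin b' (C i) = 0.
      transitivity (lin b' (v *m M)); last by rewrite vM lin0.
      rewrite mulmx_sum_row (klinear_sum (lin_is_klinear b') (@scale1r _ _) (@kscale1 _)).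
      apply: eq_bigr => i _.
      by rewrite (klinearZ (lin_is_klinear b') (@scale1r _ _) (@kscale1 _)) rowK.
    rewrite subr0 (klinear_sum fL (@kscale1 _) (@kscale1 _)); apply: eq_bigr => i _.
    exact: (klinearZ fL (@kscale1 _) (@kscale1 _)).
  exact: ksubspace_sum.
have [c [_ cU]] := bB z Zz.
have -> : v = c.
  symmetry; apply: cU; rewrite -/(lin b v) subrr; exact: BB.1.
by apply: cU; rewrite -/(lin b 0) lin0 subr0.
Qed.

(** A complement of the row space of [WB] in that of [WZ] supplies representatives; coordinates are
    unique because it meets [WB] in zero. *)
Lemma has_dim_coordinates (V : lmodType A) (Z B : V -> Prop) N
    (f : 'rV[k]_N -> V) m m' (WZ : 'M[k]_(m, N)) (WB : 'M[k]_(m', N)) :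
  klinear *:%R (@kscale V) f ->
  (forall z, Z z -> exists2 v, (v <= WZ)%MS & z = f v) ->
  (forall v, (v <= WZ)%MS -> Z (f v)) ->
  (forall v, (v <= WZ)%MS -> B (f v) <-> (v <= WB)%MS) ->
  (WB <= WZ)%MS -> has_dim Z B (\rank WZ - \rank WB).
Proof.
move=> fL Zf fZ fB sBZ; have fB' := klinearB fL (@scale1r _ _) (@kscale1 _).
have fS := klinear_sum fL (@scale1r _ _) (@kscale1 _).
have fZZ := klinearZ fL (@scale1r _ _) (@kscale1 _).
have <- : \rank (WZ :\: WB) = (\rank WZ - \rank WB)%N.
  by rewrite -(mxrank_cap_compl WZ WB) (capmx_idPr sBZ) addKn.
set D := (WZ :\: WB)%MS; exists (fun i => f (row i (row_base D))).
have DZ : (row_base D <= WZ)%MS by rewrite eq_row_base diffmxSl.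
have fD (c : 'rV_(\rank D)) : \sum_i gunit A (c 0 i) *: f (row i (row_base D)) = f (c *m row_base D).
  by rewrite mulmx_sum_row fS; apply: eq_bigr => i _; rewrite fZZ.
split=> [i|z /Zf[v vZ ->]]; first by apply: fZ; apply: submx_trans (row_sub _ _) DZ.
have : (v <= WZ :&: WB + D)%MS by rewrite addsmxC addsmx_diff_cap_eq.
case/sub_addsmxP => -[u1 u2] /= vE.
have wB : (u1 *m (WZ :&: WB)%MS <= WB)%MS.
  by apply: submx_trans (submxMl _ _) (capmxSr _ _).
have /submxP[c cE] : (u2 *m D <= row_base D)%MS by rewrite eq_row_base submxMl.
have vB : v - c *m row_base D = u1 *m (WZ :&: WB)%MS by rewrite vE -cE addrK.
have subZ c' : (v - c' *m row_base D <= WZ)%MS.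
  by rewrite addmx_sub // eqmx_opp (submx_trans (submxMl _ _) DZ).
exists c; split=> [|c']; rewrite fD -fB'; first by apply/fB; rewrite ?subZ // vB.
move/(fB _ (subZ c')) => c'B.
have : ((c' - c) *m row_base D <= D :&: WB)%MS.
  rewrite sub_capmx -{1}(eq_row_base D) submxMl /=.
  have -> : (c' - c) *m row_base D =
      (v - c *m row_base D) - (v - c' *m row_base D).
    by rewrite mulmxBl opprB [RHS]addrC addrA subrK.
  by rewrite addmx_sub ?eqmx_opp // vB.
rewrite capmx_diff submx0 => /eqP c0; apply/esym/eqP; rewrite -subr_eq0.
by rewrite -(mulmx_free_eq0 _ (row_base_free D)) c0.
Qed.

End Dimension.

(** Chain maps and homotopies are built one degree at a time, with matrices whose sizes depend on
    the degree; the invariant [P] is what makes the next lift possible. *)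
Lemma dependent_choice (T : nat -> Type) (P : forall i, T i -> Prop)
    (R : forall i, T i -> T i.+1 -> Prop) (x0 : T 0%N) :
  P 0%N x0 -> (forall i x, P i x -> exists2 y, P i.+1 y & R i x y) ->
  exists f : forall i, T i,
    f 0%N = x0 /\ forall i, P i (f i) /\ R i (f i) (f i.+1).
Proof.
move=> P0 PR.
have step i (x : {x : T i | P i x}) : {y : T i.+1 | P i.+1 y /\ R i (sval x) y}.
  apply: constructive_indefinite_description.
  by have [y] := PR _ _ (svalP x); exists y.
pose g := nat_rect (fun i => {x : T i | P i x}) (exist _ x0 P0)
  (fun i x => exist _ (sval (step i x)) (proj1 (svalP (step i x)))).
exists (fun i => sval (g i)); split=> // i; split; first exact: (svalP (g i)).
exact: (proj2 (svalP (step i (g i)))).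
Qed.

Section Grading.
Variables (k : fieldType) (A : gring k).

(** The axioms that the raw data of [gring] omits. The projections onto homogeneous components are
    part of the data, so that lifts can be made homogeneous entry by entry. *)
Record grading := Grading {
  hcomp : int -> A -> A;
  hcompD : forall d, {morph hcomp d : a b / a + b};
  hcomp_hom : forall d a, ghom d (hcomp d a);
  hcomp_id : forall d a, ghom d a -> hcomp d a = a;
  hcomp_other : forall d e a, d != e -> ghom e a -> hcomp d a = 0;
  hcompMr : forall d e a b, ghom e b -> hcomp d (a * b) = hcomp (d - e) a * b;
  ghomB : forall d (a b : A), ghom d a -> ghom d b -> ghom d (a - b);
  ghomM : forall d e (a b : A), ghom d a -> ghom e b -> ghom (d + e) (a * b);
  ghom_unit : forall c : k, ghom 0 (gunit A c)
}.

Variable gr : grading.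

Lemma ghom0 d : ghom d (0 : A).
Proof.
by rewrite -(subrr (hcomp gr d 0)); apply: (ghomB gr); exact: hcomp_hom.
Qed.

Lemma ghomD d (a b : A) : ghom d a -> ghom d b -> ghom d (a + b).
Proof.
move=> Ha Hb; rewrite -[b]opprK; apply: (ghomB gr) => //.
by rewrite -sub0r; apply: (ghomB gr) => //; exact: ghom0.
Qed.

Lemma ghom_sum d I (r : seq I) (P : pred I) (F : I -> A) :
  (forall i, P i -> ghom d (F i)) -> ghom d (\sum_(i <- r | P i) F i).
Proof.
by move=> PF; apply: (big_ind (@ghom k A d)) => //; [exact: ghom0|exact: ghomD].
Qed.

Lemma hcomp0 d : hcomp gr d 0 = 0.
Proof. by apply: hcomp_id; exact: ghom0. Qed.

Lemma hcomp_sum d I (r : seq I) (P : pred I) (F : I -> A) :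
  hcomp gr d (\sum_(i <- r | P i) F i) = \sum_(i <- r | P i) hcomp gr d (F i).
Proof. exact: (big_morph _ (hcompD gr d) (hcomp0 d)). Qed.

Definition hommx r s (da : 'I_r -> int) (db : 'I_s -> int) (D : 'M[A]_(r, s)) :=
  forall a b, ghom (da a - db b) (D a b).

Lemma hommxM r s t (da : 'I_r -> int) (db : 'I_s -> int) (dc : 'I_t -> int)
    (D : 'M[A]_(r, s)) (E : 'M[A]_(s, t)) :
  hommx da db D -> hommx db dc E -> hommx da dc (D *m E).
Proof.
move=> HD HE a c; rewrite mxE; apply: ghom_sum => b _.
have -> : da a - dc c = (da a - db b) + (db b - dc c) by rewrite addrA subrK.
exact: (ghomM gr).
Qed.

Lemma hommxB r s (da : 'I_r -> int) (db : 'I_s -> int) (D E : 'M[A]_(r, s)) :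
  hommx da db D -> hommx da db E -> hommx da db (D - E).
Proof. by move=> HD HE a b; rewrite !mxE; apply: (ghomB gr). Qed.

Lemma hommx1 r (da : 'I_r -> int) : hommx da da 1%:M.
Proof.
move=> a b; rewrite mxE; case: eqVneq => [->|_]; last exact: ghom0.
by rewrite subrr -(rmorph1 (gunit A)); exact: ghom_unit.
Qed.

(** Any lift may be replaced by the components of its entries in the expected degrees: as [P] and
    [D] are homogeneous, the equation holds component by component. *)
Lemma homogeneous_lift r s t (da : 'I_r -> int) (db : 'I_s -> int)
    (dc : 'I_t -> int) (P : 'M[A]_(r, t)) (D : 'M[A]_(s, t)) :
  hommx da dc P -> hommx db dc D ->
  (forall a, exists w, row a P = w *m D) ->
  exists2 L : 'M[A]_(r, s), hommx da db L & P = L *m D.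
Proof.
move=> HP HD /(@fin_all_exists _ (fun=> 'rV[A]_s))[w wP].
exists (\matrix_(a, b) hcomp gr (da a - db b) (w a 0 b)).
  by move=> a b; rewrite mxE; exact: hcomp_hom.
apply/matrixP => a c; rewrite -(hcomp_id gr (HP a c)).
have := congr1 (fun M : 'rV_t => M 0 c) (wP a); rewrite [LHS]mxE => ->.
rewrite !mxE hcomp_sum; apply: eq_bigr => b _; rewrite mxE (hcompMr _ _ _ (HD b c)).
by congr (hcomp _ _ _ * _); ring.
Qed.

Section Comparison.
Variable N : gmod A.

(** What the comparison of resolutions needs in order to start: homogeneous elements of [N] lift to
    vectors with homogeneous entries. *)
Definition graded_cover :=
  forall (F : free_complex A) (e : 'I_(rk F 0) -> N), free_resolution e ->
  forall (d : int) (x : N), mhom d x ->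
  exists2 v : 'rV[A]_(rk F 0), (forall b, ghom (d - fdeg b) (v 0 b))
    & x = augment e v.

Definition in_kernel (F : free_complex A) (e : 'I_(rk F 0) -> N) i :
    'rV[A]_(rk F i) -> Prop :=
  match i with
  | 0 => fun v => augment e v = 0
  | _.+1 => fun v => v *m fdiff F _ = 0
  end.

Lemma augmentM (F : free_complex A) (e : 'I_(rk F 0) -> N) r (v : 'rV[A]_r)
    (D : 'M[A]_(r, rk F 0)) :
  augment e (v *m D) = \sum_a v 0 a *: augment e (row a D).
Proof.
rewrite /augment; under [RHS]eq_bigr => a _ do rewrite scaler_sumr.
rewrite exchange_big; apply: eq_bigr => b _; rewrite mxE scaler_suml.
by apply: eq_bigr => a _; rewrite scalerA mxE.
Qed.

Lemma augmentB (F : free_complex A) (e : 'I_(rk F 0) -> N) :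
  {morph augment e : v w / v - w}.
Proof.
by move=> v w; rewrite /augment -sumrB; apply: eq_bigr => b _; rewrite !mxE scalerBl.
Qed.

Section OneResolution.
Variables (F : free_complex A) (e : 'I_(rk F 0) -> N).
Hypothesis eF : free_resolution e.

Lemma in_kernelE i v : in_kernel e v <-> exists w, v = w *m fdiff F i.
Proof. by case: eF => _ _ h0 h1; case: i v => [|i] v; [exact: h0|exact: h1]. Qed.

Lemma fdiff_hom i : hommx (@fdeg _ _ F i.+1) (@fdeg _ _ F i) (fdiff F i).
Proof. by case: eF => -[h _] _ _ _ a b; exact: h. Qed.

Lemma fdiff_fdiff i : fdiff F i.+1 *m fdiff F i = 0.
Proof.
apply/row_matrixP => a; rewrite row_mul row0.
by case: eF => _ _ _ h; apply/h; exists (delta_mx 0 a); rewrite rowE.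
Qed.

End OneResolution.

(** The comparison theorem over the identity of [N]. The invariant of the recursion is that each map
    is homogeneous and sends kernels to kernels, so that exactness of [G] provides the next map. *)
Lemma chain_map (F G : free_complex A) (e : 'I_(rk F 0) -> N)
    (e' : 'I_(rk G 0) -> N) :
  free_resolution e -> free_resolution e' -> graded_cover ->
  exists phi : forall i, 'M[A]_(rk F i, rk G i),
  [/\ forall i, hommx (@fdeg _ _ F i) (@fdeg _ _ G i) (phi i),
      forall i, fdiff F i *m phi i = phi i.+1 *m fdiff G i
    & forall v, augment e' (v *m phi 0%N) = augment e v].
Proof.
move=> eF eG cov.
have [w wP] : exists w : 'I_(rk F 0) -> 'rV[A]_(rk G 0),
    forall a, (forall b, ghom (fdeg a - fdeg b) (w a 0 b)) /\ e a = augment e' (w a).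
  apply: (@fin_all_exists _ (fun=> 'rV[A]_(rk G 0)) (fun a v =>
    (forall b, ghom (fdeg a - fdeg b) (v 0 b)) /\ e a = augment e' v)) => a.
  have [[_ he] _ _ _] := eF.
  by have [v] := cov _ _ eG _ _ (he a); exists v.
pose phi0 : 'M[A]_(rk F 0, rk G 0) := \matrix_a w a.
have phi0P v : augment e' (v *m phi0) = augment e v.
  rewrite augmentM; apply: eq_bigr => a _; rewrite rowK.
  by have [_ <-] := wP a.
pose P i (f : 'M[A]_(rk F i, rk G i)) :=
  hommx (@fdeg _ _ F i) (@fdeg _ _ G i) f /\
  forall v, in_kernel e v -> in_kernel e' (v *m f).
have P0 : P 0%N phi0.
  split; last by move=> v; rewrite /in_kernel phi0P.
  by move=> a b; rewrite mxE; have [] := wP a.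
have [|phi [phi0E phiP]] := @dependent_choice _ P
  (fun i f g => fdiff F i *m f = g *m fdiff G i) phi0 P0.
  move=> i f [fH fK].
  have [|a|g gH gE] := @homogeneous_lift _ _ _ _ (@fdeg _ _ G i.+1) _
    (fdiff F i *m f) (fdiff G i) (hommxM (@fdiff_hom F e eF i) fH).
  - exact: (fdiff_hom eG).
  - apply/(in_kernelE eG); rewrite row_mul; apply: fK.
    by apply/(in_kernelE eF); exists (delta_mx 0 a); rewrite -rowE.
  exists g => //; split=> // v /= vK.
  by rewrite -mulmxA -gE mulmxA vK mul0mx.
exists phi; split=> [i|i|v].
- by have [[]] := phiP i.
- by have [] := phiP i.
- by rewrite phi0E phi0P.
Qed.

(** A chain map over the zero map is null-homotopic. The invariant says that the differential kills
    the next matrix to be lifted, [chi i.+1 - fdiff F i *m h], rewritten with the fact that [chi]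
    commutes with the differential. *)
Lemma null_homotopy (F : free_complex A) (e : 'I_(rk F 0) -> N)
    (chi : forall i, 'M[A]_(rk F i, rk F i)) :
  free_resolution e ->
  (forall i, hommx (@fdeg _ _ F i) (@fdeg _ _ F i) (chi i)) ->
  (forall i, fdiff F i *m chi i = chi i.+1 *m fdiff F i) ->
  (forall v, augment e (v *m chi 0%N) = 0) ->
  exists h : forall i, 'M[A]_(rk F i, rk F i.+1),
  [/\ forall i, hommx (@fdeg _ _ F i) (@fdeg _ _ F i.+1) (h i),
      chi 0%N = h 0%N *m fdiff F 0
    & forall i, chi i.+1 = fdiff F i *m h i + h i.+1 *m fdiff F i.+1].
Proof.
move=> eF chiH chiC chi0.
have [|a|h0 h0H h0E] := @homogeneous_lift _ _ _ _ (@fdeg _ _ F 1) _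
  (chi 0%N) (fdiff F 0) (chiH 0%N).
- exact: (fdiff_hom eF).
- by apply/(in_kernelE eF); rewrite /= rowE chi0.
pose P i (h : 'M[A]_(rk F i, rk F i.+1)) :=
  hommx (@fdeg _ _ F i) (@fdeg _ _ F i.+1) h /\
  fdiff F i *m (chi i - h *m fdiff F i) = 0.
have P0 : P 0%N h0 by split=> //; rewrite -h0E subrr mulmx0.
have [|h [h0' hP]] := @dependent_choice _ P
  (fun i h h' => chi i.+1 = fdiff F i *m h + h' *m fdiff F i.+1) h0 P0.
  move=> i h [hH hK].
  have H : hommx (@fdeg _ _ F i.+1) (@fdeg _ _ F i.+1) (chi i.+1 - fdiff F i *m h).
    by apply: hommxB => //; apply: hommxM hH; exact: (fdiff_hom eF).
  have [|a|h' h'H h'E] := @homogeneous_lift _ _ _ _ (@fdeg _ _ F i.+2) _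
    _ (fdiff F i.+1) H.
  - exact: (fdiff_hom eF).
  - apply/(in_kernelE eF); rewrite /= -row_mul mulmxBl -chiC -mulmxA -mulmxBr.
    by rewrite hK row0.
  exists h'; last by rewrite -h'E addrC subrK.
  split=> //; rewrite -h'E opprB addrC subrK.
  by rewrite mulmxA (fdiff_fdiff eF) mul0mx.
exists h; split=> [i||i].
- by have [[]] := hP i.
- by rewrite h0'.
- by have [] := hP i.
Qed.

End Comparison.

End Grading.

Section Tor.
Variables (k : fieldType) (A : gring k) (gr : grading A) (M : gmod A).

Definition graded_action :=
  (forall j : int, mhom j (0 : M)
     /\ (forall x y : M, mhom j x -> mhom j y -> mhom j (x - y)))
  /\ (forall (i j : int) (a : A) (x : M),
        ghom i a -> mhom j x -> mhom (i + j) (a *: x)).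

Hypothesis Mgr : graded_action.

Lemma mhom_ksubspace j : ksubspace (@mhom _ _ M j).
Proof.
case: Mgr => h0 hZ; have [z0 zB] := h0 j; split=> // c x y hx hy.
have hN (z : M) : mhom j z -> mhom j (- z) by move=> hz; have := zB 0 z z0 hz; rewrite sub0r.
rewrite -[y]opprK; apply: zB; last exact: hN.
by rewrite -[j]add0r; apply: hZ => //; exact: (ghom_unit gr).
Qed.

Lemma mhom_sum j I (r : seq I) (P : pred I) (F : I -> M) :
  (forall i, P i -> mhom j (F i)) -> mhom j (\sum_(i <- r | P i) F i).
Proof.
move=> PF; apply: (big_ind (@mhom _ _ M j)) => //.
  exact: (mhom_ksubspace j).1.
by move=> x y; exact: ksubspaceD (mhom_ksubspace j).
Qed.

Definition tens r s (D : 'M[A]_(r, s)) (m : {ffun 'I_r -> M}) : {ffun 'I_s -> M} :=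
  [ffun b => \sum_a D a b *: m a].

Lemma tensM r s t (D : 'M[A]_(r, s)) (E : 'M[A]_(s, t)) m :
  tens (D *m E) m = tens E (tens D m).
Proof.
apply/ffunP => c; rewrite !ffunE.
under [RHS]eq_bigr => b _ do rewrite ffunE scaler_sumr.
rewrite exchange_big; apply: eq_bigr => a _; rewrite mxE scaler_suml.
by apply: eq_bigr => b _; rewrite scalerA mulrC.
Qed.

Lemma tensDl r s (D E : 'M[A]_(r, s)) m : tens (D + E) m = tens D m + tens E m.
Proof.
apply/ffunP => b; rewrite !ffunE -big_split; apply: eq_bigr => a _ /=.
by rewrite mxE scalerDl.
Qed.

Lemma tens1 r (m : {ffun 'I_r -> M}) : tens 1%:M m = m.
Proof.
apply/ffunP => b; rewrite ffunE (bigD1 b) //= mxE eqxx scale1r big1 ?addr0 //.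
by move=> a /negPf ne; rewrite mxE ne scale0r.
Qed.

Lemma tens_klinear r s (D : 'M[A]_(r, s)) :
  klinear (@kscale k A {ffun 'I_r -> M}) (@kscale k A {ffun 'I_s -> M}) (tens D).
Proof.
move=> c x y; apply/ffunP => b; rewrite /kscale !ffunE scaler_sumr -big_split.
by apply: eq_bigr => a _; rewrite /= !ffunE scalerDr !scalerA mulrC.
Qed.

Lemma tens0 r s (D : 'M[A]_(r, s)) : tens D 0 = 0.
Proof. exact: klinear0 (tens_klinear D) (@kscale1 _ _ _) (@kscale1 _ _ _). Qed.

Lemma tensDr r s (D : 'M[A]_(r, s)) : {morph tens D : x y / x + y}.
Proof. exact: klinearD (tens_klinear D) (@kscale1 _ _ _) (@kscale1 _ _ _). Qed.

Lemma tens_hom r s (da : 'I_r -> int) (db : 'I_s -> int) (D : 'M[A]_(r, s)) j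
    (m : {ffun 'I_r -> M}) :
  hommx da db D -> (forall a, mhom (j - da a) (m a)) ->
  forall b, mhom (j - db b) (tens D m b).
Proof.
move=> DH mH b; rewrite ffunE; apply: mhom_sum => a _.
have -> : j - db b = (da a - db b) + (j - da a) by ring.
exact: Mgr.2.
Qed.

Lemma tensor_hom_ksubspace (F : free_complex A) i j :
  ksubspace (@tensor_hom _ _ M F i j).
Proof.
split=> [b|c x y hx hy b]; rewrite !ffunE.
  exact: (mhom_ksubspace _).1.
exact: (mhom_ksubspace _).2.
Qed.

Lemma cycles_ksubspace (F : free_complex A) i j : ksubspace (@cycles _ _ M F i j).
Proof.
case: i => [|i]; first exact: tensor_hom_ksubspace.
have [h0 hL] := tensor_hom_ksubspace F i.+1 j.
split=> [|c x y [hx x0] [hy y0]]; split=> //.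
- exact: (tens0 (fdiff F i)).
- exact: hL.
rewrite [LHS](tens_klinear (fdiff F i) c x y) /kscale.
by rewrite [tens _ x]x0 [tens _ y]y0 scaler0 addr0.
Qed.

Lemma boundaries_ksubspace (F : free_complex A) i j :
  ksubspace (@boundaries _ _ M F i j).
Proof.
have [h0 hL] := tensor_hom_ksubspace F i.+1 j.
split=> [|c x y [u hu ->] [v hv ->]].
  by exists 0 => //; rewrite [RHS](tens0 (fdiff F i)).
exists (gunit A c *: u + v); first exact: hL.
by rewrite [RHS](tens_klinear (fdiff F i) c u v).
Qed.

Variable N : gmod A.
Hypothesis cov : graded_cover N.

(** The comparison map [phi] is injective on homology: 1 - phi psi is null-homotopic through [h], so
    a cycle x whose image is the boundary of w is itself the boundary of psi w + h x. *)
Lemma tor_le (F G : free_complex A) (e : 'I_(rk F 0) -> N)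
    (e' : 'I_(rk G 0) -> N) q j n n' :
  free_resolution e -> free_resolution e' ->
  has_dim (@cycles _ _ M F q j) (@boundaries _ _ M F q j) n ->
  has_dim (@cycles _ _ M G q j) (@boundaries _ _ M G q j) n' -> (n <= n')%N.
Proof.
move=> eF eG; have [phi [phiH phiC phi0]] := chain_map gr eF eG cov.
have [psi [psiH psiC psi0]] := chain_map gr eG eF cov.
pose chi i := 1%:M - phi i *m psi i.
have [|i|v|h [hH h0 hS]] := @null_homotopy _ _ gr _ F e chi eF.
- move=> i; apply: (hommxB gr); first exact: (hommx1 gr).
  exact: (hommxM gr) (phiH i) (psiH i).
- rewrite /chi mulmxBr mulmxBl mulmx1 mul1mx; congr (_ - _).
  by rewrite mulmxA phiC -!mulmxA psiC.
- by rewrite /chi mulmxBr mulmx1 augmentB mulmxA psi0 phi0 subrr.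
have tensh i (x : {ffun 'I_(rk F i) -> M}) : tensor_hom j x ->
    tensor_hom j (tens (phi i) x) by move=> hx b; exact: tens_hom (phiH i) hx b.
have tenspsi i (x : {ffun 'I_(rk G i) -> M}) : tensor_hom j x ->
    tensor_hom j (tens (psi i) x) by move=> hx b; exact: tens_hom (psiH i) hx b.
move=> dF dG; apply: (@has_dim_le _ _ _ _ _ _ _ _ (tens (phi q)) _ _ _ _ _ _ _ _ dF dG) => {dF dG}.
- exact: cycles_ksubspace.
- exact: boundaries_ksubspace.
- exact: boundaries_ksubspace.
- exact: tens_klinear.
- case: q => [|q] x; first exact: tensh.
  case=> hx x0; split; first exact: tensh.
  by rewrite /tensor_diff -/(tens _ _) -tensM -phiC tensM [tens (fdiff _ _) x]x0 tens0.
move=> x xC [w hw wE].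
have hx : tensor_hom j x by case: q x xC {w hw wE} => [|q] x //= [].
exists (tens (psi q.+1) w + tens (h q) x).
  apply: (ksubspaceD (tensor_hom_ksubspace F q.+1 j)); first exact: tenspsi.
  by move=> b; exact: tens_hom (hH q) hx b.
rewrite [RHS]tensDr -!tensM -psiC tensM.
rewrite -[tens (fdiff G q) w]wE -tensM.
have -> : tens (h q *m fdiff F q) x = tens (chi q) x.
  case: q x xC {w hw wE hx} => [|q] x xC; first by rewrite h0.
  by rewrite hS tensDl [in RHS]tensM [tens (fdiff F q) x]xC.2 tens0 add0r.
by rewrite -tensDl /chi addrC subrK tens1.
Qed.

(** The number chosen by [epsilon] comes from some resolution; the comparison in both directions
    identifies it with the number computed from the given one. *)
Lemma tor_dim_unique (F : free_complex A) (e : 'I_(rk F 0) -> N) q j n :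
  free_resolution e ->
  has_dim (@cycles _ _ M F q j) (@boundaries _ _ M F q j) n ->
  tor_dim M N q j = n.
Proof.
move=> eF dF; rewrite /tor_dim.
have [|G [e' [eG dG]]] := epsilon_spec (inhabits 0%N) (fun n =>
    exists (F : free_complex A) (e : 'I_(rk F 0) -> N),
      free_resolution e /\ has_dim (@cycles _ _ M F q j) (@boundaries _ _ M F q j) n).
  by exists n, F, e.
by apply/eqP; rewrite eqn_leq (tor_le eG eF dG dF) (tor_le eF eG dF dG).
Qed.

End Tor.

(** * The Koszul resolution *)
Lemma pihomogMr n (R : comNzRingType) d e (f g : {mpoly R[n]}) :
  g \is e.-homog ->
  pihomog mdeg d (f * g) = (if (e <= d)%N then pihomog mdeg (d - e) f else 0) * g.
Proof.
move=> gh; pose K := maxn (msize f) d.+1.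
have fK : (mmeasure mdeg f <= K)%N by apply: leq_maxl.
rewrite {1}(pihomog_partitionE fK) mulr_suml raddf_sum /=.
have E i : pihomog mdeg d (pihomog mdeg i f * g) =
    if (i + e)%N == d then pihomog mdeg i f * g else 0.
  have H : pihomog mdeg i f * g \is (i + e).-homog.
    by apply: dhomogM => //; exact: pihomogP.
  by case: eqP => [<-|/eqP ne]; [rewrite pihomog_dE|rewrite (pihomog_ne0 ne)].
rewrite (eq_bigr _ (fun (i : 'I_K) _ => E i)).
case: leqP => ed; last first.
  by rewrite mul0r big1 // => i _; case: eqP => // ie; lia.
have lt : (d - e < K)%N by rewrite /K leq_max; apply/orP; right; lia.
rewrite (bigD1 (Ordinal lt)) //= subnK // eqxx big1 ?addr0 // => i ne.
case: eqP => // ie; case/eqP: ne; apply: val_inj => /=; lia.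
Qed.

Section PolynomialCoordinates.
Variables (k : fieldType) (n : nat) (A : gring k).

(** An isomorphism of graded k-algebras with a polynomial ring. It serves for R with a linear form
    as one of the variables, and for the quotient S by that form. *)
Record coordinates := Coordinates {
  pc : {rmorphism {mpoly k[n]} -> A};
  pcV : A -> {mpoly k[n]};
  pcK : cancel pc pcV;
  pcVK : cancel pcV pc;
  pcC : forall c, pc c%:MP = gunit A c;
  pc_hom : forall j f, ghom j (pc f) <-> @ghom _ (polynomial_ring k n) j f
}.

Variable th : coordinates.

Definition pvar (t : 'I_n) : A := pc th 'X_t.
Definition pmon (b : 'X_{1..n}) : A := pc th 'X_[b].

Lemma pmonD b t : pmon (b + U_(t)) = pvar t * pmon b.
Proof. by rewrite /pmon mpolyXD rmorphM mulrC. Qed.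

Lemma pvar_hom t : ghom 1 (pvar t).
Proof. by apply/pc_hom; rewrite /= dhomogX; apply/eqP; exact: mdeg1. Qed.

Lemma pmon_hom b : ghom (mdeg b)%:Z (pmon b).
Proof. by apply/pc_hom; rewrite /= dhomogX. Qed.

Definition pc_hcomp (d : int) (a : A) : A :=
  if 0 <= d then pc th (pihomog mdeg `|d|%N (pcV th a)) else 0.

Lemma ghom_neg (d : int) a : d < 0 -> @ghom k A d a -> a = 0.
Proof.
by case: d => // d _; rewrite -(pcVK th a) => /pc_hom /= ->; rewrite rmorph0.
Qed.

Lemma pcVD : {morph pcV th : a b / a + b}.
Proof. by move=> a b; apply: (can_inj (pcK th)); rewrite rmorphD !pcVK. Qed.

Lemma pcVM : {morph pcV th : a b / a * b}.
Proof. by move=> a b; apply: (can_inj (pcK th)); rewrite rmorphM !pcVK. Qed.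

Lemma polynomial_hom0 j : @ghom _ (polynomial_ring k n) j 0.
Proof. by case: j => [j|j] //=; exact: dhomog0. Qed.

Lemma coordinates_grading : grading A.
Proof.
apply: (@Grading k A pc_hcomp).
- move=> d a b; rewrite /pc_hcomp; case: ifP => _; last by rewrite addr0.
  by rewrite pcVD !raddfD.
- move=> d a; rewrite /pc_hcomp; case: ifP => d0.
    by apply/pc_hom; case: d d0 => // d _ /=; exact: pihomogP.
  by rewrite -(rmorph0 (pc th)); apply/pc_hom; exact: polynomial_hom0.
- move=> d a; rewrite /pc_hcomp; case: (lerP 0 d) => d0; last first.
    by move/(ghom_neg d0) ->.
  rewrite -(pcVK th a) pcK => /pc_hom; case: d d0 => // d _ /=.
  by move=> h; rewrite pihomog_dE.
- move=> d e a de; rewrite -(pcVK th a) => /pc_hom; rewrite /pc_hcomp pcK.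
  case: e de => e de /= ha; last by rewrite ha !raddf0; case: ifP.
  case: ifP => // d0; have ne : e != `|d|%N by apply: contraNneq de => ->; rewrite gez0_abs.
  by rewrite (pihomog_ne0 ne ha) rmorph0.
- move=> d e a b; rewrite -(pcVK th b) => bh; move: (bh).
  case: (lerP 0 e) => e0; last by move/(ghom_neg e0) ->; rewrite !mulr0 /pc_hcomp -(rmorph0 (pc th)) pcK !linear0 rmorph0; case: ifP.
  case: e e0 {bh} => // e _ /pc_hom /= bh; rewrite /pc_hcomp pcVM pcK.
  rewrite -[RHS]mulrC; case: (lerP 0 d) => d0.
    rewrite (pihomogMr _ _ bh) rmorphM mulrC; congr (_ * _).
    case: d d0 => // d _; case: (leqP e d) => ed.
      have -> : 0 <= d%:Z - e%:Z by lia.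
      by congr (pc th (pihomog _ _ _)); lia.
    have -> : (0 <= d%:Z - e%:Z) = false by lia.
    exact: rmorph0.
  have -> : (0 <= d - e%:Z) = false by lia.
  by rewrite mulr0.
- move=> d a b; rewrite -(pcVK th a) -(pcVK th b) => /pc_hom ha /pc_hom hb.
  rewrite -rmorphB; apply/pc_hom; case: d ha hb => d /=; last by move=> -> ->; rewrite subr0.
  exact: rpredB.
- move=> d e a b; rewrite -(pcVK th a) -(pcVK th b) => /pc_hom ha /pc_hom hb.
  rewrite -rmorphM; apply/pc_hom; case: d ha => d /= ha; last first.
    by rewrite ha mul0r; exact: polynomial_hom0.
  case: e hb => e /= hb; last by rewrite hb mulr0; exact: polynomial_hom0.
  exact: dhomogM.
- by move=> c; rewrite -(pcC th); apply/pc_hom; rewrite /= -alg_mpolyC; apply: dhomogZ; exact: dhomog1.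
Qed.

End PolynomialCoordinates.

Definition ksub n q := {T : {set 'I_n} | #|T| == q}.

Lemma card_ksub n q : #|{: ksub n q}| = 'C(n, q).
Proof. by rewrite card_sig -[in RHS](card_ord n) -card_draws; apply: eq_card => T; rewrite !inE. Qed.

Lemma ksub_sum n q (R : pzSemiRingType) (U : {set 'I_n}) (f : {set 'I_n} -> R) :
  #|U| = q -> \sum_(T : ksub n q) (val T == U)%:R * f (val T) = f U.
Proof.
move=> /eqP Uq; rewrite (bigD1 (Sub U Uq : ksub n q)) //= eqxx mul1r big1 ?addr0 //.
move=> T ne; case: eqP => [TU|_]; last by rewrite mul0r.
by case/eqP: ne; apply: val_inj.
Qed.

Section Sign.
Variables (R : pzRingType) (n : nat).

Definition ksign (v : 'I_n) (T : {set 'I_n}) : R :=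
  (-1) ^+ #|[set t in T | (t < v)%N]|.

Lemma ksign_swap (u v : 'I_n) (T : {set 'I_n}) : u \in T -> v \in T -> u != v ->
  ksign v T * ksign u (T :\ v) = - (ksign u T * ksign v (T :\ u)).
Proof.
wlog uv : u v / (u < v)%N.
  move=> H uT vT ne; have [lt|ge] := ltnP u v; first exact: H.
  by rewrite (H v u) ?opprK // 1?eq_sym // ltn_neqAle ge andbT eq_sym.
move=> uT vT ne.
have -> : ksign u (T :\ v) = ksign u T.
  congr (_ ^+ _); apply: eq_card => t; rewrite !inE.
  by case: eqP => //= ->; rewrite [(v < u)%N]ltnNge (ltnW uv) andbF.
have -> : ksign v T = - ksign v (T :\ u).
  rewrite /ksign [in LHS](cardsD1 u) !inE uT uv /= exprS mulN1r; congr (- _ ^+ _).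
  by apply: eq_card => t; rewrite !inE andbA.
by rewrite mulNr -!exprD addnC.
Qed.

End Sign.

Lemma ksign_neq0 (R : nzRingType) n (v : 'I_n) T : ksign R v T != 0.
Proof. by rewrite /ksign signr_eq0. Qed.

Lemma rmorph_ksign (R S : pzRingType) (f : {rmorphism R -> S}) n (v : 'I_n) T :
  f (ksign R v T) = ksign S v T.
Proof. by rewrite /ksign rmorphXn rmorphN rmorph1. Qed.

(** The terms with u < v cancel those with u > v. Nothing is divided by 2, so the characteristic is
    arbitrary. *)
Lemma sum_antisymmetric (V : zmodType) n (P : pred 'I_n) (G : 'I_n -> 'I_n -> V) :
  (forall u v, u != v -> P u -> P v -> G u v = - G v u) ->
  \sum_(v | P v) \sum_(u | P u && (u != v)) G v u = 0.
Proof.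
move=> GN; pose H v u := if [&& P v, P u & u != v] then G v u else 0.
have HN u v : H u v = - H v u.
  rewrite /H andbCA eq_sym; case: ifP => [/and3P[Pv Pu ne]|]; last by rewrite oppr0.
  by rewrite GN // eq_sym.
have HE v : \sum_u H v u = \sum_(u : 'I_n | (u < v)%N) H v u + \sum_(u : 'I_n | (v < u)%N) H v u.
  rewrite (bigID (fun u : 'I_n => (u < v)%N)) /=; congr (_ + _).
  rewrite (bigID (fun u : 'I_n => (v < u)%N)) /= addrC big1 ?add0r => [|u].
    by apply: eq_bigl => u; case: ltngtP.
  by rewrite -!leqNgt -eqn_leq => /eqP/val_inj ->; rewrite /H eqxx !andbF.
transitivity (\sum_v \sum_u H v u).
  rewrite big_mkcond; apply: eq_bigr => v _; rewrite /H; case: ifP => Pv.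
    by rewrite big_mkcond; apply: eq_bigr.
  by rewrite big1.
under eq_bigr => v _ do rewrite HE.
rewrite big_split /= [X in _ + X](exchange_big_dep predT) //= -big_split big1 // => v _.
by rewrite -big_split big1 //= => u _; rewrite HN addNr.
Qed.

Section KoszulComplex.
Variables (k : fieldType) (n : nat) (A : gring k) (th : coordinates n A).

Definition kentry (T' T : {set 'I_n}) : A :=
  \sum_(v in T') (T == T' :\ v)%:R * (ksign A v T' * pvar th v).

Definition koszul_diff q : 'M[A]_(#|{: ksub n q.+1}|, #|{: ksub n q}|) :=
  \matrix_(a, b) kentry (val (enum_val a)) (val (enum_val b)).

Definition koszul_complex : free_complex A :=
  FreeComplex (rk := fun q => #|{: ksub n q}|) (fun q _ => q%:Z) koszul_diff.

(** The two orders in which two elements can be removed from a set carry opposite signs. *)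
Lemma koszul_diff_diff q : koszul_diff q.+1 *m koszul_diff q = 0.
Proof.
apply/matrixP => a c; rewrite !mxE; set T2 := val (enum_val a); set T := val (enum_val c).
under eq_bigr => b _ do rewrite !mxE.
rewrite -(sum_enum_val (fun b : ksub n q.+1 => kentry T2 (val b) * kentry (val b) T)).
have T2c : #|T2| = q.+2 by apply/eqP; exact: valP (enum_val a).
transitivity (\sum_(v in T2) ksign A v T2 * pvar th v * kentry (T2 :\ v) T).
  under eq_bigr => b _ do rewrite {1}/kentry mulr_suml.
  rewrite exchange_big; apply: eq_bigr => v vT.
  have c1 : #|T2 :\ v| = q.+1 by have := cardsD1 v T2; rewrite vT T2c add1n => -[->].
  rewrite -(ksub_sum (fun b => ksign A v T2 * pvar th v * kentry b T) c1).
  by apply: eq_bigr => b _; rewrite !mulrA.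
under eq_bigr => v _ do rewrite /kentry mulr_sumr.
under eq_bigr => v _ do under eq_bigl => u do rewrite in_setD1 andbC.
apply: sum_antisymmetric => u v ne uT vT.
rewrite setDDl setUC -setDDl; case: eqP => _; last by rewrite !mul0r !mulr0 oppr0.
rewrite !mul1r.
have -> : ksign A u T2 * pvar th u * (ksign A v (T2 :\ u) * pvar th v)
  = ksign A u T2 * ksign A v (T2 :\ u) * (pvar th u * pvar th v) by ring.
have -> : ksign A v T2 * pvar th v * (ksign A u (T2 :\ v) * pvar th u)
  = ksign A v T2 * ksign A u (T2 :\ v) * (pvar th u * pvar th v) by ring.
by rewrite (ksign_swap A uT vT ne) mulNr opprK.
Qed.

Lemma kentry_hom (T' T : {set 'I_n}) : ghom 1 (kentry T' T).
Proof.
have gr := coordinates_grading th.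
apply: (ghom_sum gr) => v _; case: eqP => _; last by rewrite mul0r; exact: ghom0.
rewrite mul1r -[1]add0r; apply: (ghomM gr); last exact: pvar_hom.
by rewrite -(rmorph_ksign (gunit A)); exact: (ghom_unit gr).
Qed.

Lemma koszul_diff_hom q :
  hommx (@fdeg _ _ koszul_complex q.+1) (@fdeg _ _ koszul_complex q) (koszul_diff q).
Proof.
move=> a b; rewrite /fdeg /= mxE.
have -> : q.+1%:Z - q%:Z = 1 by lia.
exact: kentry_hom.
Qed.

End KoszulComplex.

(** * Graded bases and Koszul homology with coefficients *)

Section GradedBasis.
Variables (k : fieldType) (A : gring k) (M : gmod A).

(** The coordinate map [gc] is total, but it is a coordinate map only on homogeneous elements of
    degree d. *)
Record graded_basis (h : int -> nat) := GradedBasis {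
  gb : forall d, 'I_(h d) -> M;
  gc : forall d, M -> 'rV[k]_(h d);
  gb_hom : forall d i, mhom d (@gb d i);
  gbK : forall d x, mhom d x -> lin (@gb d) (gc d x) = x;
  gcK : forall d v, gc d (lin (@gb d) v) = v
}.

Variable gr : grading A.
Hypothesis Mgr : graded_action M.

Lemma graded_basis_exists h :
  (forall d, has_dim (@mhom _ _ M d) (fun x => x = 0) (h d)) ->
  inhabited (graded_basis h).
Proof.
move=> hd.
have B d : {b : 'I_(h d) -> M | (forall i, mhom d (b i)) /\
    forall z, mhom d z -> exists! c : 'rV[k]_(h d),
      z - \sum_(i < h d) gunit A (c 0 i) *: b i = 0}.
  exact (constructive_indefinite_description _ (hd d)).
have C d (z : M) : {c : 'rV[k]_(h d) | mhom d z -> z = lin (sval (B d)) c}.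
  apply: constructive_indefinite_description.
  case: (excluded_middle_informative (mhom d z)) => hz; last by exists 0 => /hz.
  have [c [/eqP]] := (svalP (B d)).2 z hz.
  by rewrite subr_eq0 => /eqP cE _; exists c.
split; apply: (@GradedBasis _ (fun d => sval (B d)) (fun d z => sval (C d z))).
- by move=> d i; exact: (svalP (B d)).1.
- by move=> d x hx; symmetry; exact: (svalP (C d x)).
move=> d v; set z := lin _ v.
have hz : mhom d z.
  by apply: ksubspace_sum => [|i _]; [exact: mhom_ksubspace|exact: (svalP (B d)).1].
have [c0 [_ cU]] := (svalP (B d)).2 z hz.
have <- : c0 = v by apply: cU; rewrite -/(lin _ v) subrr.
by symmetry; apply: cU; rewrite -/(lin _ _) -(svalP (C d z) hz) subrr.
Qed.

Section Coordinates.
Variables (h : int -> nat) (B : graded_basis h).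

Lemma lin_hom d (v : 'rV[k]_(h d)) : mhom d (lin (@gb _ B d) v).
Proof.
by apply: ksubspace_sum => [|i _]; [exact: mhom_ksubspace|exact: gb_hom].
Qed.

Lemma gc_sum d I (r : seq I) (P : pred I) (c : I -> k) (x : I -> M) :
  (forall i, P i -> mhom d (x i)) ->
  gc B d (\sum_(i <- r | P i) gunit A (c i) *: x i) =
  \sum_(i <- r | P i) c i *: gc B d (x i).
Proof.
move=> hx; rewrite -[RHS](gcK B).
rewrite (klinear_sum (lin_is_klinear _) (@scale1r _ _) (@kscale1 _ _ _)).
congr gc; apply: eq_bigr => i Pi.
rewrite (klinearZ (lin_is_klinear _) (@scale1r _ _) (@kscale1 _ _ _)).
by rewrite /kscale gbK //; exact: hx.
Qed.

Lemma gc0 d : gc B d 0 = 0.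
Proof. by rewrite -[in LHS](lin0 (@gb _ B d)) gcK. Qed.

Lemma gc_gb d a : gc B d (@gb _ B d a) = delta_mx 0 a.
Proof.
rewrite -[RHS](gcK B); congr (gc B d _); rewrite /lin (bigD1 a) //= mxE !eqxx.
by rewrite rmorph1 scale1r big1 ?addr0 // => i ne; rewrite mxE (negPf ne) andbF rmorph0 scale0r.
Qed.

(** Source and target degree are independent arguments to avoid casts between [h d] and
    [h (d' + 1)]; the matrix represents multiplication by a linear form only when d = d' + 1. *)
Definition mult_mx (y : A) d' d : 'M[k]_(h d', h d) :=
  \matrix_a gc B d (y *: @gb _ B d' a).

Lemma mult_mxE y d' d x : ghom 1 y -> d = d' + 1 -> mhom d' x ->
  gc B d' x *m mult_mx y d' d = gc B d (y *: x).
Proof.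
move=> hy -> hx; rewrite -[in RHS](gbK B hx) /lin scaler_sumr.
under [in RHS]eq_bigr => i _ do rewrite scalerA mulrC -scalerA.
rewrite gc_sum => [|i _]; last first.
  by rewrite addrC; apply: Mgr.2 => //; exact: gb_hom.
by rewrite mulmx_sum_row; apply: eq_bigr => i _; rewrite rowK.
Qed.

Lemma mult_mx_lin y d' d v : ghom 1 y -> d = d' + 1 ->
  y *: lin (@gb _ B d') v = lin (@gb _ B d) (v *m mult_mx y d' d).
Proof.
move=> hy dd; have hv := lin_hom v; rewrite -[in RHS](gcK B v) mult_mxE // gbK //.
by rewrite dd addrC; apply: Mgr.2.
Qed.

End Coordinates.
End GradedBasis.

Section KoszulHomology.
Variables (k : fieldType) (n : nat) (A : gring k) (th : coordinates n A).
Variables (M : gmod A) (h : int -> nat).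
Hypothesis Mgr : graded_action M.
Variable B : graded_basis M h.

Let gr := coordinates_grading th.
Let K := koszul_complex th.

(* The rank of the Koszul differential from exterior degree r, in internal
   degrees d' and d = d' + 1. *)
Definition krank r d' d : nat :=
  frank (kmx (ksign k (n:=n)) r (fun v => mult_mx B (pvar th v) d' d)).

Lemma krank0 d' d : krank 0 d' d = 0%N.
Proof.
rewrite /krank /frank; apply/eqP; rewrite mxrank_eq0; apply/eqP/matrixP => i j.
rewrite !mxE /kmx; case: ifP => //; rewrite cards_eq0 => /eqP ->.
by rewrite big_set0.
Qed.

Let kms q d' d (i : ksub n q.+1 * 'I_(h d')) (j : ksub n q * 'I_(h d)) : k :=
  kmx (ksign k (n:=n)) q.+1 (fun v => mult_mx B (pvar th v) d' d)
    (val i.1, i.2) (val j.1, j.2).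

(** [kmx] is indexed by all subsets, but its entries vanish unless the cardinalities are q+1 and q,
    so the restriction to these keeps the rank. *)
Lemma frank_kms q d' d : frank (@kms q d' d) = krank q.+1 d' d.
Proof.
apply/eqP; rewrite eqn_leq; apply/andP; split.
  exact: (frank_sub _ (fun i => (val i.1, i.2)) (fun j => (val j.1, j.2))).
apply: (@frank_le _ _ _ _ _ _ _ (fun i' i => (i' == (val i.1, i.2))%:R)
  (fun j j' => (j' == (val j.1, j.2))%:R)) => -[T' a] [T b].
have zero : #|T'| != q.+1 \/ #|T| != q ->
    kmx (ksign k (n:=n)) q.+1 (fun v => mult_mx B (pvar th v) d' d) (T', a) (T, b) = 0.
  rewrite /kmx /=; case: eqP => // T'q [//|Tq]; rewrite big1 // => v vT.
  case: eqP => [TE|_]; last by rewrite mul0r.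
  by case/eqP: Tq; have := cardsD1 v T'; rewrite vT T'q -TE add1n => -[].
have [T'q|T'q] := boolP (#|T'| == q.+1); last first.
  rewrite zero; last by left.
  rewrite big1 // => i _; rewrite big1 // => j _; case: eqP; last by rewrite !mul0r.
  by case=> T'E _; case/negP: T'q; rewrite T'E; exact: (valP i.1).
have [Tq|Tq] := boolP (#|T| == q); last first.
  rewrite zero; last by right.
  rewrite big1 // => i _; rewrite big1 // => j _.
  have -> : ((T, b) == (val j.1, j.2)) = false; last by rewrite mulr0.
  apply/negP => /eqP[TE _]; case/negP: Tq; rewrite TE; exact: (valP j.1).
rewrite (bigD1 (Sub T' T'q : ksub n q.+1, a)) //= [X in _ + X]big1 ?addr0; last first.
  move=> [U c] ne; rewrite big1 // => j _; case: eqP; last by rewrite !mul0r.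
  by case=> TU ac; case/eqP: ne; congr (_, _) => //; apply: val_inj.
rewrite (bigD1 (Sub T Tq : ksub n q, b)) //= [X in _ + X]big1 ?addr0 ?eqxx ?mul1r ?mulr1 //.
move=> [U c] ne; case: eqP; last by rewrite mulr0.
by case=> TU ac; case/eqP: ne; congr (_, _) => //; apply: val_inj.
Qed.

(** From coordinate vectors to elements of the q-th Koszul term tensored with [M] whose components
    have degree d in [M]. *)
Let cv q d (v : 'rV[k]_#|{: ksub n q * 'I_(h d)}|) : {ffun 'I_(rk K q) -> M} :=
  [ffun b => lin (@gb _ _ _ _ B d) (\row_a v 0 (enum_rank (enum_val b, a)))].

Let cv_klinear q d : klinear *:%R (@kscale k A {ffun 'I_(rk K q) -> M}) (@cv q d).
Proof.
move=> c x y; apply/ffunP => b; rewrite /kscale !ffunE.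
rewrite -[RHS](lin_is_klinear (@gb _ _ _ _ B d)); congr lin.
by apply/rowP => a; rewrite !mxE.
Qed.

Let cv_hom q d j v : j = d + q%:Z -> @tensor_hom _ _ M K q j (@cv q d v).
Proof.
move=> -> b; rewrite /fdeg /= addrK ffunE.
exact: (lin_hom gr Mgr).
Qed.

Let cv_surj q d j m : j = d + q%:Z -> @tensor_hom _ _ M K q j m -> exists v, m = @cv q d v.
Proof.
move=> -> hm; exists (\row_i gc B d (m (enum_rank (enum_val i).1)) 0 (enum_val i).2).
apply/ffunP => b; rewrite ffunE.
have hb : mhom d (m b) by have := hm b; rewrite /fdeg /= addrK.
rewrite -{1}(gbK B hb); congr lin; apply/rowP => a.
by rewrite !mxE enum_rankK /= enum_valK.
Qed.

Let cv_inj q d v : @cv q d v = 0 -> v = 0.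
Proof.
move=> v0; apply/rowP => i; rewrite [RHS]mxE.
have := congr1 (fun f : {ffun 'I_(rk K q) -> M} => gc B d (f (enum_rank (enum_val i).1))) v0.
rewrite !ffunE gcK gc0 => /rowP/(_ (enum_val i).2); rewrite !mxE enum_rankK.
by rewrite -surjective_pairing enum_valK.
Qed.

Let cv_diff q d' d w : d = d' + 1 ->
  tens (koszul_diff th q) (@cv q.+1 d' w) = @cv q d (w *m fmx (@kms q d' d)).
Proof.
move=> dd; apply/ffunP => b; rewrite !ffunE; set T := val (enum_val b).
have linS := klinear_sum (lin_is_klinear (@gb _ _ _ _ B d)) (@scale1r _ _) (@kscale1 _ _ _).
have linZ := klinearZ (lin_is_klinear (@gb _ _ _ _ B d)) (@scale1r _ _) (@kscale1 _ _ _).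
pose wr (T' : ksub n q.+1) : 'rV[k]_(h d') := \row_a w 0 (enum_rank (T', a)).
transitivity (\sum_(T' : ksub n q.+1) lin (@gb _ _ _ _ B d)
  (\sum_(v in val T') ((T == val T' :\ v)%:R * ksign k v (val T'))
      *: (wr T' *m mult_mx B (pvar th v) d' d))).
  rewrite [RHS]sum_enum_val; apply: eq_bigr => a _; rewrite mxE ffunE -/T.
  rewrite -/(wr (enum_val a)) /kentry scaler_suml linS; apply: eq_bigr => v _.
  rewrite linZ -(mult_mx_lin gr Mgr B _ (pvar_hom th v) dd) /kscale scalerA.
  congr (_ *: _); rewrite rmorphM mulrA rmorph_nat.
  by rewrite (rmorph_ksign (gunit A)).
rewrite -linS; congr lin; apply/rowP => j; rewrite summxE !mxE.
rewrite (sum_enum_val (fun T' : ksub n q.+1 => _)).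
have pairE (f : ksub n q.+1 * 'I_(h d') -> k) : \sum_i f i = \sum_a \sum_b f (a, b).
  by rewrite pair_bigA /=; apply: eq_bigr => -[].
transitivity (\sum_(i : ksub n q.+1 * 'I_(h d')) w 0 (enum_rank i) * @kms q d' d i (enum_val b, j)); last first.
  by rewrite [LHS]sum_enum_val; apply: eq_bigr => i _; rewrite enum_valK !mxE enum_rankK.
rewrite pairE [RHS]sum_enum_val; apply: eq_bigr => a _; rewrite summxE.
set T' := enum_val a; rewrite /kms /kmx /= (eqP (valP T')) eqxx.
under [RHS]eq_bigr => i _ do rewrite mulr_sumr.
rewrite exchange_big; apply: eq_bigr => v _; rewrite !mxE mulr_sumr.
by apply: eq_bigr => i _; rewrite !mxE -/T; ring.
Qed.

Lemma kms_kms q d'' d' d : d' = d'' + 1 -> d = d' + 1 ->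
  fmx (@kms q.+1 d'' d') *m fmx (@kms q d' d) = 0.
Proof.
move=> dd' dd; apply/row_matrixP => i; rewrite row0 row_mul rowE; apply: cv_inj.
rewrite -cv_diff // -cv_diff // -tensM koszul_diff_diff.
by apply/ffunP => b; rewrite !ffunE big1 // => a _; rewrite mxE scale0r.
Qed.

Lemma krank_le q d'' d' d : d' = d'' + 1 -> d = d' + 1 ->
  (krank q d' d + krank q.+1 d'' d' <= 'C(n, q) * h d')%N.
Proof.
have cardE : #|{: ksub n q * 'I_(h d')}| = ('C(n, q) * h d')%N.
  by rewrite card_prod card_ksub card_ord.
move=> dd' dd; case: q cardE => [|q] cardE.
  by rewrite krank0 add0n -frank_kms -cardE rank_leq_col.
rewrite -!frank_kms -cardE addnC; apply: mulmx0_rank_max.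
exact: kms_kms.
Qed.

(** Cycles form the kernel of the differential that leaves the strand, boundaries the row space of
    the one that enters it. Exterior degree 0 is separate, since every element there is a cycle. *)
Lemma koszul_has_dim q j : let d := j - q%:Z in
  has_dim (@cycles _ _ M K q j) (@boundaries _ _ M K q j)
    ('C(n, q) * h d - krank q d (d + 1) - krank q.+1 (d - 1) d).
Proof.
move=> d; have jd : j = d + q%:Z by rewrite subrK.
have jd' : j = (d - 1) + q.+1%:Z by rewrite /d; lia.
have dd : d = d - 1 + 1 by rewrite subrK.
have cardE : #|{: ksub n q * 'I_(h d)}| = ('C(n, q) * h d)%N.
  by rewrite card_prod card_ksub card_ord.
have bd v : @boundaries _ _ M K q j (@cv q d v) <-> (v <= fmx (@kms q (d - 1) d))%MS.
  split=> [[w hw wE]|/submxP[u ->]].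
    have [u uE] := cv_surj jd' hw; rewrite uE in wE.
    have E : @cv q d v = @cv q d (u *m fmx (@kms q (d - 1) d)) by rewrite -cv_diff.
    suff -> : v = u *m fmx (@kms q (d - 1) d) by exact: submxMl.
    apply/eqP; rewrite -subr_eq0; apply/eqP/cv_inj.
    rewrite (klinearB (@cv_klinear q d) (@scale1r _ _) (@kscale1 _ _ _)).
    by rewrite E subrr.
  exists (@cv q.+1 (d - 1) u); first exact: cv_hom.
  by rewrite -cv_diff.
case: q @d jd jd' dd cardE bd => [|q] d jd jd' dd cardE bd.
  rewrite krank0 subn0 -cardE -(mxrank1 k #|{: ksub n 0 * 'I_(h d)}|) -frank_kms.
  apply: (@has_dim_coordinates _ _ _ _ _ _ (@cv 0 d)).
  - exact: cv_klinear.
  - by move=> z hz; have [v ->] := cv_surj jd hz; exists v => //; exact: submx1.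
  - by move=> v _; exact: cv_hom.
  - by move=> v _; exact: bd.
  - exact: submx1.
have -> : ('C(n, q.+1) * h d - krank q.+1 d (d + 1))%N = \rank (kermx (fmx (@kms q d (d + 1)))).
  by rewrite mxrank_ker -cardE -frank_kms.
rewrite -(frank_kms q.+1).
have cyc v : (v <= kermx (fmx (@kms q d (d + 1))))%MS <-> tensor_diff (@cv q.+1 d v) = 0.
  rewrite -[tensor_diff _]/(tens _ _) (@cv_diff q d (d + 1)) //.
  split=> [/sub_kermxP->|/cv_inj/sub_kermxP //].
  exact: klinear0 (@cv_klinear q (d + 1)) (@scale1r _ _) (@kscale1 _ _ _).
apply: (@has_dim_coordinates _ _ _ _ _ _ (@cv q.+1 d)).
- exact: cv_klinear.
- by move=> z [hz z0]; have [v zE] := cv_surj jd hz; exists v => //; apply/cyc; rewrite -zE.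
- by move=> v /cyc v0; split => //; exact: cv_hom.
- by move=> v _; exact: bd.
- by apply/sub_kermxP; exact: kms_kms.
Qed.

End KoszulHomology.

(** * Numerical exactness of the Koszul complex *)

Lemma card_monomial n m : #|{: monomial n.+1 m}| = 'C(n + m, n).
Proof.
rewrite -(card_ord_partitions n m).
pose f (t : n.+1.-tuple 'I_m.+1) : 'X_{1..n.+1} := [multinom (tnth t i : nat) | i < n.+1].
have fdeg t : mdeg (f t) = (\sum_(i <- t) i)%N.
  rewrite mdegE big_tuple; apply: eq_bigr => i _; by rewrite mnmE.
pose g (b : monomial n.+1 m) : n.+1.-tuple 'I_m.+1 := [tuple inord (mnm_of b i) | i < n.+1].
have gE b i : tnth (g b) i = mnm_of b i :> nat.
  rewrite tnth_mktuple inordK // ltnS -{2}(mdeg_mnm_of b) mdegE (bigD1 i) //=.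
  exact: leq_addr.
have fg b : f (g b) = mnm_of b by apply/mnmP => i; rewrite mnmE gE.
have g_inj : injective g by move=> b b' /(congr1 f); rewrite !fg => /mnm_of_inj.
rewrite -(card_imset _ g_inj); apply: eq_card => t; rewrite !inE.
apply/imsetP/eqP => [[b _ ->]|tm]; first by rewrite -fdeg fg mdeg_mnm_of.
have [|b bt] := @monomial_exists n.+1 m (f t); first by rewrite fdeg.
exists b => //; apply: eq_from_tnth => i; apply: val_inj => /=.
by rewrite gE bt mnmE.
Qed.

Lemma bin_monomialS n m : (m.+1 * 'C(n + m.+1, n) = (n + m.+1) * 'C(n + m, n))%N.
Proof.
have flip a : 'C(n + a, n) = 'C(n + a, a) by rewrite -bin_sub ?leq_addr // addKn.
by rewrite !flip addnS mul_bin_diag.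
Qed.

(** Divided by m+1+q, the left side is the sum of the lower bounds for two consecutive Koszul ranks
    of the polynomial ring in n+1 variables, and the right side is the dimension between them, in
    exterior degree q+1 and degree m. *)
Lemma bin_koszul n m q :
  (m.+1 * 'C(n, q) * 'C(n + m.+1, n) + m * 'C(n, q.+1) * 'C(n + m, n)
   = (m.+1 + q) * ('C(n.+1, q.+1) * 'C(n + m, n)))%N.
Proof.
have H1 := bin_monomialS n m.
have H2 : ((n.+1) * 'C(n, q) = q.+1 * 'C(n.+1, q.+1))%N by rewrite mul_bin_diag.
have H3 : 'C(n.+1, q.+1) = ('C(n, q.+1) + 'C(n, q))%N by rewrite binS.
rewrite -mulnA [X in (X + _)%N]mulnCA H1 H3.
rewrite H3 in H2; move: H2.
move: ('C(n, q)) ('C(n, q.+1)) ('C(n + m, n)) => a b c H2.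
have : ((n.+1 * a) * c = (q.+1 * (b + a)) * c)%N by rewrite H2.
nia.
Qed.

Section MonomialBasis.
Variables (k : fieldType) (n : nat) (A : gring k) (th : coordinates n.+1 A).
Variables (M : gmod A) (h : int -> nat).
Hypothesis Mgr : graded_action M.
Variables (B : graded_basis M h) (e : M).
Hypothesis e_hom : mhom 0 e.

Definition monomial_basis (m : nat) := forall a : 'I_(h m%:Z),
  exists2 b : 'X_{1..n.+1}, mdeg b = m & @gb _ _ _ _ B m%:Z a = pmon th b *: e.

Lemma krank_monomial_ge q m : monomial_basis m.+1 ->
  (m.+1 * 'C(n, q) * h m.+1%:Z <= (m.+1 + q) * krank th B q.+1 m%:Z m.+1%:Z)%N.
Proof.
move=> mb; have gr := coordinates_grading th.
have hm b : mhom (mdeg b)%:Z (pmon th b *: e).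
  by rewrite -[(_)%:Z]addr0; apply: Mgr.2 => //; exact: pmon_hom.
apply: (@koszul_rank_ge k n 1 _ _ m q _ _
  (fun b _ => gc B m%:Z (pmon th b *: e)) (fun b _ => gc B m.+1%:Z (pmon th b *: e))).
- by move=> v T _; exact: ksign_neq0.
- move=> b _ v db; rewrite mult_mxE //.
  + by rewrite pmonD scalerA.
  + exact: pvar_hom.
  + by rewrite -addn1 PoszD.
  + by rewrite -db.
- move=> z wz; apply/colP => a; rewrite [RHS]mxE.
  have [b db gbE] := mb a; have := wz b ord0 db; rewrite -gbE.
  by rewrite gc_gb -rowE => /rowP/(_ 0); rewrite !mxE.
Qed.

Hypothesis h_neg : forall m, h (Negz m) = 0%N.

Lemma krank_monomial_source q m : h m%:Z = 'C(n + m, n) -> monomial_basis m ->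
  (m * 'C(n, q) * 'C(n + m, n) <= (m + q) * krank th B q.+1 (m%:Z - 1) m%:Z)%N.
Proof.
case: m => [|m] hm mb; first by rewrite !mul0n.
rewrite -hm; have -> : m.+1%:Z - 1 = m%:Z by lia.
exact: krank_monomial_ge.
Qed.

(** The sum of this rank and of the one that enters the strand is at most a dimension which, by
    [bin_koszul], equals the sum of their lower bounds; so the lower bound is attained. *)
Lemma krank_monomial q m : h m%:Z = 'C(n + m, n) -> h m.+1%:Z = 'C(n + m.+1, n) ->
  monomial_basis m -> monomial_basis m.+1 ->
  ((m.+1 + q) * krank th B q.+1 m%:Z m.+1%:Z = m.+1 * 'C(n, q) * 'C(n + m.+1, n))%N.
Proof.
move=> hm hm1 mb mb1; apply/eqP; rewrite eqn_leq; apply/andP; split; last first.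
  by rewrite -hm1; exact: krank_monomial_ge.
have up := @krank_le _ _ _ th _ _ Mgr B q.+1 (m%:Z - 1) m%:Z m.+1%:Z.
have {}up := up _ _; rewrite hm in up.
have := krank_monomial_source q.+1 hm mb; have := bin_koszul n m q.
have {}up := up (esym (subrK _ _)) (congr1 Posz (esym (addn1 m))).
nia.
Qed.

End MonomialBasis.

Section RegularModule.
Variables (k : fieldType) (n : nat) (A : gring k) (th : coordinates n.+1 A).
Let gr := coordinates_grading th.

Definition regular_module : gmod A := @MkGmod k A A^o (fun j a => ghom j (a : A)).

Lemma regular_graded : graded_action regular_module.
Proof.
split=> [j|i j a x]; first by split; [exact: ghom0 gr j|exact: (@ghomB _ _ gr j)].
exact: (ghomM gr).
Qed.

Definition regular_dim (d : int) : nat :=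
  if d is Posz m then #|{: monomial n.+1 m}| else 0%N.

Definition regular_gb d : 'I_(regular_dim d) -> regular_module :=
  match d with
  | Posz m => fun i => pmon th (mnm_of (enum_val i))
  | Negz _ => fun _ => 0
  end.

Definition regular_gc d (x : regular_module) : 'rV[k]_(regular_dim d) :=
  match d with
  | Posz m => \row_i (pcV th x)@_(mnm_of (enum_val i))
  | Negz _ => 0
  end.

Lemma regular_lin m (v : 'rV[k]_(regular_dim m%:Z)) :
  lin (@regular_gb m%:Z) v =
  pc th (\sum_(b : monomial n.+1 m) v 0 (enum_rank b) *: 'X_[mnm_of b]).
Proof.
rewrite /lin rmorph_sum [RHS]sum_enum_val; apply: eq_bigr => i _.
by rewrite enum_valK -mul_mpolyC rmorphM pcC.
Qed.

Lemma regular_basis : graded_basis regular_module regular_dim.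
Proof.
apply: (@GradedBasis _ _ _ _ regular_gb regular_gc).
- move=> [m|m] i; last by case: i.
  by rewrite /= -[X in ghom X%:Z](mdeg_mnm_of (enum_val i)); exact: pmon_hom.
- move=> [m|m] x hx; last first.
    by rewrite /lin big_ord0; symmetry; apply: (ghom_neg th) hx.
  rewrite regular_lin -[RHS](pcVK th); congr (pc th _).
  move: hx; rewrite /= -{1}(pcVK th x) => /pc_hom /= hx.
  apply/mpolyP => b; rewrite raddf_sum /=.
  have [db|db] := eqVneq (mdeg b) m; last first.
    rewrite (dhomog_nemf_coeff hx db) big1 // => b' _.
    rewrite mcoeffZ mcoeffX; case: eqP => [E|]; last by rewrite mulr0.
    by case/eqP: db; rewrite -E mdeg_mnm_of.
  have [b' b'E] := monomial_exists db.
  rewrite (bigD1 b') //= big1 ?addr0 => [|b2 ne].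
    by rewrite mcoeffZ mcoeffX b'E eqxx mulr1 mxE enum_rankK b'E.
  rewrite mcoeffZ mcoeffX -b'E; case: eqP => [/mnm_of_inj E|]; last by rewrite mulr0.
  by rewrite E eqxx in ne.
- move=> [m|m] v; last by apply/rowP => -[].
  apply/rowP => i; rewrite mxE regular_lin pcK raddf_sum /=.
  rewrite (bigD1 (enum_val i)) //= big1 ?addr0 => [|b2 ne].
    by rewrite mcoeffZ mcoeffX eqxx mulr1 enum_valK.
  rewrite mcoeffZ mcoeffX; case: eqP => [/mnm_of_inj E|]; last by rewrite mulr0.
  by rewrite E eqxx in ne.
Defined.

Lemma regular_monomial_basis m : monomial_basis th regular_basis (1 : A) m.
Proof.
move=> a; exists (mnm_of (enum_val a)); first exact: mdeg_mnm_of.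
by rewrite /= /GRing.scale /= mulr1.
Qed.

End RegularModule.

(** * Betti numbers through Koszul ranks *)
Section ResidueField.
Variables (k : fieldType) (n : nat) (A : gring k) (th : coordinates n.+1 A).
Let gr := coordinates_grading th.
Let K := koszul_complex th.
Let R := regular_module A.
Let B := regular_basis th.
Let N := residue_field A.

(** The rank bounds for the two differentials fill the dimension of the strand, so the homology has
    dimension 0. Exterior degree 0 needs positive degree, because the cokernel there is the residue
    field. *)
Lemma koszul_homogeneous_exact q j (z : {ffun 'I_(rk K q) -> R}) :
  (q = 0%N -> 0 < j) -> @cycles _ _ R K q j z -> @boundaries _ _ R K q j z.
Proof.
move=> q0 zC; have Rgr := regular_graded th.
have := koszul_has_dim th Rgr B q j; rewrite /=.
set d := j - q%:Z; set N0 := (_ - _ - _)%N => hd.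
suff N00 : N0 = 0%N.
  case: hd => b [_ bB]; have [c [zB _]] := bB z zC.
  move: zB; rewrite big1 ?subr0 // => -[i lt _]; exfalso.
  by move: lt; rewrite N00.
have mb m : monomial_basis th B (1 : A) m by exact: regular_monomial_basis.
have one_hom : @mhom _ _ R 0 (1 : A).
  by rewrite -(rmorph1 (gunit A)); exact: (ghom_unit gr).
have hE m : regular_dim n m%:Z = 'C(n + m, n) by rewrite /= card_monomial.
rewrite {hd}/N0; case dE: d => [m|m]; last by rewrite muln0.
have -> : m%:Z + 1 = m.+1%:Z by lia.
rewrite hE; case: q q0 z zC @d dE => [|q] q0 z zC d dE.
  rewrite krank0 bin0 mul1n subn0.
  have := krank_monomial_source Rgr one_hom 0 (hE m) (mb m).
  rewrite bin0 muln1 addn0 leq_pmul2l => [le|]; first by apply/eqP; rewrite subn_eq0.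
  by have := q0 erefl; move: dE; rewrite /d; lia.
have := krank_monomial_source Rgr one_hom q.+1 (hE m) (mb m).
have := krank_monomial_ge Rgr one_hom q (mb m.+1); rewrite hE.
have := bin_koszul n m q.
move: (krank _ _ _ _ _) (krank _ _ _ _ _) => k1 k2.
nia.
Qed.

Lemma homogeneous_decomposition (I : finType) (a : I -> A) :
  exists N, forall i, a i = \sum_(d < N) hcomp gr d%:Z (a i).
Proof.
pose N0 := \max_i msize (pcV th (a i)); exists N0 => i.
have -> : \sum_(d < N0) hcomp gr d%:Z (a i) =
    \sum_(d < N0) \sum_(e < N0) hcomp gr d%:Z (pc th (pihomog mdeg e (pcV th (a i)))).
  apply: eq_bigr => d _; rewrite -hcomp_sum -rmorph_sum -pihomog_partitionE ?pcVK //.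
  exact: (leq_bigmax (F := fun i => msize (pcV th (a i)))).
rewrite exchange_big -{1}(pcVK th (a i)).
rewrite {1}(@pihomog_partitionE _ _ mdeg N0 (pcV th (a i))); last first.
  exact: (leq_bigmax (F := fun i => msize (pcV th (a i)))).
rewrite rmorph_sum; apply: eq_bigr => e _.
have eh : ghom (e : nat)%:Z (pc th (pihomog mdeg e (pcV th (a i)))).
  by apply/pc_hom; exact: pihomogP.
rewrite (bigD1 e) //= (hcomp_id gr eh) big1 ?addr0 // => d de.
by apply: (hcomp_other _ _ eh); rewrite eqz_nat.
Qed.

Lemma pc_decomposition (r : nat) (v : 'rV[A]_r) :
  exists N, v = \sum_(d < N) map_mx (hcomp gr d%:Z) v.
Proof.
have [N0 vE] := homogeneous_decomposition (fun i => v 0 i); exists N0.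
by apply/rowP => i; rewrite summxE vE; apply: eq_bigr => d _; rewrite mxE.
Qed.

Lemma hcomp_neg d a : d < 0 -> hcomp gr d a = 0.
Proof. by move=> d0; apply: (ghom_neg th d0); exact: hcomp_hom. Qed.

(** The homogeneous components are lifted one by one. In exterior degree 0 the hypothesis removes
    the constant component, the only one that need not be in the image. *)
Lemma koszul_exact q (v : 'rV[A]_(rk K q)) :
  match q as q return 'rV[A]_(rk K q) -> Prop with
  | 0 => fun v => forall b, hcomp gr 0 (v 0 b) = 0
  | _.+1 => fun v => v *m fdiff K _ = 0
  end v -> exists w, v = w *m fdiff K q.
Proof.
move=> vC; have [N0 vE] := pc_decomposition v.
suff H d : exists w, map_mx (hcomp gr d%:Z) v = w *m fdiff K q.
  pose W d := epsilon (inhabits 0) (fun w => map_mx (hcomp gr d%:Z) v = w *m fdiff K q).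
  exists (\sum_(d < N0) W d); rewrite {1}vE mulmx_suml; apply: eq_bigr => d _.
  exact: (epsilon_spec (inhabits 0) (fun w => map_mx (hcomp gr d%:Z) v = w *m fdiff K q) (H d)).
have [/andP[/eqP q0 /eqP d0]|ne] := boolP ((q == 0%N) && (d == 0%N)).
  exists 0; rewrite mul0mx; apply/rowP => b; rewrite !mxE.
  by case: q q0 v vC {vE} b => // _ v vC b; rewrite d0 vC.
pose z : {ffun 'I_(rk K q) -> R} := [ffun b => hcomp gr d%:Z (v 0 b)].
have zE b : z b = hcomp gr d%:Z (v 0 b) by rewrite ffunE.
have zh : @tensor_hom _ _ R K q (d%:Z + q%:Z) z.
  by move=> b; rewrite /fdeg /= addrK zE; exact: hcomp_hom.
have [||w _ zw] := @koszul_homogeneous_exact q (d%:Z + q%:Z) z.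
- by move=> q0; move: ne; rewrite q0 eqxx /=; lia.
- case: q v vC vE ne z zE zh => [|q] v vC vE ne z zE zh //; split=> //.
  apply/ffunP => b; rewrite !ffunE.
  transitivity (hcomp gr (d%:Z + 1) ((v *m fdiff K q) 0 b)); last by rewrite vC mxE hcomp0.
  rewrite mxE hcomp_sum; apply: eq_bigr => a _.
  rewrite (hcompMr _ _ _ (e := 1)); last by rewrite mxE; exact: kentry_hom.
  by rewrite addrK zE /GRing.scale /= mulrC.
exists (\row_a w a); apply/rowP => b; have := congr1 (fun f : {ffun _} => f b) zw.
rewrite zE ffunE !mxE => ->; apply: eq_bigr => a _.
by rewrite [(\row_a0 w a0) _ _]mxE; exact: mulrC.
Qed.

Lemma irrelevant_hcomp0 (a : A) : @lspan A A^o (@irrelevant k A) a -> hcomp gr 0 a = 0.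
Proof.
move=> [m [c [x [xI ->]]]]; rewrite hcomp_sum big1 // => i _.
have [m' [c' [y [yh ->]]]] := xI i; rewrite scaler_sumr hcomp_sum big1 // => j _.
have [e e0 ye] := yh j; change (hcomp gr 0 (c i * (c' j * y j)) = 0); rewrite mulrA (hcompMr _ _ _ ye).
by rewrite hcomp_neg ?mul0r // sub0r oppr_lt0.
Qed.

Lemma ghom_irrelevant (d : int) (a : A) : 0 < d -> ghom d a -> irrelevant a.
Proof.
move=> d0 ha; exists 1%N, (fun=> 1), (fun=> a); split; first by exists d.
by rewrite big_ord1 scale1r.
Qed.

Lemma lspan_sub (X : A -> Prop) a : X a -> @lspan A A^o X a.
Proof. by exists 1%N, (fun=> 1), (fun=> a); split=> //; rewrite big_ord1 scale1r. Qed.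

Lemma residue_proj0 (a : A) : proj (@irrelevant k A) a = 0 <-> hcomp gr 0 a = 0.
Proof.
have -> : (proj (@irrelevant k A) a = 0) <-> (a \in ideal (@irrelevant k A)).
  by rewrite -(rmorph0 (proj (@irrelevant k A))) proj_eq subr0.
split=> [/idealP|a0]; first exact: irrelevant_hcomp0.
have [N0 /rowP/(_ 0)] := pc_decomposition (const_mx a : 'rV_1).
rewrite mxE summxE => ->; apply: (rpred_sum (S := ideal_zmodClosed (@irrelevant k A))) => d _.
rewrite !mxE; have [d0|d0] := eqVneq (d : nat) 0%N.
  by rewrite d0 a0; exact: (rpred0 (ideal_zmodClosed (@irrelevant k A))).
apply/idealP/lspan_sub/(@ghom_irrelevant d%:Z); last exact: hcomp_hom.
by rewrite ltz_nat lt0n.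
Qed.

Lemma residue_scale (a : A) (x : N) : a *: x = hcomp gr 0 a *: x.
Proof.
apply/eqP; rewrite -subr_eq0 -scalerBl; apply/eqP.
have [b ->] := proj_surj x; rewrite /GRing.scale /= /quo_scale.
suff -> : proj (@irrelevant k A) (a - hcomp gr 0 a) = 0 by rewrite mul0r.
apply/residue_proj0/(@addIr _ (hcomp gr 0 a)); rewrite add0r -{2}(hcomp_id gr (hcomp_hom gr 0 a)).
by rewrite -hcompD subrK.
Qed.

Lemma residue_mhom (d : int) (x : N) : d != 0 -> mhom d x -> x = 0.
Proof.
move=> d0 [a ha ->]; apply/residue_proj0.
by apply: (hcomp_other _ _ ha); rewrite eq_sym.
Qed.

(** The residue field is concentrated in degree 0 and ring elements act on it through their
    components of degree 0, so the entries of any lift may be replaced by components. *)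
Lemma residue_cover : graded_cover N.
Proof.
move=> F e eF d x hx; have [[_ he] esurj _ _] := eF.
have [v vE] := esurj x; have [d0|d0] := eqVneq d 0; last first.
  exists 0 => [b|]; first by rewrite mxE; exact: ghom0.
  rewrite (residue_mhom d0 hx) /augment big1 // => b _; by rewrite mxE scale0r.
exists (\row_b hcomp gr (d - fdeg b) (v 0 b)) => [b|].
  by rewrite mxE; exact: hcomp_hom.
rewrite vE; apply: eq_bigr => b _; rewrite mxE.
have [db|db] := eqVneq (fdeg b) 0; last by rewrite (residue_mhom db (he b)) !scaler0.
by rewrite db d0 subr0 residue_scale.
Qed.

Definition residue_augmentation : 'I_(rk K 0) -> N := fun _ => proj (@irrelevant k A) 1.

Lemma koszul_resolution : free_resolution residue_augmentation.
Proof.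
have augE v : augment residue_augmentation v = proj (@irrelevant k A) (\sum_b v 0 b).
  rewrite /augment rmorph_sum; apply: eq_bigr => b _.
  by rewrite /GRing.scale /= /quo_scale -rmorphM mulr1.
have rk0 : #|'I_(rk K 0)| = 1%N by rewrite card_ord [LHS]card_ksub bin0.
have sum1 (v : 'rV[A]_(rk K 0)) b : \sum_c v 0 c = v 0 b.
  have [c0 c0E] := mem_card1 rk0.
  rewrite (bigD1 b) //= big1 ?addr0 // => c; move: (c0E c) (c0E b).
  by rewrite !inE => /esym/eqP-> /esym/eqP->; rewrite eqxx.
split.
- split=> [i a b|b]; first exact: koszul_diff_hom.
  exists 1 => //; rewrite /fdeg /= -(rmorph1 (gunit A)); exact: (ghom_unit gr).
- move=> x; have [a ->] := proj_surj x; exists (const_mx a); rewrite augE.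
  congr (proj _ _); have /card_gt0P[b _] : (0 < #|'I_(rk K 0)|)%N by rewrite rk0.
  by rewrite (sum1 _ b) mxE.
- move=> v; rewrite augE; split=> [/residue_proj0 v0|[w ->]].
    by apply: koszul_exact => b; rewrite -(sum1 v b).
  apply/residue_proj0; rewrite hcomp_sum big1 // => b _.
  rewrite mxE hcomp_sum big1 // => a _.
  rewrite (hcompMr _ _ _ (e := 1)); last by rewrite mxE; exact: kentry_hom.
  by rewrite hcomp_neg ?mul0r.
move=> i v; split=> [v0|[w ->]]; first exact: (@koszul_exact i.+1).
by rewrite -mulmxA [fdiff K i.+1 *m _]koszul_diff_diff mulmx0.
Qed.

End ResidueField.

Section TorKoszul.
Variables (k : fieldType) (n : nat) (A : gring k) (th : coordinates n.+1 A).
Variables (M : gmod A) (h : int -> nat).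
Hypothesis Mgr : graded_action M.
Variable B : graded_basis M h.

Theorem tor_dim_koszul q j : let d := j - q%:Z in
  tor_dim M (residue_field A) q j =
  ('C(n.+1, q) * h d - krank th B q d (d + 1) - krank th B q.+1 (d - 1) d)%N.
Proof.
exact: (tor_dim_unique (coordinates_grading th) Mgr (residue_cover th)
  (koszul_resolution th) (koszul_has_dim th Mgr B q j)).
Qed.

Corollary betti_koszul (q : nat) j : let d := j - q%:Z in
  betti M q j = ('C(n.+1, q) * h d)%N%:R - (krank th B q d (d + 1))%:R
    - (krank th B q.+1 (d - 1) d)%:R :> rat.
Proof.
move=> d; rewrite /betti tor_dim_koszul -/d.
have := @krank_le _ _ _ th _ _ Mgr B q (d - 1) d (d + 1) (esym (subrK _ _)) erefl.
by move=> le; rewrite !natrB //; lia.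
Qed.

End TorKoszul.

(** * Coordinates adapted to a linear form *)

Lemma mpoly_rmorph_ext n (k : comNzRingType) (S : pzRingType)
    (f g : {rmorphism {mpoly k[n]} -> S}) :
  (forall c, f c%:MP = g c%:MP) -> (forall i, f 'X_i = g 'X_i) -> f =1 g.
Proof.
move=> fgC fgX p; rewrite [p]mpolyE !rmorph_sum; apply: eq_bigr => m _.
rewrite -mul_mpolyC !rmorphM fgC; congr (_ * _).
rewrite mpolyXE_id !rmorph_prod; apply: eq_bigr => i _.
by rewrite !rmorphXn fgX.
Qed.

Lemma dhomog_comp n n' (k : comNzRingType) (lq : n.-tuple {mpoly k[n']}) d
    (f : {mpoly k[n]}) :
  (forall i, tnth lq i \is 1.-homog) -> f \is d.-homog -> f \mPo lq \is d.-homog.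
Proof.
move=> hl hf; rewrite [f]mpolyE raddf_sum /=.
rewrite big_seq; apply: rpred_sum => m mf; rewrite comp_mpolyZ; apply: dhomogZ.
have <- : mdeg m = d by have /dhomogP := hf; apply.
rewrite comp_mpolyX mdegE.
apply: (@big_ind2 _ _ (fun (p : {mpoly k[n']}) d => p \is d.-homog)).
- exact: dhomog1.
- by move=> p d1 q d2; exact: dhomogM.
- by move=> i _; rewrite -[X in X.-homog]mul1n; exact: dhomogMn.
Qed.

Section LinearForm.
Variables (k : fieldType) (n : nat).
Variable l : {mpoly k[n.+1]}.
Hypothesis l_hom : l \is 1.-homog.

Let lc (t : 'I_n.+1) := l@_(U_(t)).

Lemma linear_formE : l = \sum_t lc t *: 'X_t.
Proof.
apply/mpolyP => b; rewrite raddf_sum /=.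
have [db|db] := eqVneq (mdeg b) 1%N; last first.
  rewrite (dhomog_nemf_coeff l_hom db) big1 // => t _.
  rewrite mcoeffZ mcoeffX; case: eqP => [E|]; last by rewrite mulr0.
  by case/eqP: db; rewrite -E mdeg1.
have /eqP/mdeg1P[t /eqP tb] := db.
rewrite tb (bigD1 t) //= big1 ?addr0 => [|u ut].
  by rewrite mcoeffZ mcoeffX eqxx mulr1.
rewrite mcoeffZ mcoeffX; case: eqP => [E|]; last by rewrite mulr0.
by have := congr1 (fun m : 'X_{1..n.+1} => m t) E; rewrite !mnm1E (negPf ut) eqxx.
Qed.

Lemma linear_form_neq0 : l != 0 -> exists t, lc t != 0.
Proof.
move=> l0; apply/existsP; apply: contraNT l0; rewrite negb_exists => /forallP c0.
rewrite linear_formE big1 // => t _.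
by have /negPn/eqP -> := c0 t; rewrite scale0r.
Qed.

Variable t0 : 'I_n.+1.
Hypothesis l_t0 : lc t0 != 0.

Lemma dhomogXi n' (i : 'I_n') : ('X_i : {mpoly k[n']}) \is 1.-homog.
Proof. by rewrite dhomogX; apply/eqP; exact: mdeg1. Qed.

(** [fwd] substitutes l for the variable [t0], and [bwd] solves l for that variable, which is
    possible because its coefficient is a unit. *)
Let fwd : n.+1.-tuple {mpoly k[n.+1]} := [tuple if t == t0 then l else 'X_t | t < n.+1].
Let bwd : n.+1.-tuple {mpoly k[n.+1]} := [tuple
  if t == t0 then (lc t0)^-1 *: ('X_t0 - \sum_(u | u != t0) lc u *: 'X_u)
  else 'X_t | t < n.+1].

Let fwd_hom i : tnth fwd i \is 1.-homog.
Proof. by rewrite tnth_mktuple; case: eqP => // _; exact: dhomogXi. Qed.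

Let bwd_hom i : tnth bwd i \is 1.-homog.
Proof.
rewrite tnth_mktuple; case: eqP => // _; last exact: dhomogXi.
apply: dhomogZ; apply: rpredB; first exact: dhomogXi.
by apply: rpred_sum => u _; apply: dhomogZ; exact: dhomogXi.
Qed.

Let comp_X n1 n2 (lq : n1.-tuple {mpoly k[n2]}) i : 'X_i \mPo lq = tnth lq i.
Proof. by rewrite comp_mpolyXU -tnth_nth. Qed.

Let comp_sum n1 n2 (lq : n1.-tuple {mpoly k[n2]}) I (r : seq I) (P : pred I) F :
  (\sum_(i <- r | P i) F i) \mPo lq = \sum_(i <- r | P i) (F i \mPo lq).
Proof. exact: (raddf_sum (comp_mpoly lq)). Qed.

Let fwdK : cancel (comp_mpoly fwd) (comp_mpoly bwd).
Proof.
apply: (@mpoly_rmorph_ext _ _ _ (comp_mpoly bwd \o comp_mpoly fwd) idfun) => [c|i] /=.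
  by rewrite !comp_mpolyC.
rewrite comp_X tnth_mktuple; case: eqP => [->|/eqP ne]; last first.
  by rewrite comp_X tnth_mktuple (negPf ne).
rewrite {1}linear_formE comp_sum (bigD1 t0) //= comp_mpolyZ comp_X tnth_mktuple eqxx.
rewrite scalerA mulfV // scale1r -[RHS](subrK (\sum_(u | u != t0) lc u *: 'X_u)).
congr (_ + _); apply: eq_bigr => u ne.
by rewrite comp_mpolyZ comp_X tnth_mktuple (negPf ne).
Qed.

Let bwdK : cancel (comp_mpoly bwd) (comp_mpoly fwd).
Proof.
apply: (@mpoly_rmorph_ext _ _ _ (comp_mpoly fwd \o comp_mpoly bwd) idfun) => [c|i] /=.
  by rewrite !comp_mpolyC.
rewrite comp_X tnth_mktuple; case: eqP => [->|/eqP ne]; last first.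
  by rewrite comp_X tnth_mktuple (negPf ne).
rewrite comp_mpolyZ comp_mpolyB comp_X tnth_mktuple eqxx comp_sum.
have -> : \sum_(u | u != t0) ((lc u *: 'X_u) \mPo fwd) = \sum_(u | u != t0) lc u *: 'X_u.
  by apply: eq_bigr => u ne; rewrite comp_mpolyZ comp_X tnth_mktuple (negPf ne).
rewrite {1}linear_formE (bigD1 t0) //=.
by rewrite addrK scalerA mulVf // scale1r.
Qed.

Definition polynomial_coordinates : coordinates n.+1 (polynomial_ring k n.+1).
Proof.
apply: (@Coordinates k n.+1 (polynomial_ring k n.+1) (comp_mpoly fwd) (comp_mpoly bwd)).
- exact: fwdK.
- exact: bwdK.
- by move=> c; rewrite /= comp_mpolyC.
- move=> [j|j] f /=; split=> [hf|]; last 1 first.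
  + by move=> ->; rewrite comp_mpoly0.
  + by rewrite -(fwdK f); exact: dhomog_comp.
  + exact: dhomog_comp.
  + by rewrite -(fwdK f) hf comp_mpoly0.
Defined.

Lemma polynomial_coordinates_t0 : pvar polynomial_coordinates t0 = l.
Proof. by rewrite /pvar /= comp_X tnth_mktuple eqxx. Qed.

Let X (f : polynomial_ring k n.+1) := f = l.
Let S := quotient_ring X.

(** The quotient by l is a polynomial ring in the variables other than [t0]: [down] eliminates [t0]
    by means of the relation l = 0. *)
Let up : n.-tuple {mpoly k[n.+1]} := [tuple 'X_(lift t0 s) | s < n].
Let down : n.+1.-tuple {mpoly k[n]} := [tuple
  if unlift t0 t is Some s then 'X_s
  else - \sum_s ((lc t0)^-1 * lc (lift t0 s)) *: 'X_s | t < n.+1].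

Let up_hom i : tnth up i \is 1.-homog.
Proof. by rewrite tnth_mktuple; exact: dhomogXi. Qed.

Let down_hom i : tnth down i \is 1.-homog.
Proof.
rewrite tnth_mktuple; case: (unlift t0 i) => [s|]; first exact: dhomogXi.
by rewrite rpredN; apply: rpred_sum => u _; apply: dhomogZ; exact: dhomogXi.
Qed.

Let upK : cancel (comp_mpoly up) (comp_mpoly down).
Proof.
apply: (@mpoly_rmorph_ext _ _ _ (comp_mpoly down \o comp_mpoly up) idfun) => [c|i] /=.
  by rewrite !comp_mpolyC.
by rewrite comp_X tnth_mktuple comp_X tnth_mktuple liftK.
Qed.

Let down_l : l \mPo down = 0.
Proof.
rewrite linear_formE comp_sum (bigD1_ord t0) //= comp_mpolyZ comp_X tnth_mktuple unlift_none.
rewrite scalerN scaler_sumr -sumrN -big_split big1 //= => s _.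
by rewrite comp_mpolyZ comp_X tnth_mktuple liftK scalerA mulrA mulfV // mul1r addNr.
Qed.

Let down_ideal (f : polynomial_ring k n.+1) : f \in ideal X -> f \mPo down = 0.
Proof.
move/idealP => [m [c [x [xl ->]]]]; rewrite comp_sum big1 // => i _.
rewrite xl; change (comp_mpoly down (c i * l) = 0).
by rewrite rmorphM [X in _ * X]down_l mulr0.
Qed.

Let down_proj (f g : polynomial_ring k n.+1) : proj X f = proj X g -> f \mPo down = g \mPo down.
Proof.
by move/proj_eq/down_ideal; rewrite comp_mpolyB => /eqP; rewrite subr_eq0 => /eqP.
Qed.

Let proj_down (f : polynomial_ring k n.+1) : proj X ((f \mPo down) \mPo up) = proj X f.
Proof.
pose pr : {rmorphism {mpoly k[n.+1]} -> quo X} := @proj (polynomial_ring k n.+1) X.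
apply: (@mpoly_rmorph_ext _ _ _ (pr \o comp_mpoly up \o comp_mpoly down) pr) => [c|i] /=.
  by rewrite !comp_mpolyC.
rewrite comp_X tnth_mktuple; case: unliftP => [s ->|->].
  by rewrite comp_X tnth_mktuple.
apply/proj_eq/idealP; exists 1%N, (fun=> - ((lc t0)^-1)%:MP), (fun=> l); split=> //.
rewrite big_ord1 comp_mpolyN comp_sum {1}linear_formE (bigD1_ord t0) //=.
rewrite [RHS]mulNr mulrDr opprD addrC; congr (_ + _).
  by rewrite mul_mpolyC scalerA mulVf // scale1r.
rewrite mulr_sumr; congr (- _); apply: eq_bigr => s _.
by rewrite comp_mpolyZ comp_X tnth_mktuple mul_mpolyC scalerA.
Qed.

Definition quotient_coordinates : coordinates n S.
Proof.
pose pr : {rmorphism {mpoly k[n.+1]} -> S} := @proj (polynomial_ring k n.+1) X.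
apply: (@Coordinates k n S (pr \o comp_mpoly up)
  (fun q => (repr (q : quo X) : {mpoly k[n.+1]}) \mPo down)).
- move=> f /=; rewrite -[RHS]upK; apply: down_proj.
  by rewrite /proj reprK.
- move=> q /=; have [f ->] := proj_surj q.
  by rewrite -[RHS]proj_down; congr (proj X (_ \mPo up)); apply: down_proj; rewrite /proj reprK.
- by move=> c; rewrite /= comp_mpolyC.
- move=> j f /=; split=> [[a ha /down_proj E]|hf].
    rewrite upK in E; rewrite E; case: j ha => [j|j] /= ha; last by rewrite ha comp_mpoly0.
    exact: dhomog_comp.
  exists (f \mPo up) => //; case: j hf => [j|j] /= hf; last by rewrite hf comp_mpoly0.
  exact: dhomog_comp.
Defined.

End LinearForm.

(** * Truncations by powers of the maximal ideal *)

Section MaximalIdealPowers.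
Variables (k : fieldType) (n : nat) (A : gring k) (th : coordinates n.+1 A).
Let gr := coordinates_grading th.
Let I := @irrelevant k A.

Definition has_order (m : nat) (a : A) :=
  forall b, (mdeg b < m)%N -> (pcV th a)@_b = 0.

Lemma has_orderD m a b : has_order m a -> has_order m b -> has_order m (a + b).
Proof. by move=> ha hb c cm; rewrite pcVD mcoeffD ha // hb // addr0. Qed.

Lemma has_orderM m m' a b : has_order m a -> has_order m' b -> has_order (m + m') (a * b).
Proof.
move=> ha hb c cm; rewrite pcVM mcoeffM big1 // => -[b1 b2] /eqP /(congr1 (@mdeg _)) cE /=.
have [lt|ge] := ltnP (mdeg b1) m; first by rewrite ha ?mul0r.
by rewrite hb ?mulr0 //; move: cm cE; rewrite mdegD /=; lia.
Qed.

Lemma has_order0 m : has_order m 0.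
Proof. by move=> b _; rewrite -(rmorph0 (pc th)) pcK mcoeff0. Qed.

Lemma has_order_lspan m (X : A -> Prop) a :
  (forall x, X x -> has_order m x) -> @lspan A A^o X a -> has_order m a.
Proof.
move=> hX [N [c [x [xX ->]]]].
apply: (big_ind (has_order m)); [exact: has_order0|exact: has_orderD|].
by move=> i _; rewrite -[m]add0n; apply: has_orderM => //; exact: hX.
Qed.

Lemma has_order_irrelevant a : I a -> has_order 1 a.
Proof.
apply: has_order_lspan => b [j j0]; rewrite -(pcVK th b) => /pc_hom; rewrite pcVK.
case: j j0 => // j j0 /= hb c; rewrite ltnS leqn0 => /eqP c0.
have cj : mdeg c != j by rewrite c0; lia.
exact: dhomog_nemf_coeff hb cj.
Qed.

Lemma has_order_ideal_pow m a : ideal_pow I m a -> has_order m a.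
Proof.
elim: m a => [|m IH] a //=; apply: has_order_lspan => b [x [y [xI yI ->]]].
by rewrite -add1n; apply: has_orderM; [exact: has_order_irrelevant|exact: IH].
Qed.

Lemma pmon_ideal_pow m b : (m <= mdeg b)%N -> ideal_pow I m (pmon th b).
Proof.
elim: m b => [//|m IH] b mb /=.
have [t bt] : exists t, (0 < b t)%N.
  apply/existsP; apply: contraTT mb; rewrite negb_exists => /forallP b0.
  rewrite -ltnNge mdegE big1 // => t _; by apply/eqP; rewrite -leqn0 leqNgt.
have le : (U_(t) <= b)%MM.
  by apply/mnm_lepP => u; rewrite mnm1E; case: eqP => // <-.
apply: lspan_sub; exists (pvar th t), (pmon th (b - U_(t))%MM); split.
- exact: ghom_irrelevant (pvar_hom th t).
- by apply: IH; move: mb; rewrite -{1}(submK le) mdegD mdeg1; lia.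
- by rewrite -pmonD submK.
Qed.

(** A product of m elements without constant term has no terms of degree below m; conversely, a
    monomial of degree at least m is a product of m variables and a monomial. *)
Lemma maximal_ideal_pow m a : a \in ideal (ideal_pow I m) <-> has_order m a.
Proof.
split=> [/idealP|am]; first by apply: has_order_lspan; exact: has_order_ideal_pow.
rewrite -(pcVK th a) [pcV th a]mpolyE rmorph_sum big_seq.
apply: (rpred_sum (S := ideal_zmodClosed (ideal_pow I m))) => b bs.
rewrite -mul_mpolyC rmorphM; apply/idealM/idealP/lspan_sub/pmon_ideal_pow.
rewrite leqNgt; apply/negP => lt; move: bs; rewrite mcoeff_msupp.
by rewrite am // eqxx.
Qed.

Section Truncation.
Variable i : nat.
Let Y := @ideal_pow A I i.+1.
Let Q := quotient_module Y.

Lemma truncation_eq (a b : A) : proj Y a = proj Y b <-> has_order i.+1 (a - b).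
Proof. by rewrite proj_eq; exact: maximal_ideal_pow. Qed.

Lemma truncation_coeff (a b : A) c : proj Y a = proj Y b -> (mdeg c <= i)%N ->
  (pcV th a)@_c = (pcV th b)@_c.
Proof.
move=> /truncation_eq H ci; have := H c; rewrite ltnS => /(_ ci) {}H.
apply/eqP; rewrite -subr_eq0 -mcoeffB -H; apply/eqP; congr (_@_c).
by apply: (can_inj (pcK th)); rewrite rmorphB !pcVK.
Qed.

Lemma truncation_graded : graded_action Q.
Proof.
split=> [j|j j' a x ha [b hb ->]]; last first.
  by exists (a * b); [exact: (ghomM gr)|rewrite rmorphM].
split; first by exists 0; [exact: (ghom0 gr)|rewrite rmorph0].
move=> x y [a ha ->] [b hb ->]; exists (a - b); first exact: (ghomB gr).
by rewrite rmorphB.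
Qed.

Definition truncated_dim (d : int) : nat :=
  if d is Posz m then if (m <= i)%N then #|{: monomial n.+1 m}| else 0%N else 0%N.

(** The boolean stands for [m <= i]. It is abstracted because the number of basis vectors, and with
    it the type, depends on its value. *)
Let tgb m (b : bool) : 'I_(if b then #|{: monomial n.+1 m}| else 0) -> Q :=
  match b with
  | true => fun a => proj Y (pmon th (mnm_of (enum_val a)))
  | false => fun=> 0
  end.

Let tgc m (b : bool) (x : Q) : 'rV[k]_(if b then #|{: monomial n.+1 m}| else 0) :=
  match b with
  | true => \row_a (pcV th (repr (x : quo Y)))@_(mnm_of (enum_val a))
  | false => 0
  end.

Let tlin m v : lin (@tgb m true) v = proj Y (lin (@regular_gb k n A th m%:Z) v).
Proof.
rewrite /lin rmorph_sum; apply: eq_bigr => a _.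
by rewrite /GRing.scale /= /quo_scale -rmorphM.
Qed.

Let repr_coeff (a : A) c : (mdeg c <= i)%N ->
  (pcV th (repr (proj Y a : quo Y)))@_c = (pcV th a)@_c.
Proof. by apply: truncation_coeff; rewrite /proj reprK. Qed.

Lemma truncation_basis : graded_basis Q truncated_dim.
Proof.
apply: (@GradedBasis _ _ _ _
  (fun d => match d return 'I_(truncated_dim d) -> Q with
    | Posz m => @tgb m (m <= i)%N | Negz _ => fun=> 0 end)
  (fun d x => match d return 'rV[k]_(truncated_dim d) with
    | Posz m => @tgc m (m <= i)%N x | Negz _ => 0 end)).
- move=> [m|m] /=; last by case.
  case: (m <= i)%N => a; last by case: a.
  exists (pmon th (mnm_of (enum_val a))) => //.
  by rewrite -[X in ghom X%:Z](mdeg_mnm_of (enum_val a)); exact: pmon_hom.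
- move=> [m|m] x [a ha ->] /=; last first.
    by rewrite /lin big_ord0 (ghom_neg th _ ha) // rmorph0.
  case: (leqP m i) => mi.
    have E : @tgc m true (proj Y a) = gc (regular_basis th) m%:Z a.
      by apply/rowP => b; rewrite !mxE repr_coeff // mdeg_mnm_of.
    rewrite tlin E; congr (proj Y _).
    exact: (gbK (regular_basis th) ha).
  rewrite /lin big_ord0 -(rmorph0 (proj Y)); apply/esym/truncation_eq.
  rewrite subr0 => c ci; move: ha; rewrite -(pcVK th a) => /pc_hom /= ha.
  have cm : mdeg c != m by lia.
  by rewrite pcVK; exact: dhomog_nemf_coeff ha cm.
- move=> [m|m] v /=; last by apply/rowP => -[].
  move: v => /=; case: (leqP m i) => mi v; last by apply/rowP => -[].
  rewrite tlin -[RHS](gcK (regular_basis th) (d := m%:Z)).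
  apply/rowP => b; rewrite !mxE repr_coeff //.
  by rewrite mdeg_mnm_of.
Defined.

Lemma truncation_monomial_basis m : monomial_basis th truncation_basis (proj Y 1 : Q) m.
Proof.
rewrite /monomial_basis /=; case: (m <= i)%N => a; last by case: a.
exists (mnm_of (enum_val a)); first exact: mdeg_mnm_of.
by rewrite /= /GRing.scale /= /quo_scale -rmorphM mulr1.
Qed.

End Truncation.
End MaximalIdealPowers.

(* For a quotient of a free module over k[y_0..y_n] with Hilbert function a, the
   least possible rank of the Koszul differential that starts in exterior
   degree r and ends in internal degree d (0 / 0 = 0 when d = q = 0). *)
Definition least_krank n (a : int -> rat) (r : nat) (d : int) : rat :=
  if r is q.+1 then d%:~R * ('C(n, q))%:R / (d + q%:Z)%:~R * a d else 0.

(** The Betti number that results when the Koszul differentials leaving and entering the strand both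
    have least rank. It is linear in [a], so a combination of truncations enters only through its
    Hilbert function. *)
Definition largest_betti n (a : int -> rat) (q : nat) (j : int) : rat :=
  'C(n.+1, q)%:R * a (j - q%:Z) - least_krank n a q (j - q%:Z + 1)
  - least_krank n a q.+1 (j - q%:Z).

Lemma least_krank_sum n I (r : seq I) (c : I -> rat) (a : I -> int -> rat) q d :
  \sum_(i <- r) c i * least_krank n (a i) q d
  = least_krank n (fun d => \sum_(i <- r) c i * a i d) q d.
Proof.
case: q => [|q] /=; first by rewrite big1 // => i _; rewrite mulr0.
by rewrite mulr_sumr; apply: eq_bigr => i _; ring.
Qed.

Lemma largest_betti_sum n I (r : seq I) (c : I -> rat) (a : I -> int -> rat) q j :
  \sum_(i <- r) c i * largest_betti n (a i) q j
  = largest_betti n (fun d => \sum_(i <- r) c i * a i d) q j.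
Proof.
rewrite /largest_betti -!least_krank_sum mulr_sumr -!sumrB.
by apply: eq_bigr => i _; ring.
Qed.

Lemma eq_largest_betti n (a b : int -> rat) q j : a =1 b ->
  largest_betti n a q j = largest_betti n b q j.
Proof. by move=> ab; rewrite /largest_betti /least_krank; case: q => [|q]; rewrite !ab. Qed.

Lemma truncated_dimE n i (d : int) :
  truncated_dim n i d = if (0 <= d <= i%:Z) then 'C(n + `|d|%N, n) else 0%N.
Proof.
case: d => m /=; last by [].
by rewrite lez_nat /=; case: ifP => // _; rewrite card_monomial.
Qed.

Section TruncationBetti.
Variables (k : fieldType) (n : nat) (A : gring k) (th : coordinates n.+1 A).

Lemma krank_eq0 (M : gmod A) h (B : graded_basis M h) r d' d :
  h d' = 0%N \/ h d = 0%N -> krank th B r d' d = 0%N.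
Proof.
move=> h0; apply/eqP; rewrite -leqn0 /krank /frank.
case: h0 => h0; [apply: leq_trans (rank_leq_row _) _|apply: leq_trans (rank_leq_col _) _];
  by rewrite card_prod card_ord h0 muln0.
Qed.

Variable i : nat.
Let a (d : int) : rat := (truncated_dim n i d)%:R.

(** Up to degree i the truncation agrees with the polynomial ring, where the lower bound is
    attained; a differential into a degree above i has target zero. *)
Lemma krank_truncation r d :
  (krank th (truncation_basis th i) r d (d + 1))%:R = least_krank n a r (d + 1).
Proof.
case: r => [|q] /=; first by rewrite krank0.
have [dn|dp] := ltrP d 0.
  rewrite krank_eq0; last by left; rewrite truncated_dimE; case: ifP => //; lia.
  have [->|d0] := eqVneq (d + 1) 0; first by rewrite !mul0r.
  rewrite /a truncated_dimE; case: ifP => [|_]; last by rewrite mulr0.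
  lia.
case: d dp => // m _; have -> : m%:Z + 1 = m.+1%:Z by lia.
rewrite /a; have [mi|mi] := leqP m.+1 i; last first.
  have h0 : truncated_dim n i m.+1%:Z = 0%N by rewrite truncated_dimE; case: ifP => //; lia.
  by rewrite krank_eq0; [rewrite h0 mulr0|right].
have hE j : (j <= i)%N -> truncated_dim n i j%:Z = 'C(n + j, n).
  by move=> ji; rewrite truncated_dimE; case: ifP => //; lia.
have e_hom : mhom 0 (proj (ideal_pow (@irrelevant k A) i.+1) 1 : quotient_module (ideal_pow (@irrelevant k A) i.+1)).
  exists 1 => //; rewrite -(rmorph1 (gunit A)); exact: (ghom_unit (coordinates_grading th)).
have := krank_monomial (truncation_graded th i) e_hom q (hE m (ltnW mi)) (hE m.+1 mi)
  (@truncation_monomial_basis _ _ _ th i m) (@truncation_monomial_basis _ _ _ th i m.+1).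
rewrite hE // => E; have {}E := congr1 (fun x : nat => x%:R : rat) E.
rewrite !natrM in E.
have ne : ((m.+1%:Z + q%:Z)%:~R : rat) != 0 by rewrite intr_eq0; lia.
apply: (mulfI ne); rewrite -PoszD -pmulrn E -pmulrn.
by field; rewrite nat1r -natrD pnatr_eq0.
Qed.

Lemma betti_truncation (q : nat) j :
  betti (quotient_module (ideal_pow (@irrelevant k A) i.+1)) q j = largest_betti n a q j.
Proof.
rewrite (betti_koszul th (truncation_graded th i) (truncation_basis th i)).
rewrite krank_truncation natrM /largest_betti; congr (_ - _).
by rewrite -[X in krank _ _ _ _ X](subrK 1) krank_truncation subrK.
Qed.

End TruncationBetti.

(** * Splitting off a variable *)
Lemma pair_sum (V : nmodType) (I J : finType) (f : I * J -> V) :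
  \sum_i f i = \sum_a \sum_b f (a, b).
Proof. by rewrite pair_bigA /=; apply: eq_bigr => -[]. Qed.

(** The projection [pr] to the first column block has an image of rank at least that of [L] plus
    that of A P, since P kills [L]. The kernel of [pr] contains the rows (0, K C), since K kills
    [L]. *)
Lemma rank_block (k : fieldType) r1 r2 c1 c2 x y (A : 'M[k]_(r1, c1)) (L : 'M_(r2, c1))
    (C : 'M_(r2, c2)) (P : 'M_(c1, x)) (K : 'M_(y, r2)) :
  L *m P = 0 -> K *m L = 0 ->
  (\rank L + \rank (A *m P) + \rank (K *m C) <= \rank (block_mx A 0 L C))%N.
Proof.
move=> LP KL; set M := block_mx A 0 L C; pose pr : 'M[k]_(c1 + c2, c1) := col_mx 1%:M 0.
have Mpr : M *m pr = col_mx A L by rewrite mul_block_col !mulmx1 !mulmx0 !addr0.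
rewrite -(mxrank_mul_ker M pr) Mpr; apply: leq_add.
  rewrite -(mxrank_mul_ker (col_mx A L) P) mul_col_mx LP addnC; apply: leq_add.
    by apply: mxrankS; rewrite -addsmxE addsmxSl.
  apply: mxrankS; rewrite sub_capmx; apply/andP; split; last by apply/sub_kermxP.
  by rewrite -addsmxE addsmxSr.
have <- : \rank (row_mx (0 : 'M_(y, c1)) (K *m C)) = \rank (K *m C).
  by rewrite -mxrank_tr tr_row_mx trmx0 -addsmxE adds0mx mxrank_tr.
apply: mxrankS; rewrite sub_capmx; apply/andP; split; last first.
  by apply/sub_kermxP; rewrite mul_row_col mul0mx mulmx0 addr0.
apply/submxP; exists (row_mx 0 K).
by rewrite mul_row_block !mul0mx KL !add0r.
Qed.

Section KoszulBlocks.
Variables (k : fieldType) (n : nat).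

Lemma kmx_mulr m (s : 'I_m -> {set 'I_m} -> k) r c' c x (X : 'I_m -> 'M[k]_(c', c))
    (P : 'M_(c, x)) i j :
  \sum_l kmx s r X i l * ((l.1 == j.1)%:R * P l.2 j.2) =
  kmx s r (fun v => X v *m P) i j.
Proof.
rewrite pair_sum (bigD1 j.1) //= [X in _ + X]big1 ?addr0 => [|T /negPf ne]; last first.
  by rewrite big1 // => b _; rewrite ne mul0r mulr0.
rewrite /kmx; case: ifP => _; last by rewrite big1 // => b _; rewrite mul0r.
under eq_bigr => b _ do rewrite eqxx mul1r mulr_suml.
rewrite exchange_big; apply: eq_bigr => v _ /=; rewrite mxE !mulr_sumr.
by apply: eq_bigr => b _; rewrite !mulrA.
Qed.

Lemma kmx_mull m (s : 'I_m -> {set 'I_m} -> k) r c' c x (X : 'I_m -> 'M[k]_(c', c))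
    (P : 'M_(x, c')) i j :
  \sum_l ((i.1 == l.1)%:R * P i.2 l.2) * kmx s r X l j =
  kmx s r (fun v => P *m X v) i j.
Proof.
rewrite pair_sum (bigD1 i.1) //= [X in _ + X]big1 ?addr0 => [|T ne]; last first.
  by rewrite big1 // => b _; rewrite eq_sym (negPf ne) !mul0r.
rewrite /kmx /=; case: ifP => _; last by rewrite big1 // => b _; rewrite mulr0.
under eq_bigr => b _ do rewrite eqxx mul1r mulr_sumr.
rewrite exchange_big; apply: eq_bigr => v _ /=; rewrite mxE !mulr_sumr.
by apply: eq_bigr => b _; ring.
Qed.

(** The terms of the differential that remove the variable to be split off: for each set of size q a
    copy of [L], scaled by [u]. *)
Definition kdiag q c' c (u : {set 'I_n} -> k) (L : 'M[k]_(c', c))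
    (i : {set 'I_n} * 'I_c') (j : {set 'I_n} * 'I_c) : k :=
  if #|i.1| == q then (j.1 == i.1)%:R * (u i.1 * L i.2 j.2) else 0.

(** [L] is normalised to an identity matrix of the size of its rank; what remains is diagonal with
    entries [u]. *)
Lemma rank_kdiag q c' c (L : 'M[k]_(c', c)) (u : {set 'I_n} -> k) :
  (forall T, u T != 0) -> ('C(n, q) * \rank L <= frank (kdiag q u L))%N.
Proof.
move=> u0; pose r := \rank L.
have [U [V UV]] : exists U : 'M_(r, c'), exists V : 'M_(c, r), U *m L *m V = 1%:M.
  have /row_fullP[U UE] : row_full (col_base L) by exact: col_base_full.
  have /row_freeP[V VE] : row_free (row_base L) by exact: row_base_free.
  by exists U, V; rewrite -[L]mulmx_base mulmxA UE mul1mx VE.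
have cardE : #|{: ksub n q * 'I_r}| = ('C(n, q) * r)%N.
  by rewrite card_prod card_ksub card_ord.
pose D (i j : ksub n q * 'I_r) : k := (i == j)%:R * u (val i.1).
have <- : frank D = ('C(n, q) * r)%N.
  rewrite -cardE; apply: (@frank_triangular _ _ _ _ (fun i => enum_rank i : nat)).
    by move=> x; rewrite /D eqxx mul1r.
  by move=> x y /negPf ne; rewrite /D ne mul0r eqxx.
apply: (@frank_le _ _ _ _ _ _ _ (fun i' i => (i.1 == val i'.1)%:R * U i'.2 i.2)
  (fun j j' => (j.1 == val j'.1)%:R * V j.2 j'.2)) => -[[T Tq] a] [[T' T'q] b] /=.
transitivity (\sum_x \sum_y U a x * kdiag q u L (T, x) (T', y) * V y b).
  rewrite /D /kdiag /= Tq.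
  have -> : ((exist _ T Tq, a) == (exist _ T' T'q, b) :> ksub n q * 'I_r) = (T' == T) && (a == b).
    by rewrite (eq_sym T').
  have [_|_] := eqVneq T' T; last first.
    by rewrite mul0r big1 // => x _; rewrite big1 // => y _; rewrite mul0r mulr0 mul0r.
  have := congr1 (fun M : 'M_r => M a b) UV; rewrite [RHS]mxE andTb => <-.
  rewrite mxE mulr_suml exchange_big; apply: eq_bigr => y _ /=.
  rewrite !mxE !mulr_suml; apply: eq_bigr => x _.
  by rewrite !mul1r; ring.
rewrite [RHS]pair_sum (bigD1 T) //= [X in _ = _ + X]big1 ?addr0 => [|W /negPf ne]; last first.
  by rewrite big1 // => x _; rewrite big1 // => y _; rewrite ne !mul0r.
apply: eq_bigr => x _; rewrite pair_sum (bigD1 T') //= [X in _ = _ + X]big1 ?addr0 => [|W /negPf ne].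
  by apply: eq_bigr => y _; rewrite !eqxx !mul1r.
by rewrite big1 // => y _; rewrite ne mul0r mulr0.
Qed.

Lemma fmx_delta (I I' J : finType) (f : I' -> I) (F : I -> J -> k) :
  fmx (fun i' i => (i == f i')%:R : k) *m fmx F = fmx (fun i' j => F (f i') j).
Proof.
rewrite fmx_mul; apply: eq_fmx => i' j; rewrite (bigD1 (f i')) //= eqxx mul1r.
by rewrite big1 ?addr0 // => i /negPf ne; rewrite ne mul0r.
Qed.

Lemma fmx_delta_r (I J J' : finType) (g : J' -> J) (F : I -> J -> k) :
  fmx F *m fmx (fun j j' => (j == g j')%:R : k) = fmx (fun i j' => F i (g j')).
Proof.
rewrite fmx_mul; apply: eq_fmx => i j'; rewrite (bigD1 (g j')) //= eqxx mulr1.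
by rewrite big1 ?addr0 // => j /negPf ne; rewrite ne mulr0.
Qed.

(* Splitting off the variable t0: the exterior powers decompose according to
   whether t0 occurs, and the differential becomes block triangular. *)
Theorem koszul_block (s : 'I_n.+1 -> {set 'I_n.+1} -> k) (t0 : 'I_n.+1) q c' c x y
    (X : 'I_n.+1 -> 'M[k]_(c', c)) (P : 'M_(c, x)) (K : 'M_(y, c')) :
  (forall v T, s v T != 0) -> X t0 *m P = 0 -> K *m X t0 = 0 ->
  ('C(n, q) * \rank (X t0)
   + frank (kmx (fun v (T : {set 'I_n}) => s (lift t0 v) (lift t0 @: T)) q.+1
       (fun v => X (lift t0 v) *m P))
   + frank (kmx (fun v (T : {set 'I_n}) => s (lift t0 v) (t0 |: lift t0 @: T)) q
       (fun v => K *m X (lift t0 v)))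
   <= frank (kmx s q.+1 X))%N.
Proof.
move=> s0 XP KX.
(* [low] enumerates the sets without [t0] and [high] those with it. The differential never adds
   [t0], so the block from [low] to [high] vanishes. *)
pose low (T : {set 'I_n}) := lift t0 @: T; pose high T := t0 |: low T.
have low_inj : injective low by apply: imset_inj; exact: lift_inj.
have t0low T : t0 \notin low T.
  by apply/imsetP => -[v _ E]; have := neq_lift t0 v; rewrite -E eqxx.
have high_inj : injective high.
  by move=> T U E; apply: low_inj; rewrite -[LHS](setU1K (t0low T)) -/(high T) E setU1K.
have card_low T : #|low T| = #|T| by rewrite card_imset //; exact: lift_inj.
have card_high T : #|high T| = #|T|.+1 by rewrite cardsU1 t0low card_low.
have lowD T v : low (T :\ v) = low T :\ lift t0 v.
  apply/setP => z; rewrite in_setD1.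
  apply/imsetP/andP => [[w /setD1P[wv wT] ->]|[zv /imsetP[w wT zE]]].
    by split; [rewrite (inj_eq lift_inj) | exact: imset_f].
  by exists w => //; apply/setD1P; split => //; apply: contraNneq zv => <-; rewrite zE.
have highD T v : high (T :\ v) = high T :\ lift t0 v.
  rewrite /high lowD setDUl; congr (_ :|: _).
  by apply/setP => z; rewrite !inE andbC; case: (z =P t0) => //= ->; rewrite neq_lift.
pose s1 v T := s (lift t0 v) (low T); pose s2 v T := s (lift t0 v) (high T).
pose Y v := X (lift t0 v); pose u T := s t0 (high T).
pose A := kmx s1 q.+1 Y; pose C := kmx s2 q Y; pose L := kdiag q u (X t0).
have sum_low (f : 'I_n.+1 -> k) T : \sum_(v in low T) f v = \sum_(v in T) f (lift t0 v).
  by rewrite big_imset //= => ? ? _ _; exact: lift_inj.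
have sum_high (f : 'I_n.+1 -> k) T :
    \sum_(v in high T) f v = f t0 + \sum_(v in T) f (lift t0 v).
  by rewrite big_setU1 // sum_low.
pose F := kmx s q.+1 X.
have F11 i j : F (low i.1, i.2) (low j.1, j.2) = A i j.
  rewrite /F /A /kmx /= card_low; case: ifP => // _; rewrite sum_low.
  by apply: eq_bigr => v _; rewrite -lowD (inj_eq low_inj).
have F12 i j : F (low i.1, i.2) (high j.1, j.2) = 0.
  rewrite /F /kmx /=; case: ifP => // _; rewrite sum_low big1 // => v _.
  case: eqP => [E|_]; last by rewrite mul0r.
  by have := t0low (i.1 :\ v); rewrite lowD -E setU11.
have F21 i j : F (high i.1, i.2) (low j.1, j.2) = L i j.
  rewrite /F /L /kdiag /kmx /= card_high eqSS; case: ifP => // _.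
  rewrite sum_high big1 ?addr0 => [|v _]; first by rewrite setU1K // (inj_eq low_inj).
  case: eqP => [E|_]; last by rewrite mul0r.
  by have := t0low j.1; rewrite E -highD setU11.
have F22 i j : F (high i.1, i.2) (high j.1, j.2) = C i j.
  rewrite /F /C /kmx /= card_high eqSS; case: ifP => // _.
  rewrite sum_high setU1K // (_ : (high j.1 == low i.1) = false) ?mul0r ?add0r.
    by apply: eq_bigr => v _; rewrite -highD (inj_eq high_inj).
  by apply/negP => /eqP E; have := t0low i.1; rewrite -E setU11.
pose flow c (i : {set 'I_n} * 'I_c) := (low i.1, i.2).
pose fhigh c (i : {set 'I_n} * 'I_c) := (high i.1, i.2).
pose U : 'M[k]_(#|{: {set 'I_n} * 'I_c'}| + #|{: {set 'I_n} * 'I_c'}|, _) :=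
  col_mx (fmx (fun i' i => (i == flow c' i')%:R)) (fmx (fun i' i => (i == fhigh c' i')%:R)).
pose V : 'M[k]_(_, #|{: {set 'I_n} * 'I_c}| + #|{: {set 'I_n} * 'I_c}|) :=
  row_mx (fmx (fun j j' => (j == flow c j')%:R)) (fmx (fun j j' => (j == fhigh c j')%:R)).
have UFV : U *m fmx F *m V = block_mx (fmx A) 0 (fmx L) (fmx C).
  rewrite mul_col_mx !fmx_delta mul_col_row !fmx_delta_r; congr block_mx.
  - by apply: eq_fmx => i j; rewrite F11.
  - by apply/matrixP => i j; rewrite !mxE F12.
  - by apply: eq_fmx => i j; rewrite F21.
  - by apply: eq_fmx => i j; rewrite F22.
apply: (@leq_trans (\rank (block_mx (fmx A) 0 (fmx L) (fmx C)))); last first.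
  by rewrite -UFV (leq_trans (mxrankM_maxl _ _)) // mxrankM_maxr.
pose bP := fmx (fun (j : {set 'I_n} * 'I_c) (j' : {set 'I_n} * 'I_x) =>
  (j.1 == j'.1)%:R * P j.2 j'.2).
pose bK := fmx (fun (i' : {set 'I_n} * 'I_y) (i : {set 'I_n} * 'I_c') =>
  (i'.1 == i.1)%:R * K i'.2 i.2).
have LP0 : fmx L *m bP = 0.
  suff pt i j : \sum_l L i l * ((l.1 == j.1)%:R * P l.2 j.2) = 0.
    by rewrite fmx_mul; apply/matrixP => i j; rewrite [LHS]mxE pt mxE.
  rewrite pair_sum /L /kdiag; have [_|_] := boolP (#|i.1| == q); last first.
    by apply: big1 => T _; apply: big1 => b _; exact: mul0r.
  apply: big1 => Z _ /=.
  have := congr1 (fun M : 'M_(_, _) => M i.2 j.2) XP; rewrite !mxE => E.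
  transitivity ((Z == i.1)%:R * u i.1 * (Z == j.1)%:R * \sum_z X t0 i.2 z * P z j.2);
    last by rewrite E mulr0.
  by rewrite mulr_sumr; apply: eq_bigr => z _; ring.
have KL0 : bK *m fmx L = 0.
  suff pt i j : \sum_l ((i.1 == l.1)%:R * K i.2 l.2) * L l j = 0.
    by rewrite fmx_mul; apply/matrixP => i j; rewrite [LHS]mxE pt mxE.
  rewrite pair_sum /L /kdiag /=; apply: big1 => Z _.
  have [_|_] := boolP (#|Z| == q); last by apply: big1 => b _; exact: mulr0.
  have := congr1 (fun M : 'M_(_, _) => M i.2 j.2) KX; rewrite !mxE => E.
  transitivity ((i.1 == Z)%:R * u Z * (j.1 == Z)%:R * \sum_z K i.2 z * X t0 z j.2);
    last by rewrite E mulr0.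
  by rewrite mulr_sumr; apply: eq_bigr => z _; ring.
apply: leq_trans (rank_block (fmx A) (fmx C) LP0 KL0).
apply: leq_add; first apply: leq_add.
- by apply: rank_kdiag => T; exact: s0.
- rewrite /bP fmx_mul (eq_fmx (G := kmx s1 q.+1 (fun v => Y v *m P))) // => i j.
  exact: kmx_mulr.
- rewrite /bK fmx_mul (eq_fmx (G := kmx s2 q (fun v => K *m Y v))) // => i j.
  exact: kmx_mull.
Qed.

(* The transpose of a Koszul differential is the Koszul differential of the
   transposed maps, read on complementary subsets. *)
Lemma frank_kmx_tr (s : 'I_n -> {set 'I_n} -> k) q c' c (Z : 'I_n -> 'M[k]_(c', c)) :
  (q <= n)%N ->
  frank (kmx (fun v T => s v (v |: ~: T)) (n - q).+1 (fun v => (Z v)^T))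
  = frank (kmx s q Z).
Proof.
move=> qn; rewrite -[RHS]frank_tr.
have cardC T : #|~: T : {set 'I_n}| = (n - #|T|)%N.
  by have := cardsC T; rewrite card_ord; lia.
have main i j : kmx (fun v T => s v (v |: ~: T)) (n - q).+1 (fun v => (Z v)^T) i j
    = kmx s q Z (~: j.1, j.2) (~: i.1, i.2).
  rewrite /kmx /= cardC.
  have step v : (v \in i.1) && (j.1 == i.1 :\ v) = (v \in ~: j.1) && (~: i.1 == ~: j.1 :\ v).
    rewrite inE; apply/andP/andP => [[vi /eqP ->]|[vj /eqP E]].
      split; first by rewrite !inE eqxx.
      apply/eqP/setP => w; rewrite !inE.
      by have [->|_] := eqVneq w v; rewrite /= ?vi ?negbK.
    have vi : v \in i.1 by rewrite -[i.1]setCK E !inE eqxx.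
    split=> //; apply/eqP/setP => w; have /setP/(_ w) := E; rewrite !inE.
    by have [->|_] := eqVneq w v; rewrite /= ?(negPf vj) // => /negb_inj ->.
  transitivity (if #|i.1| == (n - q).+1 then
      \sum_(v | (v \in i.1) && (j.1 == i.1 :\ v)) s v (v |: ~: i.1) * Z v j.2 i.2 else 0).
    case: ifP => // _; rewrite [RHS]big_mkcondr; apply: eq_bigr => v _ /=.
    by rewrite mxE; case: eqP => _; rewrite ?mul1r ?mul0r.
  transitivity (if (n - #|j.1|)%N == q then
      \sum_(v | (v \in ~: j.1) && (~: i.1 == ~: j.1 :\ v)) s v (~: j.1) * Z v j.2 i.2 else 0);
    last first.
    case: ifP => // _; rewrite [LHS]big_mkcondr; apply: eq_bigr => v _ /=.
    by case: eqP => _; rewrite ?mul1r ?mul0r.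
  case: (pickP [pred v | (v \in i.1) && (j.1 == i.1 :\ v)]) => [v0 /andP[vi /eqP jE]|none].
    have ci := cardsD1 v0 i.1; rewrite vi -jE in ci.
    have ji : (#|i.1| <= n)%N by have := max_card (mem i.1); rewrite card_ord.
    have -> : (#|i.1| == (n - q).+1) = ((n - #|j.1|)%N == q).
      by rewrite ci; move: ji qn; rewrite ci; lia.
    case: ifP => // _; rewrite (eq_bigl _ _ step); apply: eq_bigr => v /andP[vj /eqP E].
    by congr (s v _ * _); rewrite E setD1K.
  rewrite !big_pred0; first by rewrite !if_same.
    by move=> v; rewrite -step; exact: none.
  exact: none.
apply/eqP; rewrite eqn_leq; apply/andP; split.
  rewrite (eq_frank main).
  exact: (frank_sub (fun j i => kmx s q Z i j) (fun i => (~: i.1, i.2)) (fun i => (~: i.1, i.2))).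
have E j i : kmx s q Z i j = kmx (fun v T => s v (v |: ~: T)) (n - q).+1
    (fun v => (Z v)^T) (~: j.1, j.2) (~: i.1, i.2).
  by rewrite main /= !setCK -!surjective_pairing.
rewrite (eq_frank E).
exact: (frank_sub _ (fun i => (~: i.1, i.2)) (fun i => (~: i.1, i.2))).
Qed.

(** In exterior degree n only the full set occurs, so the differential starts from a single copy of
    the source, and its left kernel contains the rows of [L]. *)
Lemma kmx_top (s : 'I_n -> {set 'I_n} -> k) b c' c (L : 'M[k]_(b, c'))
    (Y : 'I_n -> 'M[k]_(c', c)) :
  (forall v, L *m Y v = 0) -> (frank (kmx s n Y) <= c' - \rank L)%N.
Proof.
move=> LY; pose H := fmx (fun (a : 'I_c') (j : {set 'I_n} * 'I_c) => kmx s n Y ([set: 'I_n], a) j).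
pose L' := fmx (fun (x : 'I_b) (a : 'I_c') => L x a).
have LH : L' *m H = 0.
  rewrite fmx_mul; apply/matrixP => x j; rewrite !mxE; set y := enum_val x; set w := enum_val j.
  rewrite /kmx /= cardsT card_ord eqxx.
  under eq_bigr => a _ do rewrite mulr_sumr.
  rewrite exchange_big big1 //= => v _.
  have := congr1 (fun M : 'M_(_, _) => M y w.2) (LY v); rewrite !mxE => E.
  transitivity ((w.1 == [set: 'I_n] :\ v)%:R * s v setT * \sum_a L y a * Y v a w.2).
    by rewrite mulr_sumr; apply: eq_bigr => a _; ring.
  by rewrite E mulr0.
have rL : (\rank L <= \rank L')%N.
  have -> : L = (\matrix_(x, x') (x' == enum_rank x)%:R) *m L' *m (\matrix_(a, a') (a == enum_rank a')%:R).
    apply/matrixP => x a; rewrite mxE (bigD1 (enum_rank a)) //= [X in _ + X]big1 ?addr0 => [|a' /negPf ne].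
      rewrite mxE (bigD1 (enum_rank x)) //= [X in _ + X]big1 ?addr0 => [|x' /negPf ne].
        by rewrite !mxE !eqxx !enum_rankK mul1r mulr1.
      by rewrite mxE ne mul0r.
    by rewrite [X in _ * X]mxE ne mulr0.
  by rewrite (leq_trans (mxrankM_maxl _ _)) // mxrankM_maxr.
have le := mulmx0_rank_max LH; rewrite [X in (_ <= X)%N]card_ord in le.
apply: (@leq_trans (\rank H)); last by lia.
rewrite /frank; have -> : fmx (kmx s n Y) = fmx (fun (i : {set 'I_n} * 'I_c') (a : 'I_c') =>
    ((i.1 == setT) && (i.2 == a))%:R) *m H.
  rewrite fmx_mul; apply: eq_fmx => -[T a] j /=; rewrite (bigD1 a) //= big1 ?addr0 => [|a' ne].
    rewrite eqxx andbT; have [->|nT] := eqVneq T setT; first by rewrite mul1r.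
    rewrite mul0r /kmx /=; case: eqP => // cT; case/eqP: nT.
    by apply/eqP; rewrite eqEcard subsetT cardsT card_ord cT leqnn.
  by rewrite [a == a']eq_sym (negPf ne) andbF mul0r.
exact: mxrankM_maxr.
Qed.

End KoszulBlocks.

(** * Modules generated in degree zero with concentrated socle *)
Definition lift_mnm n (t0 : 'I_n.+1) (b : 'X_{1..n}) : 'X_{1..n.+1} :=
  [multinom (if unlift t0 t is Some s then b s else 0%N) | t < n.+1].

Lemma lift_mnmD n (t0 : 'I_n.+1) b s :
  lift_mnm t0 (b + U_(s))%MM = (lift_mnm t0 b + U_(lift t0 s))%MM.
Proof.
apply/mnmP => t; rewrite mnmDE ![lift_mnm _ _ _]mnmE mnm1E.
case: unliftP => [r ->|->]; last by rewrite eq_sym (negPf (neq_lift _ _)).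
by rewrite mnmDE mnm1E (inj_eq lift_inj).
Qed.

Lemma mdeg_lift_mnm n (t0 : 'I_n.+1) b : mdeg (lift_mnm t0 b) = mdeg b.
Proof.
rewrite !mdegE (bigD1_ord t0) //= mnmE unlift_none add0n.
by apply: eq_bigr => s _; rewrite mnmE liftK.
Qed.

Lemma lift_mnm_surj n (t0 : 'I_n.+1) (b : 'X_{1..n.+1}) : b t0 = 0%N ->
  exists b', b = lift_mnm t0 b'.
Proof.
move=> b0; exists [multinom b (lift t0 s) | s < n]; apply/mnmP => t; rewrite mnmE.
by case: unliftP => [s ->|-> //]; rewrite mnmE.
Qed.

Section GradedModule.
Variables (k : fieldType) (n : nat).
Local Notation R := (polynomial_ring k n.+2).
Variables (l : {mpoly k[n.+2]}) (l_hom : l \is 1.-homog).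
Variables (t0 : 'I_n.+2) (l_t0 : l@_(U_(t0)) != 0).
Variables (M : gmod R) (h : int -> nat) (B : graded_basis M h).
Hypothesis M_graded : is_graded M.
Hypothesis M_gen0 : generates (@mhom k R M 0).
Hypothesis h_neg : forall d, d < 0 -> h d = 0%N.

Let th := polynomial_coordinates l_hom l_t0.
Let gr := coordinates_grading th.

Lemma is_graded_action : graded_action M.
Proof. by case: M_graded. Qed.

Let Mgr := is_graded_action.

Lemma mhom_eq0 d (x : M) : h d = 0%N -> mhom d x -> x = 0.
Proof.
move=> h0 hx; rewrite -(gbK B hx) /lin big1 // => -[i lt] _; exfalso.
by move: lt; rewrite h0.
Qed.

Lemma mhom_disjoint d e (x : M) : d != e -> mhom d x -> mhom e x -> x = 0.
Proof.
move=> de hd he; case: M_graded => h0 _ _ ind.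
pose f j : M := if j == d then x else if j == e then - x else 0.
have fh j : mhom j (f j).
  rewrite /f; case: eqP => [->//|_]; case: eqP => [->|_]; last exact: (h0 j).1.
  by have := (h0 e).2 0 x (h0 e).1 he; rewrite sub0r.
have := ind [:: d; e] f; rewrite /= inE de /= !big_cons big_nil /f eqxx eq_sym (negPf de) eqxx.
by rewrite addr0 subrr => /(_ isT fh erefl d); rewrite inE eqxx => /(_ isT).
Qed.

(** Each [x i] has degree 0, so only coefficients of degree d contribute in degree d; directness of
    the grading allows the equation to be compared degree by degree. *)
Lemma component N (a : 'I_N -> R) (x : 'I_N -> M) d y :
  (forall i, mhom 0 (x i)) -> mhom d y -> y = \sum_i a i *: x i ->
  y = \sum_i hcomp gr d (a i) *: x i.
Proof.
move=> xh yh yE; case: M_graded => h0 _ _ ind.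
have [N0 aE] := homogeneous_decomposition th a.
pose g j : M := \sum_i hcomp gr j (a i) *: x i.
have gh j : mhom j (g j).
  apply: (mhom_sum gr Mgr) => i _.
  by have := Mgr.2 j 0 _ _ (hcomp_hom gr j (a i)) (xh i); rewrite addr0.
have yg : y = \sum_(j < N0) g j%:Z.
  rewrite yE exchange_big; apply: eq_bigr => i _; rewrite -scaler_suml; congr (_ *: _).
  exact: aE.
pose s := undup (d :: [seq j%:Z | j <- iota 0 N0]).
pose f j := (if j \in [seq j%:Z | j <- iota 0 N0] then g j else 0) - (if j == d then y else 0).
have fh j : mhom j (f j).
  apply: (h0 j).2; first by case: ifP => _ //; exact: (h0 j).1.
  by case: eqP => [->//|_]; exact: (h0 j).1.
have ds : d \in s by rewrite mem_undup mem_head.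
have us : uniq s by exact: undup_uniq.
have f0 : \sum_(j <- s) f j = 0.
  rewrite sumrB -big_mkcond /= [X in _ - X](bigD1_seq d) //= eqxx.
  rewrite [X in _ - (_ + X)]big1 ?addr0 => [|j /negPf ->//].
  apply/eqP; rewrite subr_eq0 yg; apply/eqP.
  rewrite -big_filter.
  have -> : \sum_(j < N0) g j%:Z = \sum_(j <- [seq j%:Z | j <- iota 0 N0]) g j.
    by rewrite big_map -(big_mkord xpredT (fun j : nat => g j%:Z)) /index_iota subn0.
  apply: perm_big; apply: uniq_perm.
  - by rewrite filter_uniq.
  - by rewrite map_inj_uniq ?iota_uniq // => i j [].
  move=> j; rewrite mem_filter mem_undup inE.
  by case: (_ \in _); rewrite ?orbT.
have := ind s f us fh f0 d ds; rewrite /f eqxx => /eqP; rewrite subr_eq0 => /eqP <-.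
case: ifP => // /negbT dn; symmetry.
have [d0|d0] := ltrP d 0.
  by rewrite big1 // => i _; rewrite (hcomp_neg th) ?scale0r.
rewrite big1 // => i _; suff -> : hcomp gr d (a i) = 0 by rewrite scale0r.
rewrite aE hcomp_sum big1 // => j _.
apply: (hcomp_other _ _ (hcomp_hom gr j%:Z (a i))).
apply: contraNneq dn => ->.
by apply/mapP; exists (j : nat); rewrite // mem_iota /= ltn_ord.
Qed.

Lemma mhom_span (m : nat) (Z : M -> Prop) :
  ksubspace Z ->
  (forall b rho, mdeg b = m -> Z (pmon th b *: @gb _ _ _ _ B 0 rho)) ->
  forall x : M, mhom m%:Z x -> Z x.
Proof.
move=> ZZ ZX x hx; have [N [a [y [yh xE]]]] := M_gen0 x.
rewrite (component yh hx xE).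
apply: (big_ind Z) => [||i _]; [exact: ZZ.1|by move=> *; exact: ksubspaceD|].
rewrite -[in X in Z (_ *: X)](gbK B (yh i)) /lin scaler_sumr.
under eq_bigr => rho _ do rewrite scalerA mulrC -scalerA.
apply: ksubspace_sum => // rho _.
set f := hcomp _ _ _; have fh : ghom m%:Z f by exact: hcomp_hom.
rewrite -[f](pcVK th) [pcV th f]mpolyE rmorph_sum scaler_suml big_seq.
under eq_bigr => b _ do rewrite -mul_mpolyC rmorphM pcC -scalerA.
apply: ksubspace_sum => // b bs; apply: ZX.
by move: fh; rewrite -{1}[f](pcVK th) => /pc_hom /dhomogP; apply.
Qed.

Let L d' d := mult_mx B (l : R) d' d.
Let y (s : 'I_n.+1) := pvar th (lift t0 s).
Let Y s d' d := mult_mx B (y s) d' d.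
Let ymon (b : 'X_{1..n.+1}) := pmon th (lift_mnm t0 b).

Let pvar_t0 : pvar th t0 = l.
Proof. exact: polynomial_coordinates_t0. Qed.

Let l_ghom : ghom 1 (l : R).
Proof. exact: l_hom. Qed.

Let ymonD b s : ymon (b + U_(s))%MM = y s * ymon b.
Proof. by rewrite /ymon lift_mnmD pmonD. Qed.

Let ymon_hom b : ghom (mdeg b)%:Z (ymon b).
Proof. by rewrite -(mdeg_lift_mnm t0 b); exact: pmon_hom. Qed.

Lemma mult_mxC (f g : R) d0 d1 d2 : ghom 1 f -> ghom 1 g -> d1 = d0 + 1 -> d2 = d1 + 1 ->
  mult_mx B f d0 d1 *m mult_mx B g d1 d2 = mult_mx B g d0 d1 *m mult_mx B f d1 d2.
Proof.
move=> hf hg e1 e2; apply/row_matrixP => i; rewrite !row_mul !rowK.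
have h1 e : ghom 1 e -> mhom d1 (e *: @gb _ _ _ _ B d0 i).
  by move=> he; rewrite e1 addrC; apply: Mgr.2 => //; exact: gb_hom.
rewrite !(mult_mxE Mgr) ?scalerA //; try exact: h1.
by rewrite mulrC.
Qed.

(** As [M] is generated in degree 0, the elements of degree m+1 are spanned by variables times
    elements of degree m, and l commutes with the variables. *)
Lemma surjective_step (m : nat) :
  (forall x : M, mhom m%:Z x -> exists2 z, mhom (m%:Z - 1) z & x = (l : R) *: z) ->
  forall x : M, mhom m.+1%:Z x -> exists2 z, mhom m%:Z z & x = (l : R) *: z.
Proof.
move=> sj x; pose Z (x : M) := exists2 z, mhom m%:Z z & x = (l : R) *: z.
apply: (@mhom_span m.+1 Z).
  have [h0 hL] := mhom_ksubspace gr Mgr m%:Z.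
  split; first by exists 0 => //; rewrite scaler0.
  move=> c u v [u' hu ->] [v' hv ->]; exists (gunit R c *: u' + v'); first exact: hL.
  by rewrite scalerDr !scalerA mulrC.
move=> b rho bm.
have [t bt] : exists t, (0 < b t)%N.
  apply/existsP; apply: contra_eqT bm; rewrite negb_exists => /forallP b0.
  by rewrite mdegE big1 // => t _; apply/eqP; rewrite -leqn0 leqNgt.
have le : (U_(t) <= b)%MM by apply/mnm_lepP => u; rewrite mnm1E; case: eqP => // <-.
have bE := submK le; have bm' : mdeg (b - U_(t))%MM = m.
  by have := congr1 mdeg bE; rewrite mdegD mdeg1 bm addn1 => -[].
have hx : mhom m%:Z (pmon th (b - U_(t))%MM *: @gb _ _ _ _ B 0 rho).
  rewrite -[m%:Z]addr0; apply: Mgr.2; last exact: gb_hom.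
  by rewrite -bm'; exact: pmon_hom.
have [z hz zE] := sj _ hx; exists (pvar th t *: z).
  have -> : m%:Z = 1 + (m%:Z - 1) by lia.
  by apply: Mgr.2 => //; exact: pvar_hom.
by rewrite -bE pmonD -scalerA zE !scalerA mulrC.
Qed.

Lemma rank_injective d : 
  (forall x z : M, mhom (d - 1) x -> mhom (d - 1) z -> (l : R) *: x = (l : R) *: z -> x = z) ->
  \rank (L (d - 1) d) = h (d - 1).
Proof.
move=> inj; apply/eqP/inj_row_free => v vL.
have E : (l : R) *: lin (@gb _ _ _ _ B (d - 1)) v = (l : R) *: 0.
  by rewrite (mult_mx_lin gr Mgr B v l_ghom (esym (subrK 1 d))) vL lin0 scaler0.
have := inj _ _ (lin_hom gr Mgr B v) (mhom_ksubspace gr Mgr _).1 E.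
by move/(congr1 (gc B (d - 1))); rewrite gcK gc0.
Qed.

Lemma rank_surjective d :
  (forall x : M, mhom d x -> exists2 z, mhom (d - 1) z & x = (l : R) *: z) ->
  \rank (L (d - 1) d) = h d.
Proof.
move=> sj; apply/eqP; change (row_full (L (d - 1) d)).
rewrite -sub1mx; apply/row_subP => i.
have [z hz zE] := sj _ (gb_hom B i); apply/submxP; exists (gc B (d - 1) z).
rewrite (mult_mxE Mgr B l_ghom (esym (subrK 1 d)) hz) -zE.
by rewrite gc_gb row1.
Qed.

Section Cokernel.
Variables (q m c : nat) (P : 'M[k]_(h m.+1%:Z, c)).
Hypothesis LP : L m%:Z m.+1%:Z *m P = 0.
Hypothesis P_inj : forall z : 'cV[k]_c, P *m z = 0 -> z = 0.

(** Monomials in the variables other than [t0] generate the cokernel from degree 0: a monomial that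
    contains [t0] is a multiple of l, hence is killed by [P]. *)
Lemma cokernel_krank (s : 'I_n.+1 -> {set 'I_n.+1} -> k) :
  (forall v T, s v T != 0) ->
  (m.+1 * 'C(n, q) * c
   <= (m.+1 + q) * frank (kmx s q.+1 (fun v => Y v m%:Z m.+1%:Z *m P)))%N.
Proof.
move=> s0; have hm b rho : mhom (mdeg b)%:Z (ymon b *: @gb _ _ _ _ B 0 rho).
  by rewrite -[(mdeg b)%:Z]addr0; apply: Mgr.2; [exact: ymon_hom|exact: gb_hom].
have mS : m.+1%:Z = m%:Z + 1 by lia.
apply: (@koszul_rank_ge k n (h 0) _ _ m q _ _
  (fun b rho => gc B m%:Z (ymon b *: @gb _ _ _ _ B 0 rho))
  (fun b rho => gc B m.+1%:Z (ymon b *: @gb _ _ _ _ B 0 rho) *m P)).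
- by move=> v T _; exact: s0.
- move=> b rho v db; rewrite mulmxA (mult_mxE Mgr) ?ymonD ?scalerA //.
    exact: pvar_hom.
  by rewrite -db.
move=> z wz; apply: P_inj.
pose Z (x : M) := mhom m.+1%:Z x /\ gc B m.+1%:Z x *m (P *m z) = 0.
have ZZ : ksubspace Z.
  have [h0 hL] := mhom_ksubspace gr Mgr m.+1%:Z.
  split; first by split=> //; rewrite gc0 mul0mx.
  move=> a x x' [hx x0] [hx' x'0]; split; first exact: hL.
  have -> : gc B m.+1%:Z (gunit R a *: x + x') = a *: gc B m.+1%:Z x + gc B m.+1%:Z x'.
    rewrite -[RHS](gcK B) (lin_is_klinear (@gb _ _ _ _ B m.+1%:Z)).
    by rewrite !(gbK B).
  by rewrite mulmxDl -scalemxAl x0 x'0 scaler0 addr0.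
have Zspan : forall x : M, mhom m.+1%:Z x -> Z x.
  apply: mhom_span => // b rho db; split.
    rewrite -db -[(mdeg b)%:Z]addr0; apply: Mgr.2; [exact: pmon_hom|exact: gb_hom].
  have [b0|b0] := eqVneq (b t0) 0%N.
    have [b' b'E] := lift_mnm_surj b0; rewrite b'E mulmxA; apply: wz.
    by rewrite -(mdeg_lift_mnm t0) -b'E.
  have le : (U_(t0) <= b)%MM.
    by apply/mnm_lepP => u; rewrite mnm1E; case: eqP => // <-; rewrite lt0n.
  have bE := submK le; have bm' : mdeg (b - U_(t0))%MM = m.
    by have := congr1 mdeg bE; rewrite mdegD mdeg1 db addn1 => -[].
  rewrite -bE pmonD -scalerA pvar_t0 -(mult_mxE Mgr B l_ghom mS); last first.
    rewrite -bm' -[(mdeg _)%:Z]addr0; apply: Mgr.2; [exact: pmon_hom|exact: gb_hom].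
  by rewrite -!mulmxA [X in _ *m X]mulmxA LP mul0mx mulmx0.
apply/colP => a; have [_] := Zspan _ (gb_hom B a).
by rewrite gc_gb -rowE => /rowP/(_ 0); rewrite !mxE.
Qed.

End Cokernel.

Section Kernel.
Variables (c : nat).
Hypothesis M_socle : forall x : M, socle x -> mhom c%:Z x.

Lemma socle_vars (x : M) : (forall t, pvar th t *: x = 0) -> socle x.
Proof.
move=> x0 a [N [b [f [fh ->]]]]; rewrite scaler_suml big1 // => i _.
have [j j0] := fh i; rewrite -(pcVK th (f i)) => /pc_hom.
case: j j0 => // j j0 /= hj; change (b i * pc th (pcV th (f i)) *: x = 0).
rewrite -scalerA; suff -> : pc th (pcV th (f i)) *: x = 0 by rewrite scaler0.
rewrite [pcV th (f i)]mpolyE rmorph_sum scaler_suml big_seq big1 // => m ms.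
have dm : mdeg m = j by have /dhomogP := hj; apply.
have [t mt] : exists t, (0 < m t)%N.
  apply/existsP; move: j0; apply: contraTT; rewrite negb_exists => /forallP m0.
  by rewrite -dm mdegE big1 // => t _; apply/eqP; rewrite -leqn0 leqNgt.
have le : (U_(t) <= m)%MM by apply/mnm_lepP => u; rewrite mnm1E; case: eqP => // <-.
rewrite -mul_mpolyC rmorphM -/(pmon th m) -(submK le) pmonD.
by rewrite -!scalerA [pvar th t *: _]scalerA mulrC -!scalerA x0 !scaler0.
Qed.

(** Induction on the distance m from degree c. Below degree c the socle is zero, so it suffices that
    all variables kill x: l does by assumption, and the product with any other variable is again in
    the kernel of l, one step closer to c. *)
Lemma kernel_separated (m : nat) (d : int) (x : M) : d + m%:Z = c%:Z ->
  mhom d x -> (l : R) *: x = 0 -> (forall b, mdeg b = m -> ymon b *: x = 0) -> x = 0.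
Proof.
elim: m d x => [|m IH] d x dc hx lx bx.
  have := bx 0%MM mdeg0; have -> : ymon 0 = 1; last by rewrite scale1r.
  rewrite /ymon; have -> : lift_mnm t0 0 = 0%MM.
    by apply/mnmP => t; rewrite mnmE mnm0E; case: unlift => [s|//]; rewrite mnm0E.
  by rewrite /pmon mpolyX0 rmorph1.
have dlt : d != c%:Z by lia.
apply: (mhom_disjoint dlt hx); apply/M_socle/socle_vars => t.
case: (unliftP t0 t) => [s ->|->]; last by rewrite pvar_t0.
apply: (IH (d + 1)); first by lia.
- by rewrite addrC; apply: Mgr.2 => //; exact: pvar_hom.
- by rewrite scalerA mulrC -scalerA lx scaler0.
by move=> b db; rewrite scalerA mulrC -ymonD bx // mdegD mdeg1 db addn1.
Qed.

Variables (q m r : nat) (d' d : int) (K : 'M[k]_(r, h d')).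
Hypotheses (dd : d = d' + 1) (dm : d + m%:Z = c%:Z).
Hypothesis KL : K *m L d' d = 0.
Hypothesis K_inj : forall z : 'rV[k]_r, z *m K = 0 -> z = 0.

(** The dual of the kernel of l is generated by the coordinates rho on the part of degree c: the
    functional attached to a monomial y^b and rho sends x to the coordinate rho of y^b x. That these
    functionals separate is [kernel_separated]. *)
Lemma kernel_krank (s : 'I_n.+1 -> {set 'I_n.+1} -> k) :
  (forall v T, s v T != 0) ->
  (m.+1 * 'C(n, q) * r
   <= (m.+1 + q) * frank (kmx s q.+1 (fun v => (K *m Y v d' d)^T)))%N.
Proof.
move=> s0; pose gbl (z : 'rV[k]_r) : M := lin (@gb _ _ _ _ B d') (z *m K).
have gbl_hom z : mhom d' (gbl z) by exact: (lin_hom gr Mgr).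
have gblE v : gbl v = \sum_z gunit R (v 0 z) *: gbl (delta_mx 0 z).
  rewrite /gbl mulmx_sum_row.
  rewrite (klinear_sum (lin_is_klinear (@gb _ _ _ _ B d')) (@scale1r _ _) (@kscale1 _ _ _)).
  apply: eq_bigr => z _; rewrite -rowE.
  exact: (klinearZ (lin_is_klinear (@gb _ _ _ _ B d')) (@scale1r _ _) (@kscale1 _ _ _)).
have gc_comb N (f : 'I_N -> k) (x : 'I_N -> M) b e (em : e + (mdeg b)%:Z = c%:Z) :
    (forall i, mhom e (x i)) ->
    gc B c%:Z (ymon b *: \sum_i gunit R (f i) *: x i) = \sum_i f i *: gc B c%:Z (ymon b *: x i).
  move=> hx; rewrite scaler_sumr.
  under eq_bigr => i _ do rewrite scalerA mulrC -scalerA.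
  rewrite (gc_sum B) // => i _; rewrite -em addrC.
  by apply: Mgr.2 => //; exact: ymon_hom.
have dc1 (b : 'X_{1..n.+1}) : mdeg b = m -> d + (mdeg b)%:Z = c%:Z by move=> ->.
have dc2 (b : 'X_{1..n.+1}) : mdeg b = m.+1 -> d' + (mdeg b)%:Z = c%:Z by move=> ->; move: dm; rewrite dd; lia.
apply: (@koszul_rank_ge k n (h c%:Z) _ _ m q _ _
  (fun b rho => \row_a gc B c%:Z (ymon b *: @gb _ _ _ _ B d a) 0 rho)
  (fun b rho => \row_z gc B c%:Z (ymon b *: gbl (delta_mx 0 z)) 0 rho)).
- by move=> v T _; exact: s0.
- move=> b rho v db; apply/rowP => z; rewrite !mxE.
  have -> : ymon (b + U_(v))%MM *: gbl (delta_mx 0 z) =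
      ymon b *: lin (@gb _ _ _ _ B d) (row z (K *m Y v d' d)).
    rewrite ymonD mulrC -scalerA /gbl (mult_mx_lin gr Mgr B _ (pvar_hom th _) dd).
    by rewrite -mulmxA -rowE.
  rewrite /lin (gc_comb _ _ _ _ _ (dc1 b db)); last by move=> a; exact: gb_hom.
  by rewrite summxE; apply: eq_bigr => a _; rewrite !mxE mulrC.
move=> z wz; have x0 : gbl z^T = 0.
  apply: (@kernel_separated m.+1 d'); first by move: dm; rewrite dd; lia.
  - exact: gbl_hom.
  - by rewrite /gbl (mult_mx_lin gr Mgr B _ l_ghom dd) -mulmxA KL mulmx0 lin0.
  move=> b db; have hb : mhom c%:Z (ymon b *: gbl z^T).
    by rewrite -(dc2 b db) addrC; apply: Mgr.2 => //; exact: ymon_hom.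
  rewrite -(gbK B hb) gblE (gc_comb _ _ _ _ _ (dc2 b db)) => [|i]; last exact: gbl_hom.
  suff -> : \sum_i z^T 0 i *: gc B c%:Z (ymon b *: gbl (delta_mx 0 i)) = 0 by rewrite lin0.
  apply/rowP => rho; rewrite summxE [RHS]mxE.
  have /rowP/(_ 0) E := wz b rho db; rewrite [RHS]mxE [LHS]mxE in E; rewrite -[RHS]E.
  by apply: eq_bigr => i _; rewrite !mxE mulrC.
apply: trmx_inj; rewrite trmx0; apply: K_inj.
by have := congr1 (gc B d') x0; rewrite gcK gc0.
Qed.

End Kernel.

Let rl d := \rank (L (d - 1) d).

Lemma coker_base_mul d : L (d - 1) d *m col_base (cokermx (L (d - 1) d)) = 0.
Proof.
have /row_freeP[V VE] := row_base_free (cokermx (L (d - 1) d)).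
rewrite -[LHS]mulmx1 -VE mulmxA -[_ *m _ *m row_base _]mulmxA mulmx_base mulmx_coker.
by rewrite mul0mx.
Qed.

Lemma coker_base_inj d (z : 'cV[k]_(\rank (cokermx (L (d - 1) d)))) :
  col_base (cokermx (L (d - 1) d)) *m z = 0 -> z = 0.
Proof.
have /row_fullP[U UE] := col_base_full (cokermx (L (d - 1) d)).
by move=> z0; rewrite -[z]mul1mx -UE -mulmxA z0 mulmx0.
Qed.

Lemma ker_base_mul d : row_base (kermx (L (d - 1) d)) *m L (d - 1) d = 0.
Proof. by apply/sub_kermxP; rewrite eq_row_base. Qed.

Lemma ker_base_inj d (z : 'rV[k]_(\rank (kermx (L (d - 1) d)))) :
  z *m row_base (kermx (L (d - 1) d)) = 0 -> z = 0.
Proof. by move/eqP; rewrite mulmx_free_eq0 ?row_base_free // => /eqP. Qed.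

(** The lower bound in the top exterior degree n+1 over S is compared with the upper bound of
    [kmx_top]: multiples of l in degree m stay zero in the cokernel after multiplication by a
    variable. *)
Lemma cokernel_growth (m : nat) :
  (m.+1 * (h m.+1%:Z - rl m.+1%:Z) <= (m.+1 + n) * (h m%:Z - rl m%:Z))%N.
Proof.
have E : m.+1%:Z - 1 = m%:Z by lia.
have LP := coker_base_mul m.+1%:Z; have Pi := @coker_base_inj m.+1%:Z.
rewrite /rl -mxrank_coker; move: LP Pi; rewrite E => LP Pi.
have s0 (v : 'I_n.+1) (T : {set 'I_n.+1}) : (1 : k) != 0 by exact: oner_neq0.
have := cokernel_krank n LP Pi s0; rewrite binn muln1 => /leq_trans; apply.
rewrite leq_mul2l; apply/orP; right; apply: kmx_top => v.
rewrite mulmxA -(mult_mxC (pvar_hom th _) l_ghom) ?subrK //; last by rewrite -E subrK.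
by rewrite -mulmxA LP mulmx0.
Qed.

Variable c : nat.
Hypothesis M_socle : forall x : M, socle x -> mhom c%:Z x.
Hypothesis h_big : forall d, c%:Z < d -> h d = 0%N.

(** Dual to [cokernel_growth]: variables send the kernel of l in degree d - 1 into the kernel in
    degree d, whose dimension bounds the top rank of the transposed maps. *)
Lemma kernel_growth (m : nat) d : d + m%:Z = c%:Z ->
  (m.+1 * (h (d - 1) - rl d) <= (m.+1 + n) * (h d - rl (d + 1)))%N.
Proof.
move=> dm; have KL := ker_base_mul d; have Ki := @ker_base_inj d.
have s0 (v : 'I_n.+1) (T : {set 'I_n.+1}) : (1 : k) != 0 by exact: oner_neq0.
have := kernel_krank M_socle n (esym (subrK 1 d)) dm KL Ki s0.
rewrite [X in (_ * X <= _)%N]mxrank_ker binn muln1 => /leq_trans; apply.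
rewrite leq_mul2l; apply/orP; right.
rewrite /rl addrK -[\rank (L d (d + 1))]mxrank_tr; apply: kmx_top => v.
apply: trmx_inj; rewrite trmx_mul !trmxK trmx0 -mulmxA.
rewrite (mult_mxC (pvar_hom th _) l_ghom) ?subrK //.
by rewrite mulmxA KL mul0mx.
Qed.

Let cokernel_part (q : nat) d (s : 'I_n.+1 -> {set 'I_n.+1} -> k) :
  (forall v T, s v T != 0) ->
  least_krank n (fun e => (h e - rl e)%N%:R) q.+1 d
  <= (frank (kmx s q.+1 (fun v => Y v (d - 1) d *m col_base (cokermx (L (d - 1) d)))))%:R :> rat.
Proof.
move=> s0; have [d0|d0] := lerP 0 d; last first.
  have -> : least_krank n (fun e => (h e - rl e)%N%:R) q.+1 d = 0; last exact: ler0n.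
  by rewrite /least_krank h_neg // sub0n mulr0.
case: d d0 => // -[|m] _; first by rewrite /= !mul0r.
rewrite /least_krank mulrAC ler_pdivrMr; last by rewrite ltr0z; lia.
rewrite -PoszD -!pmulrn -!natrM ler_nat [X in (_ <= X)%N]mulnC /rl -mxrank_coker.
have LP := coker_base_mul m.+1%:Z; have Pi := @coker_base_inj m.+1%:Z; move: LP Pi.
have -> : m.+1%:Z - 1 = m%:Z by lia.
by move=> LP Pi; exact: (cokernel_krank q LP Pi s0).
Qed.

(** Complements in n+1 variables turn a differential from exterior degree q into one from exterior
    degree n+2-q, and duality turns the target degree d into c+1-d. *)
Let kernel_part (q : nat) d (s : 'I_n.+1 -> {set 'I_n.+1} -> k) : (q <= n.+1)%N ->
  (forall v T, s v T != 0) ->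
  least_krank n (fun e => (h (c%:Z - e) - rl (c%:Z - e + 1))%N%:R) (n.+2 - q) (c%:Z + 1 - d)
  <= (frank (kmx s q (fun v => row_base (kermx (L (d - 1) d)) *m Y v (d - 1) d)))%:R :> rat.
Proof.
move=> qn s0; case: q qn => [|q] qn.
  (* Exterior degree n+2 exceeds the number of variables of S, so the bound is 0. *)
  by rewrite subn0 /least_krank bin_small // mulr0 !mul0r.
rewrite subSn // /least_krank.
have -> : c%:Z - (c%:Z + 1 - d) = d - 1 by lia.
rewrite subrK; have [dc|dc] := ltrP c%:Z (d - 1).
  have -> : (h (d - 1) - rl d = 0)%N by have := h_big dc; lia.
  by rewrite mulr0 ler0n.
have [m mE] : exists m : nat, c%:Z + 1 - d = m%:Z by exists (absz (c%:Z + 1 - d)%R); lia.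
rewrite mE; case: m mE => [|m] mE; first by rewrite !mul0r.
rewrite mulrAC ler_pdivrMr; last by rewrite ltr0z; lia.
rewrite -PoszD -!pmulrn -!natrM ler_nat [X in (_ <= X)%N]mulnC.
rewrite -[X in (_ <= _ * X)%N]frank_kmx_tr // -[(h (d - 1) - _)%N]mxrank_ker.
apply: (kernel_krank M_socle _ (esym (subrK 1 d)) _ (ker_base_mul d) (@ker_base_inj d)).
  by lia.
by move=> v T; exact: s0.
Qed.

Lemma krank_lower_bound (q : nat) d : (q <= n.+1)%N ->
  ('C(n.+1, q) * rl d)%N%:R
  + least_krank n (fun e => (h e - rl e)%N%:R) q.+1 d
  + least_krank n (fun e => (h (c%:Z - e) - rl (c%:Z - e + 1))%N%:R) (n.+2 - q) (c%:Z + 1 - d)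
  <= (krank th B q.+1 (d - 1) d)%:R :> rat.
Proof.
move=> qn; pose s := @ksign k n.+2.
have s0 v T : s v T != 0 by exact: ksign_neq0.
pose Xm t := mult_mx B (pvar th t) (d - 1) d.
have Xt0 : Xm t0 = L (d - 1) d by rewrite /Xm pvar_t0.
have XP : Xm t0 *m col_base (cokermx (L (d - 1) d)) = 0 by rewrite Xt0 coker_base_mul.
have KX : row_base (kermx (L (d - 1) d)) *m Xm t0 = 0 by rewrite Xt0 ker_base_mul.
have := koszul_block q s0 XP KX; rewrite Xt0 -/(rl d) => blk.
apply: (@le_trans _ _ ('C(n.+1, q) * rl d
   + frank (kmx (fun v (T : {set 'I_n.+1}) => s (lift t0 v) (lift t0 @: T)) q.+1
       (fun v => Xm (lift t0 v) *m col_base (cokermx (L (d - 1) d))))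
   + frank (kmx (fun v (T : {set 'I_n.+1}) => s (lift t0 v) (t0 |: lift t0 @: T)) q
       (fun v => row_base (kermx (L (d - 1) d)) *m Xm (lift t0 v))))%N%:R); last first.
  by rewrite ler_nat.
rewrite !natrD; apply: lerD; first apply: lerD => //.
  exact: cokernel_part.
exact: kernel_part.
Qed.

End GradedModule.

(** * Pure diagrams *)
Section DividedDifferences.
Variables (F : fieldType) (p : nat).

(** The weight of the node a in the divided difference at the nodes e. *)
Definition node_weight (e : 'I_p.+1 -> F) (a : 'I_p.+1) : F :=
  \prod_(b | b != a) (e a - e b)^-1.

(* The coefficient of X^p in the Lagrange interpolation of f at p + 1 nodes. *)
Lemma divided_difference_eq0 (e : 'I_p.+1 -> F) (f : {poly F}) :
  injective e -> (size f <= p)%N ->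
  \sum_a node_weight e a * f.[e a] = 0.
Proof.
move=> e_inj sf.
pose m a := \prod_(b | b != a) ('X - (e b)%:P).
have szm a : size (m a) = p.+1.
  rewrite /m -big_filter size_prod_XsubC size_filter -sum1_count sum1_card.
  by rewrite cardC1 card_ord.
have mE a b : (m a).[e b] = \prod_(c | c != a) (e b - e c).
  by rewrite horner_prod; apply: eq_bigr => c _; rewrite !hornerE.
pose g := \sum_a (node_weight e a * f.[e a]) *: m a.
have gf : g = f.
  apply/eqP; rewrite -subr_eq0; apply/eqP.
  apply: (@roots_geq_poly_eq0 _ _ [seq e b | b <- enum 'I_p.+1]).
  - apply/allP => _ /mapP[b _ ->]; rewrite rootE hornerD hornerN horner_sum subr_eq0.
    rewrite (bigD1 b) //= big1 => [|a ab].
      rewrite hornerZ mE addr0 mulrAC -big_split /= big1 ?mul1r // => c cb.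
      by rewrite mulVf // subr_eq0 (inj_eq e_inj) eq_sym.
    by rewrite hornerZ mE (bigD1 b) 1?eq_sym //= subrr mul0r mulr0.
  - by rewrite map_inj_uniq // enum_uniq.
  rewrite size_map size_enum_ord (leq_trans (size_polyD _ _)) // geq_max size_polyN.
  rewrite (leq_trans sf) // andbT (leq_trans (size_sum _ _ _)) //.
  by apply/bigmax_leqP => a _; rewrite (leq_trans (size_scale_leq _ _)) ?szm.
have gp : g`_p = 0 by rewrite gf nth_default.
rewrite -[RHS]gp coef_sum; apply: eq_bigr => a _; rewrite coefZ.
have /monicP := monic_prod_XsubC (index_enum 'I_p.+1) (fun b => b != a) e.
by rewrite /lead_coef -/(m a) szm /= => ->; rewrite mulr1.
Qed.

End DividedDifferences.

Lemma coef_binomial_power (e j : nat) : (('X + 1) ^+ e : {poly rat})`_j = 'C(e, j)%:R.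
Proof.
rewrite exprDn coef_sum; have [je|ej] := leqP j e.
  have lt : (e - j < e.+1)%N by rewrite ltnS leq_subr.
  rewrite (bigD1 (Ordinal lt)) //= expr1n mulr1 coefMn coefXn subKn // eqxx bin_sub //.
  rewrite big1 ?addr0 // => i ne; rewrite expr1n mulr1 coefMn coefXn.
  case: eqP => [E|_]; last by rewrite mul0rn.
  by case/eqP: ne; apply: val_inj => /=; rewrite E subKn // -ltnS.
rewrite bin_small // big1 // => i _; rewrite expr1n mulr1 coefMn coefXn.
by case: eqP => [E|_]; rewrite ?mul0rn //; lia.
Qed.

Definition binomial_poly (j : nat) : {poly rat} :=
  (j`!%:R)^-1 *: \prod_(i < j) ('X - i%:R%:P).

Lemma binomial_polyE j (e : nat) : (binomial_poly j).[e%:R] = 'C(e, j)%:R.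
Proof.
rewrite hornerZ horner_prod.
have -> : \prod_(i < j) ('X - i%:R%:P).[e%:R] = (e ^_ j)%:R :> rat.
  transitivity (\prod_(i < j) (e%:R - i%:R) : rat).
    by apply: eq_bigr => i _; rewrite hornerD hornerN hornerX hornerC.
  rewrite ffact_prod natr_prod.
  have [je|ej] := leqP j e.
    by apply: eq_bigr => i _; rewrite natrB //; have := ltn_ord i; lia.
  rewrite (bigD1 (Ordinal ej)) //= subrr mul0r.
  by rewrite (bigD1 (Ordinal ej)) //= subnn mul0r.
rewrite -bin_ffact natrM mulrC mulfK // pnatr_eq0 -lt0n; exact: fact_gt0.
Qed.

Lemma size_binomial_poly j : (size (binomial_poly j) <= j.+1)%N.
Proof.
apply: leq_trans (size_scale_leq _ _) _; rewrite size_prod_XsubC.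
by rewrite -[index_enum _]enumT /= size_enum_ord.
Qed.

(** Divisibility by (1 - X)^p means that the coefficients below p vanish after the shift of X to X +
    1. The j-th of them is the divided difference of the binomial polynomial of degree j < p. *)
Lemma node_weight_dvdp p (e : 'I_p.+1 -> nat) : injective e ->
  (1 - 'X) ^+ p %| \sum_a node_weight (fun a => (e a)%:R : rat) a *: 'X^(e a).
Proof.
move=> e_inj; set Q := \sum_a _ *: _.
have Qc j : (j < p)%N -> (Q \Po ('X + 1%:P))`_j = 0.
  move=> jp; have er_inj : injective (fun a => (e a)%:R : rat).
    by move=> a b /eqP; rewrite eqr_nat => /eqP/e_inj.
  rewrite -[RHS](divided_difference_eq0 er_inj (leq_trans (size_binomial_poly j) jp)).
  rewrite raddf_sum coef_sum; apply: eq_bigr => a _ /=.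
  by rewrite comp_polyZ comp_Xn_poly coefZ coef_binomial_power binomial_polyE.
have QE : Q \Po ('X + 1%:P) = drop_poly p (Q \Po ('X + 1%:P)) * 'X^p.
  rewrite -[LHS](poly_take_drop p) [take_poly _ _](_ : _ = 0) ?add0r //.
  apply/polyP => j; rewrite coef_take_poly coef0; case: ltnP => // jp; exact: Qc.
rewrite -[Q](comp_polyXaddC_K Q 1) QE comp_polyM comp_Xn_poly.
apply: dvdp_mull; have -> : 1 - 'X = (-1) *: ('X - 1%:P) :> {poly rat}.
  by rewrite scaleN1r opprB.
by rewrite exprZn dvdpZl ?expf_neq0 // oppr_eq0 oner_eq0.
Qed.

Section PureDiagrams.
Variable p : nat.

(** The Herzog-Kuehl formula: the entries are the weights of the divided difference at the degrees,
    with alternating signs, normalised to 1 in column 0. *)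
Definition pure_entry (d : 'I_p.+1 -> int) (a : 'I_p.+1) : rat :=
  (-1) ^+ a * node_weight (fun b => (d b)%:~R) a / node_weight (fun b => (d b)%:~R) ord0.

Definition pure_diagram (d : 'I_p.+1 -> int) : diagram := fun i j =>
  \sum_(a < p.+1) if (i == a%:Z) && (j == d a) then pure_entry d a else 0.

Lemma pure_diagramE d (a : 'I_p.+1) j :
  pure_diagram d a%:Z j = if j == d a then pure_entry d a else 0.
Proof.
rewrite /pure_diagram (bigD1 a) //= eqxx big1 ?addr0 // => b ba.
by rewrite eqz_nat eq_sym; case: eqP => [E|//]; case/eqP: ba; apply: val_inj.
Qed.

Lemma node_weight_neq0 (d : 'I_p.+1 -> int) a : injective d ->
  node_weight (fun b => (d b)%:~R : rat) a != 0.
Proof.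
move=> d_inj; apply/prodf_neq0 => b ba.
by rewrite invr_eq0 -rmorphB intr_eq0 subr_eq0 (inj_eq d_inj) eq_sym.
Qed.

Lemma strictly_increasing_inj (d : 'I_p.+1 -> int) : strictly_increasing d -> injective d.
Proof.
move=> sd a b dab; apply/val_inj/eqP; case: ltngtP => // lt.
  by have := sd _ _ lt; rewrite dab ltxx.
by have := sd _ _ lt; rewrite dab ltxx.
Qed.

Lemma pure_diagramP d : strictly_increasing d -> is_pure_diagram d (pure_diagram d).
Proof.
move=> /strictly_increasing_inj d_inj.
pose w0 := node_weight (fun b => (d b)%:~R : rat) ord0.
have w0n : w0 != 0 by exact: node_weight_neq0.
split.
- split=> [i j ij|].
    rewrite /pure_diagram big1 // => a _; case: eqP => //= E; case/negP: ij.
    by have := ltn_ord a; rewrite E; lia.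
  (* The shift by N makes all degrees natural numbers; the weights depend only on differences of
     degrees. *)
  pose N := (\sum_a absz (d a))%N; exists N.
  have dN a : (absz (d a) <= N)%N by rewrite /N (bigD1 a) //= leq_addr.
  split=> [i j jN|].
    rewrite /pure_diagram big1 // => a _; case: (j =P d a) => [E|]; last by rewrite andbF.
    by have := dN a; move: jN; rewrite E; lia.
  pose e a := absz (d a + N%:Z).
  have eE a : (e a)%:Z = d a + N%:Z by have := dN a; rewrite /e; lia.
  have e_inj : injective e.
    by move=> a b E; apply/d_inj/(@addIr _ N%:Z); rewrite -!eE E.
  have -> : \poly_(m < N.*2.+1)
      (\sum_(i < p.+1) (-1) ^+ i * pure_diagram d i%:Z (m%:Z - N%:Z)) =
      w0^-1 *: \sum_a node_weight (fun a => (e a)%:R : rat) a *: 'X^(e a).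
    apply/polyP => m; rewrite coef_poly coefZ coef_sum mulr_sumr.
    have term a : w0^-1 * (node_weight (fun a => (e a)%:R : rat) a *: 'X^(e a))`_m =
        if m%:Z - N%:Z == d a then (-1) ^+ a * pure_entry d a else 0.
      rewrite coefZ coefXn subr_eq -eE eqz_nat; case: eqP => _; last by rewrite !mulr0.
      rewrite mulr1 /pure_entry !mulrA -exprD -signr_odd oddD addbb expr0 mul1r -/w0 mulrC.
      congr (_ / _); apply: eq_bigr => b _; congr (_^-1).
      by rewrite !pmulrn !eE !rmorphD /= opprD addrACA subrr addr0.
    rewrite (eq_bigr _ (fun a _ => term a)); case: ltnP => mN.
      apply: eq_bigr => a _; rewrite pure_diagramE; case: eqP => // _.
      by rewrite mulr0.
    rewrite big1 // => a _; case: eqP => // E.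
    by have := dN a; move: mN; rewrite -mul2n; lia.
  by rewrite dvdpZr ?invr_eq0 //; exact: node_weight_dvdp.
- by move=> i j /eqP/negPf ji; rewrite pure_diagramE ji.
have := pure_diagramE d ord0 (d ord0); rewrite eqxx => ->.
by rewrite /pure_entry expr0 mul1r divff.
Qed.

End PureDiagrams.

(* Pure diagrams whose degree sequences follow low up to position s and top
   afterwards: the differences of divided differences telescope in s. *)
Section Interpolation.
Variables (p : nat) (low top : nat -> int).
Hypothesis low_mono : forall a b, (a < b <= p)%N -> low a < low b.
Hypothesis top_mono : forall a b, (0 < a < b)%N -> (b <= p.+1)%N -> top a < top b.
Hypothesis low_top : forall s, (s <= p)%N -> low s < top s.+1.

Definition mixed (s : nat) (a : 'I_p.+2) : int := if (a <= s)%N then low a else top a.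

Lemma mixed_increasing s : (s <= p)%N -> strictly_increasing (mixed s).
Proof.
move=> sp a b ab; have := ltn_ord b; rewrite /mixed ltnS => bp.
have lowW x y : (x <= y <= p)%N -> low x <= low y.
  by move=> /andP[]; rewrite leq_eqVlt => /predU1P[->//|xy] yp; rewrite ltW // low_mono // xy.
have topW x y : (0 < x <= y)%N -> (y <= p.+1)%N -> top x <= top y.
  move=> /andP[x0]; rewrite leq_eqVlt => /predU1P[->//|xy] yp; rewrite ltW // top_mono //.
  by rewrite x0.
case: (leqP a s) => a_s; case: (leqP b s) => bs.
- by apply: low_mono; rewrite ab (leq_trans bs).
- apply: le_lt_trans (lowW a s _) _; first by rewrite a_s.
  by apply: lt_le_trans (low_top sp) (topW _ _ _ _).
- by have := leq_trans (ltnW ab) bs; rewrite leqNgt a_s.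
by apply: top_mono => //; rewrite ab andbT; case: (a : nat) a_s.
Qed.

(** The weight at [ord0] undoes the normalisation of the pure diagram, the degree difference makes
    the sum over s telescope, and the sign makes the product non-negative. *)
Let mul (s : nat) : rat := (-1) ^+ p.+1 * (top s.+1 - low s)%:~R
  * node_weight (fun b => (mixed s b)%:~R) ord0.

Lemma mul_ge0 s : (s <= p)%N -> 0 <= mul s.
Proof.
move=> sp; rewrite /mul mulrAC mulr_ge0 //; last by rewrite ler0z subr_ge0 ltW ?low_top.
have inc := mixed_increasing sp.
rewrite /node_weight -[X in X * _](_ : \prod_(b < p.+2 | b != ord0) (-1) = _).
  rewrite -big_split /= prodr_ge0 // => b b0.
  rewrite mulN1r -invrN opprB -rmorphB invr_ge0 ler0z subr_ge0 ltW //.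
  by apply: inc; rewrite lt0n; apply: contraNneq b0 => E; apply/eqP/val_inj.
rewrite prodr_const; congr (_ ^+ _).
by have := cardC1 (@ord0 p.+1); rewrite card_ord.
Qed.

Lemma mixed_sum (a : 'I_p.+2) j :
  \sum_(s < p.+1) mul s * pure_diagram (mixed s) a%:Z j =
  (if (a <= p)%N && (j == low a) then
     (-1) ^+ (p + a) / \prod_(b < p.+1 | b != a :> nat) (low a - low b)%:~R else 0)
  + (if (0 < a)%N && (j == top a) then
     (-1) ^+ (p.+1 + a) / \prod_(b < p.+1 | b.+1 != a :> nat) (top a - top b.+1)%:~R else 0).
Proof.
have term (s : 'I_p.+1) : mul s * pure_diagram (mixed s) a%:Z j =
    if j == mixed s a then (-1) ^+ (p.+1 + a) * (top s.+1 - low s)%:~R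
      * node_weight (fun b => (mixed s b)%:~R) a else 0.
  rewrite pure_diagramE; case: eqP => _; last by rewrite mulr0.
  rewrite /pure_entry /mul exprD.
  have := node_weight_neq0 ord0 (strictly_increasing_inj (mixed_increasing (ltn_ord s))).
  by move: (node_weight _ ord0) => w wn; field.
rewrite (eq_bigr _ (fun s _ => term s)).
pose zl z b : rat := z - (low b)%:~R; pose zt z b : rat := z - (top b)%:~R.
(* [W z s] is the weight of the s-th mixed sequence at the value z; [V z t] follows low before t,
   top after t and omits t. Since top - low = (z - low) - (z - top), the term of s is V_s - V_(s+1).
   The factor for b = a is absent from these products, which is why a V with the index a has to be
   dropped. *)
pose W z s := (\prod_(0 <= b < s.+1 | b != a :> nat) zl z b
  * \prod_(s.+1 <= b < p.+2 | b != a :> nat) zt z b)^-1.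
pose V z t := (\prod_(0 <= b < t | b != a :> nat) zl z b
  * \prod_(t.+1 <= b < p.+2 | b != a :> nat) zt z b)^-1.
have nwE s : (s <= p)%N -> node_weight (fun b => (mixed s b)%:~R) a = W (mixed s a)%:~R s.
  move=> sp; rewrite /W /node_weight -(big_mkord (fun b => b != a :> nat)
    (fun b => ((mixed s a)%:~R - (if (b <= s)%N then low b else top b)%:~R)^-1)).
  rewrite (big_cat_nat (n := s.+1)) ?ltnS ?(leq_trans sp) //= invfM -!prodfV.
  congr (_ * _); rewrite big_nat_cond [RHS]big_nat_cond; apply: eq_bigr => b.
    by move=> /andP[/andP[_ bs] _]; rewrite -(ltnS b) bs.
  by move=> /andP[/andP[bs _] _]; rewrite leqNgt bs.
have nz z s : (s <= p)%N -> z = (mixed s a)%:~R ->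
    (\prod_(0 <= b < s.+1 | b != a :> nat) zl z b != 0)
    /\ (\prod_(s.+1 <= b < p.+2 | b != a :> nat) zt z b != 0).
  move=> sp zE; have := node_weight_neq0 a (strictly_increasing_inj (mixed_increasing sp)).
  by rewrite nwE // -zE /W invr_eq0 mulf_eq0 negb_or => /andP[].
have lowS z s : \prod_(0 <= b < s.+1 | b != a :> nat) zl z b =
    (\prod_(0 <= b < s | b != a :> nat) zl z b) * (if s == a :> nat then 1 else zl z s).
  by rewrite big_mkcond big_nat_recr //= -big_mkcond /=; case: eqP.
have topS z s : (s <= p)%N -> \prod_(s.+1 <= b < p.+2 | b != a :> nat) zt z b =
    (if s.+1 == a :> nat then 1 else zt z s.+1) * \prod_(s.+2 <= b < p.+2 | b != a :> nat) zt z b.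
  by move=> sp; rewrite big_mkcond big_ltn_cond ?ltnS //= -big_mkcond /=; case: eqP; rewrite ?mul1r.
pose c s := (top s.+1 - low s)%:~R * W (mixed s a)%:~R s.
have cE s : (s <= p)%N -> c s =
    (if s == a :> nat then 0 else V (mixed s a)%:~R s)
    - (if s.+1 == a :> nat then 0 else V (mixed s a)%:~R s.+1).
  move=> sp; rewrite /c /W /V; set z := (mixed s a)%:~R.
  have := nz z s sp erefl; rewrite lowS (topS z s sp) !mulf_eq0 !negb_or.
  have [sa|sa] := eqVneq s a; have [sa'|sa'] := eqVneq s.+1 a.
  - by move: sa'; rewrite -sa; lia.
  - have zE : z = (low s)%:~R by rewrite /z /mixed -sa leqnn.
    rewrite mulr1 sub0r /zt rmorphB /= -zE => -[n1 /andP[n2 n3]].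
    by field; rewrite ?n1 ?n2 ?n3.
  - have zE : z = (top s.+1)%:~R by rewrite /z /mixed -sa' ltnn.
    rewrite mul1r subr0 /zl rmorphB /= -zE => -[/andP[n1 n2] n3].
    by field; rewrite ?n1 ?n2 ?n3.
  rewrite /zl /zt rmorphB /= => -[/andP[n1 n2] /andP[n3 n4]].
  by field; rewrite ?n1 ?n2 ?n3 ?n4.
have tele (f : nat -> rat) x y : (x <= y)%N ->
    \sum_(x <= t < y) (f t - f t.+1) = f x - f y.
  move=> xy; rewrite -[RHS]opprB -telescope_sumr // -sumrN.
  by apply: eq_bigr => t _; rewrite opprB.
(* For s >= a the value is low a and V_a is dropped, so only the far end V_(p+1), which involves low
   alone, survives. For s < a the value is top a and V_0, which involves top alone, survives. *)
have claim1 : (a <= p)%N -> \sum_(a <= t < p.+1) c t =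
    - (\prod_(b < p.+1 | b != a :> nat) (low a - low b)%:~R)^-1.
  move=> ap; pose f t := if (t <= a)%N then 0 else V (low a)%:~R t.
  transitivity (\sum_(a <= t < p.+1) (f t - f t.+1)).
    rewrite big_nat_cond [RHS]big_nat_cond; apply: eq_bigr => t /andP[/andP[at_ tp] _].
    rewrite cE // /mixed at_ /f ltnNge at_ /= eqn_leq at_ andbT.
    by have -> : (t.+1 == a) = false by lia.
  rewrite tele ?(leq_trans ap) // /f leqnn sub0r leqNgt ltnS ap /=.
  congr (- _); rewrite /V [X in _ * X]big_geq // mulr1 big_mkord; congr (_^-1).
  by apply: eq_bigr => b _; rewrite /zl rmorphB.
have claim2 : (0 < a)%N -> \sum_(0 <= t < a) c t =
    (\prod_(b < p.+1 | b.+1 != a :> nat) (top a - top b.+1)%:~R)^-1.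
  move=> a0; pose f t := if t == a :> nat then 0 else V (top a)%:~R t.
  have ap : (a <= p.+1)%N by rewrite -ltnS.
  transitivity (\sum_(0 <= t < a) (f t - f t.+1)).
    rewrite big_nat_cond [RHS]big_nat_cond; apply: eq_bigr => t /andP[/andP[_ ta] _].
    have tp : (t <= p)%N by lia.
    rewrite (cE t tp) /mixed /f.
    by have -> : (a <= t)%N = false by lia.
  rewrite tele // /f eqxx subr0 ifN ?(ltn_eqF a0) //.
  rewrite /V big_geq // mul1r big_add1 big_mkord; congr (_^-1).
  by apply: eq_bigr => b _; rewrite /zt rmorphB.
have termE (s : 'I_p.+1) : (if j == mixed s a then (-1) ^+ (p.+1 + a) * (top s.+1 - low s)%:~R
      * node_weight (fun b => (mixed s b)%:~R) a else 0) =
    (if (a <= s)%N then (if j == low a then (-1) ^+ (p.+1 + a) else 0) * c s else 0)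
    + (if (s < a)%N then (if j == top a then (-1) ^+ (p.+1 + a) else 0) * c s else 0).
  rewrite (nwE s (ltn_ord s)) -mulrA -/(c s) /mixed.
  by case: leqP => _; rewrite ?addr0 ?add0r; case: eqP; rewrite ?mul0r.
rewrite (eq_bigr _ (fun s _ => termE s)) big_split /=; congr (_ + _).
  rewrite -(big_mkord xpredT (fun s => if (a <= s)%N then _ * c s else 0)).
  have [ap|pa] := leqP a p; last first.
    rewrite big_nat_cond big1 // => t /andP[/andP[_ tp] _]; rewrite ifN //; lia.
  rewrite (big_cat_nat (n := a)) ?(leq_trans ap) //= big_nat_cond big1 ?add0r; last first.
    by move=> t /andP[/andP[_ ta] _]; rewrite leqNgt ta.
  have -> : \sum_(a <= i < p.+1) (if (a <= i)%N then
      (if j == low a then (-1) ^+ (p.+1 + a) else 0) * c i else 0) =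
      (if j == low a then (-1) ^+ (p.+1 + a) else 0) * \sum_(a <= t < p.+1) c t.
    rewrite mulr_sumr big_nat_cond [RHS]big_nat_cond; apply: eq_bigr => t.
    by move=> /andP[/andP[-> _] _].
  rewrite claim1 //; case: eqP => _; last by rewrite mul0r.
  by rewrite addSn exprS mulN1r mulrNN.
rewrite -(big_mkord xpredT (fun s => if (s < a)%N then _ * c s else 0)).
have ap : (a <= p.+1)%N by rewrite -ltnS.
rewrite (big_cat_nat (n := a)) //= [X in _ + X]big_nat_cond [X in _ + X]big1 ?addr0; last first.
  by move=> t /andP[/andP[ta _] _]; rewrite ltnNge ta.
have -> : \sum_(0 <= i < a) (if (i < a)%N then
    (if j == top a then (-1) ^+ (p.+1 + a) else 0) * c i else 0) =
    (if j == top a then (-1) ^+ (p.+1 + a) else 0) * \sum_(0 <= t < a) c t.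
  rewrite mulr_sumr big_nat_cond [RHS]big_nat_cond; apply: eq_bigr => t.
  by move=> /andP[/andP[_ ->] _].
have [->|a0] := posnP a; first by rewrite big_geq // mulr0.
by rewrite claim2 //; case: eqP => _; rewrite ?mul0r.
Qed.

End Interpolation.

(** * Truncations and their duals as pure strands *)

Section Strands.
Variable n : nat.

Definition rising (i : nat) : rat := \prod_(b < n.+1) (i + b.+1)%N%:R.

(* The Betti diagram of k[y_0..y_n] / m^(i+1), divided by rising i; the latter
   is (n+1)! times the length of the quotient. *)
Definition strand (i q : nat) (j : int) : rat :=
  if q is q'.+1 then
    if (q' <= n)%N && (j == (i + q)%N%:Z)
    then ((i + q)%N%:R * (q'`! * (n - q')`!)%N%:R)^-1 else 0
  else if j == 0 then (rising i)^-1 else 0.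

Lemma rising_gt0 i : 0 < rising i.
Proof. by apply: prodr_gt0 => b _; rewrite ltr0n addnS. Qed.

Lemma risingE i : rising i = ((i + n.+1) * n`! * 'C(n + i, n))%N%:R.
Proof.
have H r : \prod_(b < r) (i + b.+1)%N%:R * i`!%:R = (i + r)`!%:R :> rat.
  elim: r => [|r IH]; first by rewrite big_ord0 mul1r addn0.
  by rewrite big_ord_recr /= mulrAC IH addnS factS -natrM mulnC.
have i0 : (i`!%:R : rat) != 0 by rewrite pnatr_eq0 -lt0n fact_gt0.
apply: (mulIf i0); rewrite H -natrM; congr (_%:R).
have := bin_fact (leq_addr i n); rewrite addKn => E.
by rewrite addnS factS addnC -E; ring.
Qed.

Lemma rising_sum i : rising i = \sum_(d < i.+1) (n.+1)`!%:R * 'C(n + d, n)%:R.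
Proof.
elim: i => [|i IH].
  by rewrite big_ord1 risingE addn0 binn add0n factS !muln1 mulr1.
rewrite big_ord_recr -IH /= !risingE -!natrM -natrD; congr (_%:R).
have := bin_monomialS n i; rewrite factS => E.
have -> : ((i.+1 + n.+1) * n`! * 'C(n + i.+1, n) =
   n`! * (i.+1 * 'C(n + i.+1, n)) + n.+1 * n`! * 'C(n + i.+1, n))%N by ring.
by rewrite E; ring.
Qed.

(** Below degree i the least ranks of the two differentials fill the dimension of the strand, apart
    from the generator 1; in degree i no differential leaves, and above i everything is zero. The
    resolution is thus linear after its first step. *)
Lemma largest_betti_strand i q j :
  largest_betti n (fun d => (truncated_dim n i d)%:R) q j = rising i * strand i q j.
Proof.
have dimE (m : nat) : truncated_dim n i m%:Z = if (m <= i)%N then 'C(n + m, n) else 0%N.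
  by rewrite truncated_dimE /= lez_nat.
have dim_neg d : d < 0 -> truncated_dim n i d = 0%N.
  by move=> d0; rewrite truncated_dimE; case: ifP => //; lia.
rewrite /largest_betti; set d := j - q%:Z.
have jE : j = d + q%:Z by rewrite subrK.
have [dn|dp] := ltrP d 0.
  have -> : strand i q j = 0.
    rewrite /strand; case: q @d jE dn => [|q] d jE dn; first by case: eqP => //; lia.
    by rewrite andbC; case: eqP => //; lia.
  rewrite mulr0 (dim_neg d dn) mulr0 sub0r /least_krank (dim_neg d dn) mulr0 subr0.
  case: q @d jE dn => [|q] d jE dn; first by rewrite oppr0.
  have [->|d1] := eqVneq (d + 1) 0; first by rewrite !mul0r oppr0.
  by rewrite dim_neg ?mulr0 ?oppr0 //; lia.
case: d dp jE => // m _ jE.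
case: q jE => [|q] jE.
  rewrite /least_krank !bin0 mul1r subr0 addr0 mulr1 /strand jE addr0.
  case: m {jE} => [|m]; first by rewrite !mul0r subr0 dimE addn0 binn mulfV // gt_eqF ?rising_gt0.
  by rewrite mulr0 divff ?intr_eq0 // mul1r subrr.
have -> : m%:Z + 1 = m.+1%:Z by lia.
rewrite /least_krank !dimE.
have e1 : m.+1%:Z + q%:Z = (m + q.+1)%N%:Z by lia.
have e2 : m%:Z + q.+1%:Z = (m + q.+1)%N%:Z by lia.
rewrite e1 e2 -!pmulrn.
have ne : ((m + q.+1)%N%:R : rat) != 0 by rewrite pnatr_eq0 addnS.
have bk := congr1 (fun x => x%:R : rat) (bin_koszul n m q).
rewrite /= natrD !natrM addSnnS in bk.
have [lt|gt|eq] := ltngtP m i.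
- have -> : strand i q.+1 j = 0.
    by rewrite /strand jE andbC eqz_nat eqn_add2r; case: eqP => // E; move: lt; rewrite E ltnn.
  rewrite mulr0; apply: (mulfI ne).
  move: ((m + q.+1)%N%:R : rat) ne bk => N ne bk.
  rewrite !mulrBr -bk.
  by move: ('C(n, q)%:R : rat) ('C(n, q.+1)%:R : rat) ('C(n + m, n)%:R : rat)
    ('C(n + m.+1, n)%:R : rat) (m.+1%:R : rat) (m%:R : rat) => *; field.
- have -> : strand i q.+1 j = 0.
    by rewrite /strand jE andbC eqz_nat eqn_add2r; case: eqP => // E; move: gt; rewrite E ltnn.
  by rewrite !mulr0 !subr0.
rewrite mulr0 subr0 /strand jE -eq eqxx andbT.
have s0 := congr1 (fun x => x%:R : rat) (bin_monomialS n m); rewrite /= !natrM in s0.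
have [qn|nq] := leqP q n; last first.
  have c1 : 'C(n.+1, q.+1) = 0%N by rewrite bin_small.
  have c2 : 'C(n, q.+1) = 0%N by rewrite bin_small // ltnW.
  by rewrite c1 c2 !(mul0r, mulr0) subr0.
have qf : ((q`! * (n - q)`!)%N%:R : rat) != 0.
  by rewrite pnatr_eq0 -lt0n muln_gt0 !fact_gt0.
have bf := congr1 (fun x => x%:R : rat) (bin_fact qn); rewrite /= [LHS]natrM in bf.
move: bf qf; move: ((q`! * (n - q)`!)%N%:R : rat) => f bf qf.
rewrite risingE !natrM -bf; move: bk s0 ne.
have -> : (n + m.+1 = m + n.+1)%N by lia.
move: ((m + q.+1)%N%:R : rat) => N bk s0 ne.
apply: (mulfI ne); rewrite mulrBr -bk.
transitivity ((m + n.+1)%N%:R * 'C(n + m, n)%:R * 'C(n, q)%:R : rat).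
  rewrite -s0.
  by move: ('C(n, q)%:R : rat) ('C(n, q.+1)%:R : rat) ('C(n + m, n)%:R : rat)
    ('C(m + n.+1, n)%:R : rat) (m.+1%:R : rat) (m%:R : rat) => *; field.
by move: ('C(n, q)%:R : rat) ('C(n + m, n)%:R : rat) ((m + n.+1)%N%:R : rat) => *; field; rewrite ?ne ?qf.
Qed.

Lemma prod_distances N (a : nat) : (a <= N)%N ->
  \prod_(b < N.+1 | b != a :> nat) (a%:Z - (b : nat)%:Z)%:~R
  = (-1) ^+ (N - a) * (a`! * (N - a)`!)%N%:R :> rat.
Proof.
move=> /subnK <-; elim: (N - a)%N => [|r IH].
  rewrite add0n subnn big_mkcond big_ord_recr /= eqxx /= mulr1 expr0 mul1r fact0 muln1.
  rewrite -ffactnn ffact_prod natr_prod; apply: eq_bigr => b _; rewrite ltn_eqF //=.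
  by rewrite subzn ?pmulrn // ltnW.
transitivity ((\prod_(b < (r + a).+1 | b != a :> nat) (a%:Z - (b : nat)%:Z)%:~R)
    * (a%:Z - (r.+1 + a)%N%:Z)%:~R : rat).
  rewrite big_mkcond big_ord_recr /= [in RHS]big_mkcond /=; congr (_ * _).
  by case: eqP => //; lia.
rewrite IH !addnK factS exprS.
have -> : a%:Z - (r.+1 + a)%N%:Z = - (r.+1%:Z) by lia.
by rewrite rmorphN /= -pmulrn !natrM; ring.
Qed.

(** The degrees in the minimal resolution of the truncation: 0, then i+1, i+2 and so on. *)
Definition low_degree (i a : nat) : int := if a is 0 then 0 else (i + a)%N%:Z.

(** The degrees of the dual resolution, with homological degree a replaced by n+2-a and degree j by
    n+2+c-j; the exceptional last entry comes from the generator 1. *)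
Definition top_degree (c i a : nat) : int :=
  if a == n.+2 then (n.+2 + c)%N%:Z else ((c - i) + a)%N%:Z.

Lemma low_degree_strand i (a : 'I_n.+3) j :
  (if (a <= n.+1)%N && (j == low_degree i a) then
     (-1) ^+ (n.+1 + a) / \prod_(b < n.+2 | b != a :> nat)
       (low_degree i a - low_degree i b)%:~R else 0) = strand i a j.
Proof.
case: a => -[|a] /= lt.
  rewrite /strand; case: eqP => // _; rewrite big_mkcond big_ord_recl /= mul1r.
  have -> : \prod_(b < n.+1) (0 - low_degree i (lift ord0 b))%:~R = (-1) ^+ n.+1 * rising i :> rat.
    transitivity (\prod_(b < n.+1) (-1 * (i + b.+1)%N%:R) : rat).
      by apply: eq_bigr => b _; rewrite sub0r rmorphN /= -pmulrn mulN1r.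
    by rewrite big_split /= prodr_const card_ord.
  by rewrite addn0 invfM mulrA divff ?mul1r // signr_eq0.
rewrite /strand ltnS /= andbC [X in _ = if X then _ else _]andbC.
case: eqP => //= _; case: leqP => // an.
have -> : \prod_(b < n.+2 | b != a.+1 :> nat) ((i + a.+1)%N%:Z - low_degree i b)%:~R =
    (i + a.+1)%N%:R * ((-1) ^+ (n - a) * (a`! * (n - a)`!)%N%:R) :> rat.
  rewrite -prod_distances // big_mkcond big_ord_recl /= subr0 -pmulrn; congr (_ * _).
  rewrite [RHS]big_mkcond; apply: eq_bigr => b _; rewrite /= ?/bump ?leq0n ?add1n eqSS.
  by case: eqP => // _; congr (_%:~R); lia.
have -> : (-1) ^+ (n.+1 + a.+1) = (-1) ^+ (n - a) :> rat.
  have -> : (n.+1 + a.+1 = n - a + a.+1.*2)%N by lia.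
  by rewrite exprD -[X in _ * X]signr_odd odd_double expr0 mulr1.
by rewrite mulrCA invfM mulrA divff ?mul1r // signr_eq0.
Qed.

Lemma top_degree_strand c i (a : 'I_n.+3) j : (i <= c)%N ->
  (if (0 < a)%N && (j == top_degree c i a) then
     (-1) ^+ (n.+2 + a) / \prod_(b < n.+2 | b.+1 != a :> nat)
       (top_degree c i a - top_degree c i b.+1)%:~R else 0)
  = strand i (n.+2 - a) ((n.+2 + c)%N%:Z - j).
Proof.
move=> ic; case: a => -[|a] lt /=.
  by rewrite subn0 /strand ltnn.
have [an|na] := eqVneq a n.+1.
  rewrite an subnn /top_degree eqxx /strand subr_eq0 eq_sym; case: eqP => // _.
  rewrite big_mkcond big_ord_recr /= eqxx mulr1.
  have -> : \prod_(b < n.+1) (if b.+1 != n.+2 then ((n.+2 + c)%N%:Z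
      - (if b.+1 == n.+2 then (n.+2 + c)%N%:Z else (c - i + b.+1)%N%:Z))%:~R else 1) = rising i :> rat.
    rewrite /rising (reindex_inj rev_ord_inj); apply: eq_bigr => b _ /=.
    have bn := ltn_ord b; have -> : ((n.+1 - b.+1).+1 == n.+2) = false by lia.
    by rewrite /= pmulrn; congr (_%:~R); lia.
  by rewrite addnn -signr_odd odd_double expr0 mul1r.
have {lt na}an : (a <= n)%N by move: lt na; lia.
rewrite /top_degree eqSS; have -> : (a == n.+1) = false by lia.
have -> : (n.+2 - a.+1 = (n - a).+1)%N by lia.
rewrite /strand leq_subr /=.
have -> : ((n.+2 + c)%N%:Z - j == (i + (n - a).+1)%N%:Z) = (j == (c - i + a.+1)%N%:Z).
  by apply/eqP/eqP; lia.
case: eqP => // _; rewrite subKn //.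
have -> : \prod_(b < n.+2 | b.+1 != a.+1 :> nat)
    ((c - i + a.+1)%N%:Z - (if b.+1 == n.+2 then (n.+2 + c)%N%:Z else (c - i + b.+1)%N%:Z))%:~R
    = (-1) ^+ (n - a).+1 * ((i + (n - a).+1)%N%:R * (a`! * (n - a)`!)%N%:R) :> rat.
  rewrite exprS mulN1r mulNr mulrCA -prod_distances // big_mkcond big_ord_recr /= eqSS eqxx.
  have -> : (n.+1 != a) by lia.
  rewrite mulrC -mulNr pmulrn -rmorphN; congr (_%:~R * _); first by lia.
  rewrite [RHS]big_mkcond; apply: eq_bigr => b _; rewrite !eqSS.
  have -> : ((b : nat) == n.+1) = false by have := ltn_ord b; lia.
  by case: eqP => // _; congr (_%:~R); lia.
have -> : (-1) ^+ (n.+2 + a.+1) = (-1) ^+ (n - a).+1 :> rat.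
  have -> : (n.+2 + a.+1 = (n - a).+1 + a.+1.*2)%N by lia.
  by rewrite exprD -[X in _ * X]signr_odd odd_double expr0 mulr1.
by rewrite invfM mulrA divff ?mul1r ?signr_eq0 // [(a`! * _)%N]mulnC.
Qed.

(** The pair of strands with indices x and y receives the weight f x * g y / T. As both families sum
    to T, the marginals of these weights are f and g; the sum of the two strands of a pair is split
    by [mixed_sum]. *)
Lemma nonneg_pure_strands (u v : nat) (f g : nat -> rat) (T : rat) (E : diagram) :
  (forall i, 0 <= f i) -> (forall i, 0 <= g i) -> 0 < T ->
  \sum_(i < u.+1) f i = T -> \sum_(i < v.+1) g i = T ->
  (forall (q : 'I_n.+3) j, E q%:Z j = \sum_(i < u.+1) f i * strand i q j
     + \sum_(i < v.+1) g i * strand i (n.+2 - q) ((n.+2 + (u + v))%N%:Z - j)) ->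
  (forall q j, ~~ (0 <= q <= n.+2%:Z) -> E q j = 0) ->
  nonneg_pure_combination n.+2 E.
Proof.
move=> f_ge0 g_ge0 T_gt0 fT gT EE E0; set c := (u + v)%N in EE.
pose I := ('I_u.+1 * 'I_v.+1 * 'I_n.+2)%type.
pose low (x : I) := low_degree x.1.1; pose top (x : I) := top_degree c x.1.2.
have low_mono (x : I) a b : (a < b <= n.+1)%N -> low x a < low x b.
  by rewrite /low /low_degree; case: a b => [|a] [|b] //; lia.
have top_mono (x : I) a b : (0 < a < b)%N -> (b <= n.+2)%N -> top x a < top x b.
  move=> ab bn; rewrite /top /top_degree; have -> : (a == n.+2) = false by lia.
  by case: eqP => _; lia.
(* The indices are at most u and v and c = u + v, which is exactly what keeps a sequence increasing
   when it switches from low to top. *)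
have low_top (x : I) s : (s <= n.+1)%N -> low x s < top x s.+1.
  have xu := ltn_ord x.1.1; have xv := ltn_ord x.1.2.
  move=> sn; rewrite /low /top /top_degree /low_degree /c.
  by case: s sn => [|s] sn; case: eqP => _; lia.
pose mu (x : I) : rat := (-1) ^+ n.+2 * (top x x.2.+1 - low x x.2)%:~R
  * node_weight (fun b => (@mixed n.+1 (low x) (top x) x.2 b)%:~R) ord0.
pose co (x : I) : rat := f x.1.1 * g x.1.2 / T * mu x.
pose P (x : I) := pure_diagram (@mixed n.+1 (low x) (top x) x.2).
exists #|{: I}|, (fun m => @mixed n.+1 (low (enum_val m)) (top (enum_val m)) (enum_val m).2),
  (fun m => P (enum_val m)), (fun m => co (enum_val m)); split.
  move=> m; set x := enum_val m.
  have inc := mixed_increasing (low_mono x) (top_mono x) (low_top x) (ltn_ord x.2).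
  split=> //; first exact: pure_diagramP.
  apply: mulr_ge0; last exact: (mul_ge0 (low_mono x) (top_mono x) (low_top x) (ltn_ord x.2)).
  by apply: divr_ge0; [apply: mulr_ge0 | exact: ltW].
move=> q j.
transitivity (\sum_(x : I) co x * P x q j); last first.
  rewrite (reindex (fun m : 'I_#|{: I}| => enum_val m)) //=.
  exact: (onW_bij _ (enum_val_bij _)).
have [qn|qn] := boolP (0 <= q <= n.+2%:Z); last first.
  rewrite E0 // big1 // => x _.
  have [[zero _] _ _] := pure_diagramP
    (mixed_increasing (low_mono x) (top_mono x) (low_top x) (ltn_ord x.2)).
  by rewrite /P zero // mulr0.
have [a ->] : exists a : 'I_n.+3, q = a%:Z.
  case: q qn => // q; rewrite !lez_nat leq0n /= => qn.
  by exists (Ordinal (qn : (q < n.+3)%N)).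
rewrite EE -(pair_bigA _ (fun (y : 'I_u.+1 * 'I_v.+1) (s : 'I_n.+2) => co (y, s) * P (y, s) a%:Z j)) /=.
have inner (y : 'I_u.+1 * 'I_v.+1) :
    \sum_(s < n.+2) co (y, s) * P (y, s) a%:Z j =
    f y.1 * g y.2 / T * (strand y.1 a j + strand y.2 (n.+2 - a) ((n.+2 + c)%N%:Z - j)).
  have := mixed_sum (low_mono (y, ord0)) (top_mono (y, ord0)) (low_top (y, ord0)) a j.
  rewrite low_degree_strand top_degree_strand; last first.
    by have := ltn_ord y.2; rewrite /c /=; lia.
  by move=> <-; rewrite mulr_sumr; apply: eq_bigr => s _; rewrite mulrA.
rewrite (eq_bigr _ (fun y _ => inner y)).
rewrite -(pair_bigA _ (fun (x : 'I_u.+1) (y : 'I_v.+1) =>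
  f x * g y / T * (strand x a j + strand y (n.+2 - a) ((n.+2 + c)%N%:Z - j)))) /=.
have Tn : T != 0 by rewrite gt_eqF.
transitivity (\sum_(x < u.+1) \sum_(y < v.+1) (f x * strand x a j * (g y / T)
   + (f x / T) * (g y * strand y (n.+2 - a) ((n.+2 + c)%N%:Z - j)))); last first.
  by apply: eq_bigr => x _; apply: eq_bigr => y _; field.
transitivity ((\sum_(x < u.+1) f x * strand x a j) * (\sum_(y < v.+1) g y / T)
  + (\sum_(x < u.+1) f x / T) * (\sum_(y < v.+1) g y * strand y (n.+2 - a) ((n.+2 + c)%N%:Z - j))).
  by rewrite -!mulr_suml fT gT divff // mulr1 mul1r.
rewrite !mulr_suml -big_split; apply: eq_bigr => x _ /=.
by rewrite !mulr_sumr -big_split; apply: eq_bigr.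
Qed.

End Strands.

(** * Diagrams of truncations and cancellations *)
Section Layers.
Variables (n N : nat) (a : int -> rat).
Hypothesis a_supp : forall d, ~~ (0 <= d <= N%:Z) -> a d = 0.

Let ratio (i : nat) : rat := a i%:Z / 'C(n + i, n)%:R.

(* The multiplicity of k[y_0..y_n] / m^(i+1) in a module with Hilbert function
   a that is filtered by such truncations. *)
Definition layer (i : nat) : rat := ratio i - ratio i.+1.

Let binn0 i : ('C(n + i, n)%:R : rat) != 0.
Proof. by rewrite pnatr_eq0 -lt0n bin_gt0 leq_addr. Qed.

(** Degree d meets the layers from d on; their multiplicities telescope to the ratio at d, because
    the ratio at N+1 is 0. *)
Lemma layer_sum d : \sum_(i < N.+1) layer i * (truncated_dim n i d)%:R = a d.
Proof.
case: d => m; last by rewrite a_supp // big1 // => i _; rewrite truncated_dimE mulr0.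
transitivity (\sum_(0 <= i < N.+1) if (m <= i)%N then layer i * 'C(n + m, n)%:R else 0).
  rewrite big_mkord; apply: eq_bigr => i _; rewrite truncated_dimE /= lez_nat.
  by case: leqP; rewrite ?mulr0.
have [mN|Nm] := leqP m N; last first.
  rewrite a_supp; last by rewrite lez_nat -ltnNge.
  rewrite big_nat_cond big1 // => i /andP[/andP[_ iN] _].
  by rewrite ifN // -ltnNge; lia.
rewrite (big_cat_nat (n := m)) //=; last exact: leqW.
rewrite big_nat_cond big1 ?add0r; last by move=> i /andP[/andP[_ im] _]; rewrite leqNgt im.
transitivity ('C(n + m, n)%:R * \sum_(m <= i < N.+1) (ratio i - ratio i.+1)).
  rewrite mulr_sumr big_nat_cond [RHS]big_nat_cond.
  by apply: eq_bigr => i /andP[/andP[-> _] _]; rewrite mulrC.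
rewrite sumrB -opprB -sumrB telescope_sumr ?leqW //.
rewrite /ratio a_supp; last by lia.
by rewrite mul0r sub0r opprK mulrC mulfVK.
Qed.

(** Additivity of length, up to the factor (n+1)!. *)
Lemma layer_rising :
  \sum_(i < N.+1) layer i * rising n i = (n.+1)`!%:R * \sum_(d < N.+1) a (d : nat)%:Z.
Proof.
have E (i : 'I_N.+1) : rising n i = \sum_(d < N.+1) (n.+1)`!%:R * (truncated_dim n i (d : nat)%:Z)%:R.
  rewrite rising_sum (big_ord_widen N.+1 (fun d => (n.+1)`!%:R * 'C(n + d, n)%:R) (ltn_ord i)).
  rewrite big_mkcond; apply: eq_bigr => d _; rewrite truncated_dimE /= lez_nat ltnS.
  by case: leqP; rewrite ?mulr0.
under eq_bigr => i _ do rewrite E mulr_sumr.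
rewrite exchange_big mulr_sumr; apply: eq_bigr => d _ /=.
by rewrite -layer_sum mulr_sumr; apply: eq_bigr => i _; rewrite mulrCA.
Qed.

(** The hypothesis says that the ratio does not increase, since ['C(n + i.+1, n)] is (n+i+1) / (i+1)
    times ['C(n + i, n)]. *)
Lemma layer_ge0 i :
  i.+1%:R * a i.+1%:Z <= (i.+1 + n)%N%:R * a i%:Z -> 0 <= layer i.
Proof.
move=> le; rewrite subr_ge0 /ratio ler_pdivrMr; last by rewrite lt0r binn0 ler0n.
have i0 : 0 < i.+1%:R :> rat by [].
rewrite -(ler_pM2l i0) (le_trans le) // le_eqVlt; apply/orP; left; apply/eqP.
rewrite [RHS]mulrCA -[i.+1%:R * _]natrM bin_monomialS natrM [(n + i.+1)%N]addnC.
by move: (binn0 i) (a i) (i.+1 + n)%N => c0 ai N'; field.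
Qed.

End Layers.

Lemma largest_betti_layers n N a q j : (forall d, ~~ (0 <= d <= N%:Z) -> a d = 0) ->
  \sum_(i < N.+1) layer n a i * largest_betti n (fun d => (truncated_dim n i d)%:R) q j
  = largest_betti n a q j.
Proof.
move=> supp; rewrite largest_betti_sum; apply: eq_largest_betti => d.
exact: layer_sum.
Qed.

Lemma largest_betti_eq0 n a q j : (n.+1 < q)%N -> largest_betti n a q j = 0.
Proof.
case: q => // q nq; rewrite /largest_betti /least_krank !bin_small ?ltnS //.
  by rewrite !(mulr0, mul0r) !subr0.
exact: ltnW.
Qed.

Lemma least_krank_ge0 n a r d : (forall e, 0 <= a e) -> (forall e, e < 0 -> a e = 0) ->
  0 <= least_krank n a r d.
Proof.
move=> a_ge0 a_neg; case: r => //= q; have [d0|d0] := ltrP d 0; first by rewrite a_neg ?mulr0.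
by rewrite mulr_ge0 // divr_ge0 ?mulr_ge0 ?ler0z // addr_ge0.
Qed.

(** [e q j] is cancelled between columns q-1 and q, whence the shift in the coefficient of
    [cancellation_matrix]; its vanishing for q = 0 and q = p+1 keeps the cancellations inside the
    diagram, and [N] makes them finite in number. *)
Lemma cancellations_intro p (D D' : diagram) (e : nat -> int -> rat) (N : nat) :
  (forall q j, 0 <= e q j) -> (forall j, e 0%N j = 0) -> (forall j, e p.+1 j = 0) ->
  (forall q j, ~~ (0 <= j < N%:Z) -> e q j = 0) ->
  (forall i j, ~~ (0 <= i <= p%:Z) -> D i j = D' i j) ->
  (forall (q : nat) j, (q <= p)%N -> D q%:Z j = D' q%:Z j + (e q j + e q.+1 j)) ->
  (forall i j, 0 <= D' i j) -> consecutive_cancellations p D D'.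
Proof.
move=> e_ge0 e0 ep eN DD' DE D'_ge0.
exists [seq (q, m%:Z) | q <- enum 'I_p, m <- iota 0 N], (fun q => e q.+1); split=> //.
  by apply: allpairs_uniq; rewrite ?enum_uniq ?iota_uniq // => -[q m] [q' m'] _ _ [-> ->].
move=> i j; rewrite big_allpairs_dep big_enum /=.
have inner (q : 'I_p) : \sum_(m <- iota 0 N) e q.+1 m%:Z * cancellation_matrix q%:Z m%:Z i j
    = e q.+1 j * ((i == q%:Z) || (i == q%:Z + 1))%:R.
  have [jN|jN] := boolP (0 <= j < N%:Z); last first.
    rewrite eN // mul0r big_seq big1 // => m; rewrite mem_iota => mN.
    rewrite /cancellation_matrix andbC; case: (j =P m%:Z) => [E|_]; last by rewrite mulr0.
    by move: jN; rewrite E ltz_nat; lia.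
  case: j jN => // m; rewrite ltz_nat => /andP[_ mN].
  rewrite (bigD1_seq m) ?iota_uniq ?mem_iota //= /cancellation_matrix eqxx andbT.
  rewrite [X in _ + X]big1 ?addr0 // => m1 ne.
  by rewrite eqz_nat [m == m1]eq_sym (negPf ne) andbF mulr0.
rewrite (eq_bigr _ (fun q _ => inner q)).
have [ip|ip] := boolP (0 <= i <= p%:Z); last first.
  rewrite DD' // big1 ?subr0 // => q _; have qp := ltn_ord q.
  have -> : (i == q%:Z) || (i == q%:Z + 1) = false by lia.
  by rewrite mulr0.
case: i {inner} ip => // r; rewrite lez_nat /= => rp.
rewrite DE //; have split (q : 'I_p) : e q.+1 j * ((r%:Z == q%:Z) || (r%:Z == q%:Z + 1))%:R
    = (if (q : nat) == r then e r.+1 j else 0) + (if q.+1 == r then e r j else 0).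
  have [->|qr] := eqVneq (q : nat) r.
    by rewrite eqxx mulr1 gtn_eqF ?addr0.
  have -> : (r%:Z == q%:Z) || (r%:Z == q%:Z + 1) = (q.+1 == r).
    by rewrite eqz_nat [r == q]eq_sym (negPf qr) /=; apply/eqP/eqP; lia.
  by case: eqP => [->|_]; rewrite ?mulr1 ?mulr0 add0r.
rewrite (eq_bigr _ (fun q _ => split q)) big_split /=.
have -> : \sum_(q < p) (if (q : nat) == r then e r.+1 j else 0) = e r.+1 j.
  have [rp'|pr] := ltnP r p.
    rewrite (bigD1 (Ordinal rp')) //= eqxx big1 ?addr0 // => q ne; case: eqP => // E.
    by case/eqP: ne; apply: val_inj.
  rewrite big1 => [|q _]; last by rewrite ifN // ltn_eqF // (leq_trans _ pr).
  by have -> : r = p by lia.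
have -> : \sum_(q < p) (if q.+1 == r then e r j else 0) = e r j.
  case: r rp {split} => [|r] rp; first by rewrite big1.
  rewrite (bigD1 (Ordinal rp)) //= eqxx big1 ?addr0 // => q ne; case: eqP => // -[E].
  by case/eqP: ne; apply: val_inj.
by rewrite [e r.+1 j + _]addrC addrK.
Qed.

(** * The weak Lefschetz property *)
(** The part of degree c is non-zero and lies in the socle, because all higher degrees vanish; so
    the single degree of the socle is c. *)
Lemma socle_degree (k : fieldType) (n : nat) (M : gmod (polynomial_ring k n.+2))
    (h : int -> nat) (B : graded_basis M h) (c : nat) :
  is_graded M -> (0 < h c%:Z)%N -> (forall d, c%:Z < d -> h d = 0%N) ->
  level M -> forall x : M, socle x -> mhom c%:Z x.
Proof.
move=> M_graded h_c h_big [_ [s Ms]] x /Ms; suff -> : s = c%:Z by [].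
pose i0 := Ordinal h_c; pose y := gb B (d := c%:Z) i0.
have y_hom : mhom c%:Z y by exact: gb_hom.
have y_socle : socle y.
  move=> a [N [b [z [z_pos ->]]]]; rewrite scaler_suml big1 // => i _.
  have [e e0 ez] := z_pos i; have [_ hom] := is_graded_action M_graded.
  have zy : (z i : polynomial_ring k n.+2) *: y = 0.
    by apply: (mhom_eq0 B _ (hom _ _ _ _ ez y_hom)); apply: h_big; lia.
  by transitivity ((b i : polynomial_ring k n.+2) *: ((z i : polynomial_ring k n.+2) *: y)); [rewrite scalerA | rewrite zy scaler0].
apply/eqP; apply: contraT => sc; have y0 := mhom_disjoint M_graded sc (Ms _ y_socle) y_hom.
have := gc_gb B i0; rewrite -/y y0 -(lin0 (gb B (d := c%:Z))) gcK => /matrixP/(_ 0 i0)/eqP.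
by rewrite !mxE !eqxx eq_sym oner_eq0.
Qed.

Section WeakLefschetz.
Variables (k : fieldType) (n : nat).
Let R := polynomial_ring k n.+2.
Variables (l : {mpoly k[n.+2]}) (l_hom : l \is 1.-homog).
Variables (t0 : 'I_n.+2) (l_t0 : l@_(U_(t0)) != 0).
Variables (M : gmod R) (h : int -> nat) (B : graded_basis M h).
Hypothesis M_graded : is_graded M.
Hypothesis M_gen0 : generates (@mhom k R M 0).
Hypothesis h_neg : forall d, d < 0 -> h d = 0%N.
Variable u : nat.
Hypothesis h_u : (h u.+1%:Z <= h u%:Z)%N.
Hypothesis h_mono : forall v : nat, (v < u)%N -> (h v%:Z < h v.+1%:Z)%N.
Hypothesis wlp : lefschetz_element M l.

Let Mgr := is_graded_action M_graded.
Let gr := coordinates_grading (polynomial_coordinates l_hom l_t0).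
Let rl d := \rank (mult_mx B (l : R) (d - 1) d).

Lemma rank_lefschetz_le d : (rl d <= h (d - 1))%N /\ (rl d <= h d)%N.
Proof. by rewrite rank_leq_row rank_leq_col. Qed.

Lemma surjective_rank d : rl d = h d ->
  forall y : M, mhom d y -> exists2 x : M, mhom (d - 1) x & y = (l : R) *: x.
Proof.
move=> /eqP; rewrite -/(row_full _) => full y yd.
exists (lin (gb B (d := d - 1)) (gc B d y *m pinvmx (mult_mx B (l : R) (d - 1) d))).
  exact: lin_hom.
have d1 : d = d - 1 + 1 by rewrite subrK.
have [_ lg _] := wlp.
by rewrite (mult_mx_lin gr Mgr B _ lg d1) mulmxKpV ?submx_full // gbK.
Qed.

(** A strictly increasing Hilbert function excludes surjectivity, so the Lefschetz map is injective;
    in degrees d <= 0 its source is zero. *)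
Lemma rank_lefschetz_low d : d <= u%:Z -> rl d = h (d - 1).
Proof.
have [leR leC] := rank_lefschetz_le d.
have [d0 _|d0 du] := lerP d 0.
  by apply/eqP; rewrite eqn_leq leR h_neg //; lia.
have [_ _ /(_ d) [inj|surj]] := wlp; first exact: (rank_injective l_hom l_t0).
have rE : rl d = h d by apply: (rank_surjective l_hom B M_graded surj).
case: d d0 du leR leC rE {surj} => // -[|v] // _ vu leR _ rE; move: leR.
have vE : v.+1%:Z - 1 = v%:Z by lia.
rewrite rE vE => le; have uv : (v < u)%N by rewrite -lez_nat.
by have := h_mono uv; rewrite ltnNge le.
Qed.

(** Into degree u+1 injectivity would force equal dimensions and hence surjectivity as well;
    surjectivity then passes to all higher degrees. *)
Lemma rank_lefschetz_high d : u%:Z < d -> rl d = h d.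
Proof.
have surj_u : forall y : M, mhom u.+1%:Z y ->
    exists2 x : M, mhom (u.+1%:Z - 1) x & y = (l : R) *: x.
  have [_ _ /(_ u.+1%:Z) [inj|//]] := wlp.
  apply: surjective_rank; have [_ leC] := rank_lefschetz_le u.+1%:Z.
  apply/eqP; rewrite eqn_leq leC /= /rl (rank_injective l_hom l_t0 B M_graded inj).
  by have -> : u.+1%:Z - 1 = u%:Z by lia.
have surj (m : nat) : forall y : M, mhom (u.+1 + m)%N%:Z y ->
    exists2 x : M, mhom ((u.+1 + m)%N%:Z - 1) x & y = (l : R) *: x.
  elim: m => [|m IH]; first by rewrite addn0.
  rewrite addnS => y yd; have -> : (u.+1 + m).+1%:Z - 1 = (u.+1 + m)%N%:Z by lia.
  exact: (surjective_step l_hom l_t0 B M_graded M_gen0 IH).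
move=> ud; have -> : d = (u.+1 + absz (d - u.+1%:Z))%N%:Z by lia.
exact: (rank_surjective l_hom B M_graded (surj _)).
Qed.

Lemma hilbert_nonincreasing d : u%:Z <= d -> (h (d + 1) <= h d)%N.
Proof.
move=> ud; rewrite -rank_lefschetz_high; last by lia.
by have [] := rank_lefschetz_le (d + 1); rewrite addrK.
Qed.

Variable c : nat.
Hypothesis h_c : (0 < h c%:Z)%N.
Hypothesis h_big : forall d, c%:Z < d -> h d = 0%N.

Lemma peak_le : (u <= c)%N.
Proof.
rewrite leqNgt; apply/negP => /h_mono.
by rewrite [h c.+1%:Z]h_big // ltz_nat.
Qed.

(** Past u the Hilbert function does not increase, and it is positive at c >= u. The decomposition
    into pure diagrams divides by a multiple of h_u. *)
Lemma peak_gt0 : (0 < h u%:Z)%N.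
Proof.
have H (m : nat) : (h (u%:Z + m%:Z) <= h u%:Z)%N.
  elim: m => [|m IH]; first by rewrite addr0.
  apply: leq_trans IH; have -> : u%:Z + m.+1%:Z = u%:Z + m%:Z + 1 by lia.
  by apply: hilbert_nonincreasing; lia.
apply: leq_trans h_c _; have := H (c - u)%N.
by have := peak_le => uc; have -> : u%:Z + (c - u)%N%:Z = c%:Z by lia.
Qed.

End WeakLefschetz.

Theorem proposition6p3 (k : fieldType) (p : nat) (hp : (2 <= p)%N)
  (M : gmod (polynomial_ring k p))
  (M_graded : is_graded M)
  (M_fg : finitely_generated M)
  (M_artinian : artinian M)
  (M_level : level M)
  (M_gen0 : generates (@mhom k (polynomial_ring k p) M 0))
  (M_wlp : weak_lefschetz M)
  (h : {poly nat}) (c : nat)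
  (M_h : has_hvector M h) (h_deg : size h = c.+1)
  (l : polynomial_ring k p) (hl : lefschetz_element M l)
  (u : nat) (hu : (hcoef h u.+1 <= hcoef h u)%N)
  (u_min : forall v : nat, (v < u)%N -> (hcoef h v < hcoef h v.+1)%N) :
  let S := quotient_ring (fun f : polynomial_ring k p => f = l) in
  let E := Ediag p h c u S in
  [/\ forall i : nat, (i <= u)%N -> 0 <= fcoef p h u i,
      forall i : nat, (i <= c - u)%N -> 0 <= gcoef p h c u i,
      consecutive_cancellations p E (betti M)
    & nonneg_pure_combination p E].
Proof.
(* With p = n + 2 the quotient S has n + 1 variables. *)
case: p hp M M_graded M_fg M_artinian M_level M_gen0 M_wlp M_h l hl => [|[|n]] // _
  M M_graded _ _ M_level M_gen0 _ M_h l wlp S E.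
have [l0 l_hom _] := wlp.
have [t0 l_t0] := linear_form_neq0 l_hom l0.
pose th := polynomial_coordinates l_hom l_t0.
pose H := hcoef h.
have [B] : inhabited (graded_basis M H).
  by apply: (graded_basis_exists (coordinates_grading th) (is_graded_action M_graded) (h := H)); exact: M_h.
have H_neg d : d < 0 -> H d = 0%N by case: d.
have H_big d : c%:Z < d -> H d = 0%N.
  by case: d => // m; rewrite ltz_nat => cm; rewrite /H /= nth_default // h_deg.
have H_c : (0 < H c%:Z)%N.
  have : lead_coef h != 0%N by rewrite lead_coef_eq0 -size_poly_eq0 h_deg.
  by rewrite lead_coefE h_deg lt0n.
have M_socle := socle_degree B M_graded H_c H_big M_level.
pose rl (d : int) : nat := \rank (mult_mx B l (d - 1) d).
have rl_le d : (rl d <= H (d - 1)%R)%N /\ (rl d <= H d)%N by exact: rank_lefschetz_le.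
have rl_low d : d <= u%:Z -> rl d = H (d - 1) by exact: (rank_lefschetz_low l_hom l_t0 B M_graded H_neg hu u_min wlp).
have rl_high d : u%:Z < d -> rl d = H d by exact: (rank_lefschetz_high l_hom l_t0 B M_graded M_gen0 hu wlp).
have uc : (u <= c)%N by exact: (@peak_le H u u_min c H_big).
have Hu0 : (0 < H u%:Z)%N.
  exact: (peak_gt0 l_hom l_t0 B M_graded M_gen0 hu u_min wlp H_c H_big).
(* The Hilbert functions of the cokernel of l and of the dual of its kernel; degree e of the dual
   corresponds to degree c - e of the kernel. *)
pose a (d : int) : rat := (H d - rl d)%N%:R.
pose kap (e : int) : rat := (H (c%:Z - e)%R - rl (c%:Z - e + 1)%R)%N%:R.
have aE d : a d = (H d)%:R - (rl d)%:R by rewrite /a natrB //; have [] := rl_le d.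
have kapE e : kap e = (H (c%:Z - e))%:R - (rl (c%:Z - e + 1))%:R.
  by rewrite /kap natrB //; have := (rl_le (c%:Z - e + 1)).1; rewrite addrK.
have a_ge0 d : 0 <= a d by rewrite ler0n.
have kap_ge0 d : 0 <= kap d by rewrite ler0n.
have a_neg d : d < 0 -> a d = 0 by move=> d0; rewrite /a H_neg.
have kap_neg e : e < 0 -> kap e = 0 by move=> e0; rewrite /kap H_big //; lia.
have a_supp d : ~~ (0 <= d <= u%:Z) -> a d = 0.
  have [/a_neg //|d0 du] := ltrP d 0; rewrite aE rl_high ?subrr //; lia.
have kap_supp e : ~~ (0 <= e <= (c - u)%N%:Z) -> kap e = 0.
  have [/kap_neg //|e0 eu] := ltrP e 0; rewrite kapE rl_low; last lia.
  by rewrite addrK subrr.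
(* Up to degree u the form l is injective, so the cokernel has dimension h_d - h_(d-1). The second
   term is missing from f_u because the cokernel vanishes in degree u+1. *)
have fE i : (i <= u)%N -> fcoef n.+2 h u i = layer n a i.
  rewrite /fcoef /layer !subSS !subn0 -/H => iu.
  have alow (d : nat) : (d <= u)%N -> a d%:Z = (H d%:Z)%:R - (H (d%:Z - 1))%:R.
    by move=> du; rewrite aE rl_low.
  case: ltnP => ui; last first.
    have -> : i = u by lia.
    by rewrite alow // (a_supp u.+1%:Z) ?mul0r ?subr0 //; lia.
  rewrite !alow //; have -> : i.+1%:Z - 1 = i%:Z by lia.
  by have -> : i%:Z + 1 = i.+1%:Z by lia.
(* Above degree u the form l is surjective, so its kernel in degree c-e has dimension h_(c-e) -
   h_(c-e+1) for e <= c-u. *)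
have gE i : (i <= c - u)%N -> gcoef n.+2 h c u i = layer n kap i.
  rewrite /gcoef /layer !subSS !subn0 -/H => iu.
  have klow (e : nat) : (e <= c - u)%N ->
      kap e%:Z = (H (c%:Z - e%:Z))%:R - (H (c%:Z - e%:Z + 1))%:R.
    by move=> eu; rewrite kapE rl_high //; lia.
  case: ltnP => ui; last first.
    have -> : i = (c - u)%N by lia.
    rewrite klow // (kap_supp (c - u).+1%:Z) ?mul0r ?subr0; last lia.
    by have -> : c%:Z - (c - u)%N%:Z = u%:Z by lia.
  rewrite !klow //; have -> : c%:Z - i.+1%:Z + 1 = c%:Z - i%:Z by lia.
  by have -> : c%:Z - i.+1%:Z = c%:Z - i%:Z - 1 by lia.
have f_ge0 i : 0 <= layer n a i.
  apply: layer_ge0; rewrite /a -!natrM ler_nat.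
  exact: (cokernel_growth l_hom l_t0 B M_graded M_gen0).
have g_ge0 e : 0 <= layer n kap e.
  apply: layer_ge0; rewrite /kap -!natrM ler_nat.
  have ce : c%:Z - e%:Z + e%:Z = c%:Z by rewrite subrK.
  have := kernel_growth l_hom l_t0 B M_graded M_socle ce.
  have -> : c%:Z - e.+1%:Z + 1 = c%:Z - e%:Z by lia.
  by have -> : c%:Z - e.+1%:Z = c%:Z - e%:Z - 1 by lia.
have thS := quotient_coordinates l_hom l_t0.
have FE (q : nat) j : Fdiag n.+2 h u S q%:Z j = largest_betti n a q j.
  rewrite -(largest_betti_layers n q j a_supp); apply: eq_bigr => i _.
  by rewrite (fE i (ltn_ord i)); congr (_ * _); exact: (betti_truncation thS i q j).
have GE (q : nat) j : Gdiag n.+2 h c u S q%:Z j = largest_betti n kap q j.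
  rewrite -(largest_betti_layers n q j kap_supp); apply: eq_bigr => i _.
  by rewrite (gE i (ltn_ord i)); congr (_ * _); exact: (betti_truncation thS i q j).
have EE (q : nat) j : (q <= n.+2)%N -> E q%:Z j =
    largest_betti n a q j + largest_betti n kap (n.+2 - q) ((n.+2 + c)%N%:Z - j).
  by move=> qn; rewrite /E /Ediag FE subzn // GE.
have E0 q j : ~~ (0 <= q <= n.+2%:Z) -> E q j = 0.
  move=> qn; rewrite /E /Ediag; case: q qn => q qn.
    rewrite FE largest_betti_eq0; last by move: qn; rewrite lez_nat; lia.
    have -> : n.+2%:Z - q%:Z = Negz (q - n.+3) by move: qn; rewrite lez_nat; lia.
    by rewrite add0r /Gdiag big1 // => i _; rewrite mulr0.
  have -> : n.+2%:Z - Negz q = (n.+3 + q)%N%:Z by lia.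
  rewrite GE largest_betti_eq0; last lia.
  by rewrite addr0 /Fdiag big1 // => i _; rewrite mulr0.
split.
- by move=> i /fE ->.
- by move=> i /gE ->.
(* [K r d] is the rank of the differential that starts in exterior degree r and ends in degree d of
   [M], and [L r d] is its lower bound. In internal degree j this differential ends in degree d = j
   - r + 1. *)
- pose K r d : rat := (krank th B r (d - 1) d)%:R.
  pose L r d : rat := if r is q.+1 then ('C(n.+1, q) * rl d)%N%:R + least_krank n a q.+1 d
    + least_krank n kap (n.+2 - q) (c%:Z + 1 - d) else 0.
  pose e (r : nat) j := K r (j - r%:Z + 1) - L r (j - r%:Z + 1).
  have K_le q d : K q d + K q.+1 (d - 1) <= ('C(n.+2, q) * H (d - 1)%R)%N%:R.
    rewrite /K -natrD ler_nat; apply: krank_le; first exact: is_graded_action.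
      by rewrite subrK.
    by rewrite subrK.
  have K_ge0 r d : 0 <= K r d by exact: ler0n.
  have L_le q d : (q <= n.+1)%N -> L q.+1 d <= K q.+1 d.
    exact: (krank_lower_bound l_hom l_t0 B M_graded M_gen0 H_neg M_socle H_big).
  have L_ge0 r d : 0 <= L r d.
    case: r => // q; rewrite /L; apply: addr_ge0; last exact: least_krank_ge0.
    by apply: addr_ge0; [exact: ler0n | exact: least_krank_ge0].
  have e0 j : e 0%N j = 0 by rewrite /e /K krank0 subr0.
  have K_big r d : (n.+2 < r)%N -> K r d = 0.
    move=> nr; apply/eqP; rewrite eq_le K_ge0 andbT.
    apply: le_trans (_ : _ <= K r d + K r.+1 (d - 1)) _; first by rewrite lerDl K_ge0.
    by rewrite (le_trans (K_le _ _)) // bin_small.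
  have e_big r j : (n.+2 < r)%N -> e r j = 0.
    case: r => // q nq; rewrite /e K_big //; set d := j - _ + 1.
    rewrite /L /least_krank !bin_small //; last exact: ltnW.
    have -> : (n.+2 - q = 0)%N by lia.
    by rewrite mul0n mulr0n mulr0 !mul0r !addr0.
  have e_ge0 q j : 0 <= e q j.
    case: q => [|q]; first by rewrite e0.
    have [nq|qn] := ltnP n.+1 q; first by rewrite e_big.
    by rewrite subr_ge0 L_le.
  (* A non-zero differential from exterior degree q+1 ends in degree j - q of [M], which lies
     between 0 and c, and q is at most n+1; c + n + 3 is therefore a safe bound. *)
  have e_supp q j : ~~ (0 <= j < (c + n.+3)%N%:Z) -> e q j = 0.
    case: q => [|q] jN; first by rewrite e0.
    have [nq|qn] := ltnP n.+1 q; first by rewrite e_big.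
    apply/eqP; rewrite eq_le e_ge0 andbT /e; set d := j - _ + 1.
    have Hd : H d = 0%N.
      have [j0|j0] := ltrP j 0; [apply: H_neg | apply: H_big]; rewrite /d; lia.
    rewrite (le_trans (_ : _ <= K q.+1 d)) //; first by rewrite gerBl.
    have := K_le q (d + 1); rewrite addrK Hd muln0; apply: le_trans.
    by rewrite lerDr K_ge0.
  (* The multiples of [rl] inside [L] complete the dimensions of cokernel and kernel to h_d;
     Pascal's rule then combines the two binomial coefficients into ['C(n.+2, q)]. *)
  have DE (q : nat) j : (q <= n.+2)%N -> E q%:Z j = betti M q%:Z j + (e q j + e q.+1 j).
    move=> qn; rewrite (EE q j qn) (betti_koszul th (is_graded_action M_graded) B).
    rewrite /largest_betti /e.
    have -> : (n.+2 + c)%N%:Z - j - (n.+2 - q)%N%:Z = c%:Z - (j - q%:Z) by lia.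
    have -> : j - q.+1%:Z + 1 = j - q%:Z by lia.
    set d := j - q%:Z; rewrite -/(K q.+1 d).
    have -> : krank th B q d (d + 1) = krank th B q (d + 1 - 1) (d + 1) by rewrite addrK.
    rewrite -/(K q (d + 1)) aE kapE; have -> : c%:Z - (c%:Z - d) = d by lia.
    rewrite /L; have -> : c%:Z + 1 - d = c%:Z - d + 1 by lia.
    case: q qn @d => [|q] qn d.
      rewrite subn0 !(bin0, bin_small (ltnSn n.+1)) !mul1n /=.
      rewrite (bin_small (ltnW (ltnSn n.+1))).
      move: (_ / _ * a d) (_ / _ * kap (c%:Z - d + 1)) => *.
      by rewrite /K krank0; ring.
    have -> : c%:Z + 1 - (d + 1) = c%:Z - d by lia.
    have -> : (n.+2 - q.+1 = n.+1 - q)%N by lia.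
    have -> : ((n.+1 - q).+1 = n.+2 - q)%N by lia.
    rewrite bin_sub // ['C(n.+2, _)]binS !natrM natrD.
    by move: (least_krank _ _ _ _) (least_krank _ _ _ _)
      (least_krank _ _ _ _) (least_krank _ _ _ _) => *; ring.
  apply: (cancellations_intro e_ge0 e0 (fun j => e_big n.+3 j (ltnSn _)) e_supp _ DE).
    move=> q j qn; rewrite E0 //; case: q qn => // q qn; have nq : (n.+2 < q)%N by lia.
    rewrite (betti_koszul th (is_graded_action M_graded) B) bin_small // mul0n sub0r.
    set d := j - q%:Z; rewrite -/(K q.+1 d) (K_big q.+1 d (ltnW nq)) subr0.
    have -> : krank th B q d (d + 1) = krank th B q (d + 1 - 1) (d + 1) by rewrite addrK.
    by rewrite -/(K q (d + 1)) K_big // oppr0.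
  by case=> q j //; exact: ler0n.
(* The dimensions h_d - h_(d-1) of the cokernel telescope to h_u from below, and those of the kernel
   telescope to the same h_u from degree c downwards. *)
have sumf : \sum_(i < u.+1) layer n a i * rising n i = (n.+1)`!%:R * (H u%:Z)%:R.
  rewrite (layer_rising n a_supp); congr (_ * _).
  pose phi (d : nat) : rat := (H (d%:Z - 1))%:R.
  transitivity (\sum_(0 <= d < u.+1) (phi d.+1 - phi d)).
    rewrite big_mkord; apply: eq_bigr => d _; rewrite aE rl_low; last by have := ltn_ord d; lia.
    by rewrite /phi; have -> : d.+1%:Z - 1 = d%:Z by lia.
  rewrite telescope_sumr // /phi [H (0%:Z - 1)]H_neg // subr0.
  by have -> : u.+1%:Z - 1 = u%:Z by lia.
have sumg : \sum_(e < (c - u).+1) layer n kap e * rising n e = (n.+1)`!%:R * (H u%:Z)%:R.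
  rewrite (layer_rising n kap_supp); congr (_ * _).
  pose phi (e : nat) : rat := (H (c%:Z - e%:Z + 1))%:R.
  transitivity (\sum_(0 <= e < (c - u).+1) (phi e.+1 - phi e)).
    rewrite big_mkord; apply: eq_bigr => e _; rewrite kapE rl_high; last by have := ltn_ord e; lia.
    by rewrite /phi; have -> : c%:Z - e.+1%:Z + 1 = c%:Z - e%:Z by lia.
  rewrite telescope_sumr // /phi [H (c%:Z - 0%:Z + 1)]H_big ?subr0; last lia.
  by have -> : c%:Z - (c - u).+1%:Z + 1 = u%:Z by lia.
apply: (nonneg_pure_strands (f := fun i => layer n a i * rising n i)
  (g := fun i => layer n kap i * rising n i) _ _ _ sumf sumg _ E0) => [i|i||q j].
- by apply: mulr_ge0; rewrite // ltW ?rising_gt0.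
- by apply: mulr_ge0; rewrite // ltW ?rising_gt0.
- by apply: mulr_gt0; rewrite ltr0n ?fact_gt0.
rewrite (EE q j (ltn_ord q)) subnKC //; congr (_ + _).
  rewrite -(largest_betti_layers n q j a_supp); apply: eq_bigr => i _.
  by rewrite largest_betti_strand mulrA.
rewrite -(largest_betti_layers n (n.+2 - q) _ kap_supp); apply: eq_bigr => i _.
by rewrite largest_betti_strand mulrA.
Qed.
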